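(* Let $X=(X,\underline{\ast},\overline{\ast})$ be a biquandle, let $\mathcal{Q}(X)$ be its associated quandle, and let $D$ be a (broken surface) diagram of an oriented surface link. Then there exists a one-to-one correspondence between the set $\mathrm{Col}_X(D)$ of biquandle colorings of $D$ by $X$ and the set $\mathrm{Col}_{\mathcal{Q}(X)}(D)$ of quandle colorings of $D$ by $\mathcal{Q}(X)$.
   Context: A quandle is a set $Q$ with a binary operation $\ast$ such that $a\ast a=a$; for every $a$ the map $\bullet\mapsto\bullet\ast a$ is bijective; and $(a\ast b)\ast c=(a\ast c)\ast(b\ast c)$. A biquandle is a set $X$ with two binary operations $\underline{\ast},\overline{\ast}$ such that (BQ1) $x\,\underline{\ast}\,x=x\,\overline{\ast}\,x$; (BQ2) for every $x$ the maps $\bullet\mapsto\bullet\,\underline{\ast}\,x$ and $\bullet\mapsto\bullet\,\overline{\ast}\,x$ are bijective, and $H:X\times X\to X\times X$, $H(x,y)=(y\,\overline{\ast}\,x,\;x\,\underline{\ast}\,y)$, is bijective; (BQ3) for all $x,y,z$: $(x\underline{\ast}y)\underline{\ast}(z\underline{\ast}y)=(x\underline{\ast}z)\underline{\ast}(y\overline{\ast}z)$, $(x\overline{\ast}y)\overline{\ast}(z\overline{\ast}y)=(x\overline{\ast}z)\overline{\ast}(y\underline{\ast}z)$, $(x\underline{\ast}y)\overline{\ast}(z\underline{\ast}y)=(x\overline{\ast}z)\underline{\ast}(y\overline{\ast}z)$. Let $\bullet\,\overline{\ast}^{-1}x$ be the inverse of $\bullet\mapsto\bullet\,\overline{\ast}\,x$.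 $\mathcal{Q}(X)$ is the set $X$ with the operation $x\ast y:=(x\,\underline{\ast}\,y)\,\overline{\ast}^{-1}y$; this is known to be a quandle. A surface link is a closed surface smoothly embedded in $\mathbb{R}^4$; it is assumed to be oriented. A (broken surface) diagram $D$ is the image of the surface link under a generic projection $\mathbb{R}^4\to\mathbb{R}^3$ (whose singularities are double point curves, isolated triple points and isolated branch points), together with the relative height information, indicated by removing a neighborhood of the double point curves in the lower sheet. The orientations of the surface and of $\mathbb{R}^3$ determine a normal vector to each sheet, by a fixed convention. A sheet is a connected component obtained by cutting the surface along the double curves in the lower sheets only; a semi-sheet is a connected component obtained by cutting the surface along the double curves in both the upper and the lower sheets. Quandle coloring by $Q$: a map $\mathcal{C}$ from the set of sheets to $Q$ such that along each double curve, if $\alpha_j$ is the upper sheet and $\alpha_i,\alpha_k$ are the lower sheets such that the normal of $\alpha_j$ points from the side of $\alpha_i$ to the side of $\alpha_k$, then $\mathcal{C}(\alpha_i)\ast\mathcal{C}(\alpha_j)=\mathcal{C}(\alpha_k)$. $\mathrm{Col}_Q(D)$ is the set of these. Biquandle coloring by $X$: a map $\mathcal{C}$ from the set of semi-sheets to $X$ such that along each double curve (away from triple and branch points), if $\sigma_i$ (lower) and $\sigma_j$ (upper) are the semi-sheets adjacent to the local region from which the normals of both sheets point away, and $\sigma_k$ (lower), $\sigma_l$ (upper) are the other two semi-sheets, then $\mathcal{C}(\sigma_i)\,\underline{\ast}\,\mathcal{C}(\sigma_j)=\mathcal{C}(\sigma_k)$ and $\mathcal{C}(\sigma_j)\,\overline{\ast}\,\mathcal{C}(\sigma_i)=\mathcal{C}(\sigma_l)$.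 $\mathrm{Col}_X(D)$ is the set of these. *)

(* Defs.v *)
From mathcomp Require Import all_boot all_order all_algebra.
From mathcomp Require Import all_classical all_reals all_analysis.
Import Order.TTheory GRing.Theory Num.Theory numFieldNormedType.Exports.

Set Implicit Arguments.
Unset Strict Implicit.
Unset Printing Implicit Defensive.

Local Open Scope classical_set_scope.
Local Open Scope ring_scope.

(** * Quandles and biquandles *)

Record quandle := Quandle {
  qdl_car :> Type;
  qdl_op : qdl_car -> qdl_car -> qdl_car;
  qdl_idem : forall a, qdl_op a a = a;
  qdl_bij : forall a, bijective (fun x => qdl_op x a);
  qdl_dist : forall a b c,
    qdl_op (qdl_op a b) c = qdl_op (qdl_op a c) (qdl_op b c) }.

(* [biq_under x y] and [biq_over x y] are the operations written with an underlined
   and an overlined star. *)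
Record biquandle := Biquandle {
  bqd_car :> Type;
  biq_under : bqd_car -> bqd_car -> bqd_car;
  biq_over : bqd_car -> bqd_car -> bqd_car;
  bqd_diag : forall x, biq_under x x = biq_over x x;
  under_bij : forall x, bijective (fun y => biq_under y x);
  over_bij : forall x, bijective (fun y => biq_over y x);
  bqd_switch_bij :
    bijective (fun xy : bqd_car * bqd_car => (biq_over xy.2 xy.1, biq_under xy.1 xy.2));
  under_under : forall x y z,
    biq_under (biq_under x y) (biq_under z y) = biq_under (biq_under x z) (biq_over y z);
  over_over : forall x y z,
    biq_over (biq_over x y) (biq_over z y) = biq_over (biq_over x z) (biq_under y z);
  under_over : forall x y z,
    biq_over (biq_under x y) (biq_under z y) = biq_under (biq_over x z) (biq_over y z) }.

Section AssociatedQuandle.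
Variable X : biquandle.

Lemma over_inv_ex (x : X) :
  exists g : X -> X, cancel (fun y => biq_over y x) g /\ cancel g (fun y => biq_over y x).
Proof. by case: (over_bij x) => g gK Kg; exists g. Qed.

Definition over_inv (y x : X) : X := sval (cid (over_inv_ex x)) y.

Lemma overK (x y : X) : over_inv (biq_over y x) x = y.
Proof. by rewrite /over_inv; case: cid => g /= [gK _]; rewrite gK. Qed.

Lemma over_invK (x y : X) : biq_over (over_inv y x) x = y.
Proof. by rewrite /over_inv; case: cid => g /= [_ Kg]; rewrite Kg. Qed.

Definition assoc_op (x y : X) : X := over_inv (biq_under x y) y.

Lemma assoc_op_idem a : assoc_op a a = a.
Proof. by rewrite /assoc_op bqd_diag overK. Qed.

Lemma assoc_op_bij a : bijective (fun x => assoc_op x a).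
Proof.
case: (under_bij a) => g gK Kg.
exists (fun x => g (biq_over x a)) => x; rewrite /assoc_op ?over_invK ?gK //.
by rewrite Kg overK.
Qed.

Lemma assoc_op_dist a b c :
  assoc_op (assoc_op a b) c = assoc_op (assoc_op a c) (assoc_op b c).
Proof.
have inj z : injective (fun y : X => biq_over y z) by exact: bij_inj (over_bij z).
have opE x y : biq_over (assoc_op x y) y = biq_under x y by rewrite /assoc_op over_invK.
have conj x y z :
  biq_over (biq_over (assoc_op x y) z) (biq_over y z) = biq_under (biq_over x z) (biq_over y z).
  by rewrite over_over opE under_over.
apply: (inj c); apply: (inj (biq_over (assoc_op b c) c)).
rewrite (conj (assoc_op a c)) !opE.
by rewrite under_over opE under_under.
Qed.

Definition assoc_quandle : quandle :=
  Quandle assoc_op_idem assoc_op_bij assoc_op_dist.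

End AssociatedQuandle.

(** * Smooth maps *)

Fixpoint Cn_on (R : realType) (V W : normedModType R) (k : nat)
    (U : set V) (f : V -> W) : Prop :=
  if k is k'.+1 then
    (forall x, U x -> differentiable f x) /\
    (forall v, Cn_on k' U (fun x => 'D_v f x))
  else forall x, U x -> {for x, continuous f}.

(* Only used with [U] open. *)
Definition smooth_on (R : realType) (V W : normedModType R)
    (U : set V) (f : V -> W) : Prop := forall k, Cn_on k U f.

Definition diffeo_on (R : realType) (V W : normedModType R)
    (A : set V) (B : set W) (f : V -> W) (g : W -> V) : Prop :=
  [/\ open A /\ open B,
      smooth_on A f /\ smooth_on B g,
      set_fun A B f /\ set_fun B A g,
      {in A, cancel f g} & {in B, cancel g f}].

Definition cube (R : realType) (n : nat) : set 'rV[R]_n :=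
  [set u | forall i, `|u 0 i| < 1].
Arguments cube : clear implicits.

(** * Oriented closed surfaces in 4-space *)

(* A smooth parametrization, by the open unit square, of an open piece of the
   subset [S]: an immersion that is a homeomorphism onto an open subset of [S].
   The [i]-th row of ['J f u] is the [i]-th partial derivative of [f]. *)
Definition local_param (R : realType) (S : set 'rV[R]_4)
    (phi : 'rV[R]_2 -> 'rV[R]_4) : Prop :=
  [/\ smooth_on (cube R 2) phi,
      forall u, cube R 2 u -> row_free ('J phi u),
      set_inj (cube R 2) phi &
      forall A : set 'rV[R]_2, open A -> A `<=` cube R 2 ->
        exists2 U : set 'rV[R]_4, open U & phi @` A = S `&` U].

(* A closed surface smoothly embedded in R^4 with an orientation, given by an
   atlas of local parametrizations: where two of them meet, their coordinate
   frames differ by a matrix of positive determinant. *)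
Record surface_link (R : realType) := SurfaceLink {
  surf : set 'rV[R]_4;
  surf_compact : compact surf;
  atlas : set ('rV[R]_2 -> 'rV[R]_4);
  atlas_param : forall phi, atlas phi -> local_param surf phi;
  atlas_cover : forall p, surf p ->
    exists2 phi, atlas phi & (phi @` cube R 2) p;
  atlas_oriented : forall phi psi u v, atlas phi -> atlas psi ->
    cube R 2 u -> cube R 2 v -> phi u = psi v ->
    exists2 M : 'M[R]_2, 0 < \det M & 'J phi u = M *m 'J psi v }.

(** * Generic projections and diagrams *)

(* The three coordinate planes of R^3, and the Whitney umbrella. *)
Definition coord_plane (R : realType) (i : 'I_3) (u : 'rV[R]_2) : 'rV[R]_3 :=
  \row_(k < 3) (if unlift i k is Some j then u 0 j else 0).

Definition whitney_umbrella (R : realType) (u : 'rV[R]_2) : 'rV[R]_3 :=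
  let x := u 0 0 in let y := u 0 1 in
  \row_(k < 3) [:: x; x * y; y ^+ 2]`_k.

(* Over a neighbourhood [V] of [y], the surface [S] consists of [k] disjoint
   pieces, and in suitable smooth coordinates on these pieces and on [V],
   centred at [y], the projection of the [i]-th piece is [g i]. *)
Definition local_model (R : realType) (S : set 'rV[R]_4) (pr : 'M[R]_(4, 3))
    (y : 'rV[R]_3) (k : nat) (g : 'I_k -> 'rV[R]_2 -> 'rV[R]_3) : Prop :=
  exists (V : set 'rV[R]_3) (Psi Psi' : 'rV[R]_3 -> 'rV[R]_3)
         (phi : 'I_k -> 'rV[R]_2 -> 'rV[R]_4),
  [/\ V y /\ Psi y = 0,
      diffeo_on V (cube R 3) Psi Psi',
      forall i, local_param S (phi i),
      [set p | S p /\ V (p *m pr)] = \bigcup_i (phi i @` cube R 2)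
        /\ (forall i j u v, cube R 2 u -> cube R 2 v ->
              phi i u = phi j v -> i = j) &
      forall i u, cube R 2 u -> Psi (phi i u *m pr) = g i u].

(* Every point of the image is a regular point, a double point or a triple
   point (one, two or three coordinate planes), or a branch point. *)
Definition generic_projection (R : realType) (S : set 'rV[R]_4)
    (pr : 'M[R]_(4, 3)) : Prop :=
  forall p, S p ->
    (exists (k : nat) (k_le3 : (k <= 3)%N),
       local_model S pr (p *m pr)
         (fun i : 'I_k => @coord_plane R (widen_ord k_le3 i))) \/
    local_model S pr (p *m pr) (fun _ : 'I_1 => @whitney_umbrella R).

(* A diagram is recorded by the surface link, the linear projection onto R^3
   and the height function that it comes from; points and linear maps follow
   the row-vector convention. *)
Record diagram (R : realType) := Diagram {
  slink :> surface_link R;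
  projmx : 'M[R]_(4, 3);
  hgt : 'cV[R]_4;
  proj_hgt_unit : (row_mx projmx hgt : 'M[R]_4) \in unitmx;
  proj_generic : generic_projection (surf slink) projmx }.

Section Colorings.
Variables (R : realType) (D : diagram R).
Implicit Types (p q : 'rV[R]_4) (A : set 'rV[R]_4).

Definition height p : R := (p *m hgt D) 0 0.

Definition same_proj p q : Prop := p *m projmx D = q *m projmx D.

(* The points of the surface lying on the double curves (respectively on the
   double curves, in a lower sheet).  Their closures add the branch points, at
   which double curves end. *)
Definition double_set : set 'rV[R]_4 :=
  [set p | surf D p /\ exists q, [/\ surf D q, same_proj p q & p <> q]].

Definition lower_set : set 'rV[R]_4 :=
  [set p | surf D p /\
     exists q, [/\ surf D q, same_proj p q & height p < height q]].

(* The set of connected components of a subset of R^4. *)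
Definition component A : Type :=
  {B : set 'rV[R]_4 | (connected_component A @` A) B}.

Definition sheet : Type := component (surf D `\` closure lower_set).

Definition semi_sheet : Type := component (surf D `\` closure double_set).

(* [p] and [q] are the lower and upper points of the surface over a double
   point that is not a triple point. *)
Definition double_point p q : Prop :=
  [/\ surf D p /\ surf D q, same_proj p q, height p < height q &
      forall r, surf D r -> same_proj r p -> r = p \/ r = q].

Definition dot3 (v w : 'rV[R]_3) : R := (v *m w^T) 0 0.

Definition cross3 (v w : 'rV[R]_3) : 'rV[R]_3 :=
  \row_(k < 3) \det (col_mx (delta_mx 0 k : 'rV[R]_3) (col_mx v w) : 'M[R]_3).

(* [n] is a normal vector at [p] to the projected surface: (v, w, n) is
   positively oriented for every positive tangent frame (v, w). *)
Definition normal_vec p (n : 'rV[R]_3) : Prop :=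
  exists phi u, [/\ atlas D phi, cube R 2 u, phi u = p &
    n = cross3 (row 0 ('J phi u) *m projmx D) (row 1 ('J phi u) *m projmx D)].

(* [c] is a curve on the surface which at time 0 passes through [p] and whose
   projection crosses there the sheet of [q], in the direction of the normal
   of that sheet. *)
Definition crossing_curve p q (c : R -> 'rV[R]_4) : Prop :=
  [/\ c 0 = p, \forall t \near 0, surf D (c t), derivable c 0 1 &
      exists2 n, normal_vec q n & 0 < dot3 ('D_1 c 0 *m projmx D) n].

(* The piece [A] of the surface is adjacent to [p] from the side which the
   normal of the sheet of [q] points away from (respectively, to). *)
Definition behind p q A : Prop :=
  exists2 c, crossing_curve p q c & \forall t \near 0^'+, A (c (- t)).

Definition ahead p q A : Prop :=
  exists2 c, crossing_curve p q c & \forall t \near 0^'+, A (c t).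

Definition is_quandle_coloring (Q : quandle) (C : sheet -> Q) : Prop :=
  forall p q, double_point p q ->
  forall ai aj ak : sheet,
    behind p q (sval ai) -> sval aj q -> ahead p q (sval ak) ->
    qdl_op (C ai) (C aj) = C ak.

Definition is_biquandle_coloring (X : biquandle) (C : semi_sheet -> X) : Prop :=
  forall p q, double_point p q ->
  forall si sj sk sl : semi_sheet,
    behind p q (sval si) -> behind q p (sval sj) ->
    ahead p q (sval sk) -> ahead q p (sval sl) ->
    biq_under (C si) (C sj) = C sk /\ biq_over (C sj) (C si) = C sl.

Definition quandle_coloring (Q : quandle) : Type :=
  {C : sheet -> Q | is_quandle_coloring C}.

Definition biquandle_coloring (X : biquandle) : Type :=
  {C : semi_sheet -> X | is_biquandle_coloring C}.

End Colorings.

(* Main.v *)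
(** Idea.  Let [C] be a biquandle coloring, and let crossing a semi-sheet [s] along its
    normal act on maps [X -> X] by composition with the translation [x |-> biq_over x (C s)].
    Around a double curve the two ways of crossing both sheets have the same effect, by the
    axiom [over_over], so these actions are a locally constant transport on [R^3].  By
    continuation along segments it is trivial: there is a map [tau] from the regions of the
    complement of the projected surface to the automorphisms of the associated quandle,
    unique once its value at one region is fixed.  Moving [C s] back by the value of [tau]
    behind [s] gives a color that is the same on both sides of a double curve in the upper
    sheet and that changes by the quandle operation in the lower sheet, hence a quandle
    coloring.  Conversely, given a quandle coloring [c], let crossing [s] send [g] to its
    composite with the translation by [g (c s)]; this transport is also trivial, it has the
    same [tau], and [C s] is recovered by applying [tau] behind [s] to [c s].  Near a double
    or triple point [tau] is a function of the signs of the coordinates that vanish on the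
    sheets, and near a branch point there are only three regions and two semi-sheets, so no
    condition arises. *)

Require Import Defs.
From mathcomp Require Import all_boot all_order all_algebra.
From mathcomp Require Import all_classical all_reals all_analysis.
From mathcomp Require Import ring lra.
Import Order.TTheory GRing.Theory Num.Theory numFieldNormedType.Exports.

Set Implicit Arguments.
Unset Strict Implicit.
Unset Printing Implicit Defensive.

Local Open Scope classical_set_scope.
Local Open Scope ring_scope.

(** * Paths, matrices and cross products *)

(** The transport takes values in automorphisms of the associated quandle because the action of a
    quandle coloring depends on [g] itself: going around a double curve then works only if [g]
    respects the quandle operation. Recovering [g] from its image needs the map sending [x] to
    [biq_over x x] to be invertible, and this is drawn from the bijectivity of the switch map. The
    geometric obstacle is that continuation has to pass through double curves, triple points and
    branch points. Hence regions are never named: a section is a function on R^3, locally constant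
    off the projected surface, that obeys the crossing rule at regular points. Around every point of
    R^3 there are arbitrarily small neighbourhoods where a section exists with any prescribed value
    and is determined by one value. Sections are then continued along segments from a base point
    [y0], and two continuations are compared on intersections of convex tubes, which stands in for
    simple connectedness. Normalizing [tau y0] to the identity makes the correspondence
    one-to-one. *)

Lemma locally_constant_connected (T : topologicalType) (U : Type) (A : set T)
    (f : T -> U) : connected A ->
  (forall x, A x -> \forall y \near x, A y -> f y = f x) ->
  forall x y, A x -> A y -> f y = f x.
Proof.
move=> cA lc x y Ax Ay.
pose B := A `&` [set z | f z = f x].
have BA : B = A.
  apply: cA; first by exists x.
  - exists (interior [set z | A z -> f z = f x]); first exact: open_interior.
    apply/seteqP; split=> z [Az /= fz]; split=> //.
      by have := lc z Az; rewrite /interior /= -fz; apply: filterS => w /=.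
    exact: (nbhs_singleton fz).
  - exists (closure B); first exact: closed_closure.
    apply/seteqP; split=> z; first by move=> Bz; split; [case: Bz|exact: subset_closure].
    move=> [Az clz]; split => //=.
    have [w [[Aw fw] /(_ Aw) fzw]] := clz _ (lc z Az).
    by rewrite -fzw.
have : B y by rewrite BA.
by case.
Qed.

Section Paths.
Variable R : realType.

Lemma locally_constant_segment (U : Type) (f : R -> U) :
  (forall t : R, 0 <= t <= 1 -> \forall s \near t, 0 <= s <= 1 -> f s = f t) ->
  f 0 = f 1.
Proof.
move=> lc; apply: (@locally_constant_connected R U `[0, 1]%classic f
  (@segment_connected _ _ _)) => [t|/=|/=]; rewrite ?in_itv /= ?lexx ?ler01 //.
by move=> /lc; apply: filterS => s Hs; rewrite in_itv.
Qed.

Lemma connected_component_path (T : topologicalType) (A : set T) (c : R -> T) :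
  (forall t : R, 0 <= t <= 1 -> {for t, continuous c}) ->
  (forall t : R, 0 <= t <= 1 -> A (c t)) ->
  connected_component A (c 0) = connected_component A (c 1).
Proof.
move=> cc Ac; apply: same_connected_component.
have H : connected (c @` `[0, 1]%classic).
  apply: connected_continuous_connected; first exact: segment_connected.
  apply: continuous_in_subspaceT => t; rewrite inE /= in_itv /= => Ht.
  exact: cc.
apply: (connected_component_max _ _ H).
- by exists 0; rewrite //= in_itv /= lexx ler01.
- by move=> _ [t Ht <-]; apply: Ac; move: Ht; rewrite /= in_itv.
- by exists 1; rewrite //= in_itv /= lexx ler01.
Qed.

Lemma mx_continuous (T : topologicalType) m n (f : T -> 'M[R]_(m, n)) x :
  (forall i j, {for x, continuous (fun y => f y i j)}) -> {for x, continuous f}.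
Proof.
move=> fc A [P fP PA].
have : \forall y \near x, forall i j, P i j (f y i j).
  apply: filter_forall => i; apply: filter_forall => j.
  by apply: fc; exact: fP.
by apply: filterS => y Py; apply: PA.
Qed.

Lemma cvg_sum (I T : Type) (F : set_system T) {FF : Filter F} (r : seq I)
    (f : I -> T -> R) (l : I -> R) :
  (forall i, f i @ F --> l i) ->
  (fun y => \sum_(i <- r) f i y) @ F --> \sum_(i <- r) l i.
Proof.
move=> fl; elim: r => [|i r IH].
  rewrite big_nil (_ : (fun y => _) = cst 0); first exact: cvg_cst.
  by apply/funext => y; rewrite big_nil.
rewrite big_cons (_ : (fun y => _) = (f i \+ fun y => \sum_(k <- r) f k y)).
  exact: cvgD (fl i) IH.
by apply/funext => y; rewrite big_cons.
Qed.

Lemma cvg_minor (T : Type) (F : set_system T) {FF : Filter F} (f g h k : T -> R)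
    (a b c d : R) :
  f @ F --> a -> g @ F --> b -> h @ F --> c -> k @ F --> d ->
  (fun y => f y * g y - h y * k y) @ F --> a * b - c * d.
Proof. by move=> fa gb hc kd; exact: (cvgB (cvgM fa gb) (cvgM hc kd)). Qed.

Lemma mulmxr_continuous m n p (A : 'M[R]_(n, p)) :
  continuous (fun x : 'M[R]_(m, n) => x *m A).
Proof.
move=> x; apply: mx_continuous => i j; rewrite /prop_for /continuous_at mxE.
rewrite [X in X @ _](_ : _ = fun y : 'M[R]_(m, n) => \sum_k y i k * A k j).
  apply: (@cvg_sum _ _ _ (nbhs_filter x)) => k.
  by apply: (@cvgMr_tmp _ _ _ (nbhs_filter x)); exact: coord_continuous.
by apply/funext => y; rewrite mxE.
Qed.

Lemma mulmxr_differentiable n p (A : 'M[R]_(n, p)) (x : 'rV[R]_n) :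
  differentiable (fun y : 'rV[R]_n => y *m A) x.
Proof.
apply: (@linear_differentiable _ _ _ (mulmxr A : {linear 'rV[R]_n -> 'rV[R]_p})).
exact: mulmxr_continuous.
Qed.

Lemma diff_mulmxr n p (A : 'M[R]_(n, p)) (x v : 'rV[R]_n) :
  'd (fun y : 'rV[R]_n => y *m A) x v = v *m A.
Proof.
rewrite (@diff_lin _ _ _ (mulmxr A : {linear 'rV[R]_n -> 'rV[R]_p})) //.
exact: mulmxr_continuous.
Qed.

End Paths.

(** * Vectors of R^3 *)

Section Rows.
Variable R : realType.
Implicit Types a b g n v : 'rV[R]_3.

Definition row3 (x y z : R) : 'rV[R]_3 := \row_(k < 3) [:: x; y; z]`_k.

Lemma row3E0 x y z : row3 x y z 0 0 = x. Proof. by rewrite mxE. Qed.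
Lemma row3E1 x y z : row3 x y z 0 1 = y. Proof. by rewrite mxE. Qed.
Lemma row3E2 x y z : row3 x y z 0 2 = z. Proof. by rewrite mxE. Qed.
Definition row3E := (row3E0, row3E1, row3E2).

Lemma ord3 (P : 'I_3 -> Prop) : P 0 -> P 1 -> P 2 -> forall i, P i.
Proof.
move=> P0 P1 P2 [[|[|[|]]] // h].
- by rewrite (_ : Ordinal h = 0) //; apply: val_inj.
- by rewrite (_ : Ordinal h = 1) //; apply: val_inj.
- by rewrite (_ : Ordinal h = 2) //; apply: val_inj.
Qed.

Lemma sum3 (F : 'I_3 -> R) : \sum_(i < 3) F i = F 0 + F 1 + F 2.
Proof.
rewrite !big_ord_recl big_ord0 addr0 addrA.
by congr (F _ + F _ + F _); apply: val_inj.
Qed.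

Lemma row3_eta v : v = row3 (v 0 0) (v 0 1) (v 0 2).
Proof. by apply/rowP; apply: ord3; rewrite row3E. Qed.

Lemma dot3E v w : dot3 v w = v 0 0 * w 0 0 + v 0 1 * w 0 1 + v 0 2 * w 0 2.
Proof. by rewrite /dot3 mxE sum3 !mxE. Qed.

Lemma det3 (A : 'M[R]_3) : \det A =
  A 0 0 * (A 1 1 * A 2 2 - A 1 2 * A 2 1) - A 0 1 * (A 1 0 * A 2 2 - A 1 2 * A 2 0)
  + A 0 2 * (A 1 0 * A 2 1 - A 1 1 * A 2 0).
Proof.
pose f (i j : nat) := A (inord i) (inord j).
have -> : A = \matrix_(i, j) f i j by apply/matrixP => i j; rewrite mxE /f !inord_val.
rewrite (expand_det_row _ 0) sum3 /cofactor !(expand_det_row _ 0).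
rewrite !big_ord_recl !big_ord0 /cofactor !det_mx11 !mxE /= /bump /=; ring.
Qed.

Lemma cross3E v w : cross3 v w =
  row3 (v 0 1 * w 0 2 - v 0 2 * w 0 1) (v 0 2 * w 0 0 - v 0 0 * w 0 2)
       (v 0 0 * w 0 1 - v 0 1 * w 0 0).
Proof.
have c0 (a : 'rV[R]_3) j : (col_mx a (col_mx v w) : 'M[R]_3) 0 j = a 0 j.
  by rewrite -(col_mxEu a (col_mx v w) 0 j); congr (fun_of_matrix _ _ _); exact: val_inj.
have c1 (a : 'rV[R]_3) j : (col_mx a (col_mx v w) : 'M[R]_3) 1 j = v 0 j.
  by rewrite -(col_mxEu v w 0 j) -[RHS](col_mxEd a (col_mx v w)); congr (fun_of_matrix _ _ _);
    exact: val_inj.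
have c2 (a : 'rV[R]_3) j : (col_mx a (col_mx v w) : 'M[R]_3) 2 j = w 0 j.
  by rewrite -(col_mxEd v w 0 j) -[RHS](col_mxEd a (col_mx v w)); congr (fun_of_matrix _ _ _);
    exact: val_inj.
apply/rowP => k; rewrite mxE det3 !c0 !c1 !c2 !mxE.
by move: k; apply: ord3; rewrite /= ?mulr1n ?mulr0n; ring.
Qed.

(** A vector orthogonal to [a] and [b] is proportional to their cross product; the proportionality
    is written without division, so that it also makes sense for dependent [a] and [b]. *)
Lemma dot3_cross a b g v : dot3 g a = 0 -> dot3 g b = 0 ->
  dot3 g v * dot3 (cross3 a b) (cross3 a b) =
  dot3 v (cross3 a b) * dot3 g (cross3 a b).
Proof.
move=> ga gb; apply/eqP; rewrite -subr_eq0; apply/eqP.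
pose n := cross3 a b; pose u := cross3 v n.
(* By the Binet-Cauchy identity the difference is the scalar product of [cross3 g n] and [u], and
   the triple product formula expands [cross3 g n] in [a] and [b] with coefficients [dot3 g b] and
   [- dot3 g a]. *)
transitivity (dot3 g b * dot3 a u - dot3 g a * dot3 b u); last first.
  by rewrite ga gb !mul0r subrr.
by rewrite /u /n !(dot3E, cross3E, row3E); ring.
Qed.

Lemma cross3_lincomb a b (x y z w : R) :
  cross3 (x *: a + y *: b) (z *: a + w *: b) = (x * w - y * z) *: cross3 a b.
Proof.
by rewrite !cross3E; apply/rowP; apply: ord3; rewrite [RHS]mxE !row3E !mxE; ring.
Qed.

Lemma cross3_eq0 a b : cross3 a b = 0 ->
  exists x y : R, (x, y) != (0, 0) /\ x *: a + y *: b = 0.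
Proof.
rewrite cross3E => /rowP c0.
have := c0 0; have := c0 1; have := c0 2; rewrite !mxE /= => e2 e1 e0.
have [a0|] := eqVneq a 0.
  by exists 1, 0; rewrite a0 scaler0 scale0r addr0; split => //; rewrite xpair_eqE oner_eq0.
move=> a_neq0; have [k ak] : exists k, a 0 k != 0.
  apply: contrapT => /forallNP a0; move: a_neq0; rewrite -[_ != _]negbK => /negP; apply.
  by apply/negPn/eqP/rowP => k; rewrite mxE; apply/eqP/negPn/negP => /a0.
(* The vanishing 2-by-2 minors make [b 0 k *: a - a 0 k *: b] zero in every coordinate. *)
exists (b 0 k), (- a 0 k); split.
  by rewrite xpair_eqE oppr_eq0 negb_and ak orbT.
apply/rowP => j; rewrite !mxE.
move: k j {ak}; apply: ord3; apply: ord3; lra.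
Qed.

Lemma dot3_gt0 a : a != 0 -> 0 < dot3 a a.
Proof.
move=> a0; rewrite lt0r; apply/andP; split; last first.
  by rewrite dot3E !addr_ge0 // -expr2 sqr_ge0.
apply: contra a0; rewrite dot3E -!expr2 => /eqP h; apply/eqP/rowP.
have := sqr_ge0 (a 0 0); have := sqr_ge0 (a 0 1); have := sqr_ge0 (a 0 2) => h2 h1 h0.
by apply: ord3; rewrite mxE; apply/eqP; rewrite -sqrf_eq0; apply/eqP; lra.
Qed.

End Rows.

Lemma diff_compE (R : realType) (U V W : normedModType R) (f : U -> V) (g : V -> W) x v :
  differentiable f x -> differentiable g (f x) ->
  'd (g \o f) x v = 'd g (f x) ('d f x v).
Proof. by move=> df dg; rewrite (diff_comp df dg). Qed.

(** The difference quotients of [F \o c] at 0 tend to a positive [l], so for small times of either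
    sign they lie within [l] of it and are positive. *)
Lemma curve_sides (R : realType) (V : normedModType R) (c : R -> V) (F : V -> R) :
  derivable c 0 1 -> differentiable F (c 0) -> F (c 0) = 0 ->
  0 < 'd F (c 0) ('D_1 c 0) ->
  \forall t \near 0^'+, 0 < F (c t) /\ F (c (- t)) < 0.
Proof.
move=> dc dF F0 Fpos.
have dc' : differentiable c 0 by apply/derivable1_diffP.
have dFc : differentiable (F \o c) 0 by exact: differentiable_comp.
have E : 'd F (c 0) ('D_1 c 0) = 'D_1 (F \o c) 0.
  by rewrite (deriveE _ dFc) (deriveE _ dc') (diff_comp dc' dF).
rewrite {}E in Fpos; set l := 'D_(1 : R) (F \o c) 0 in Fpos.
have /derivable1_diffP dFc1 := dFc.
have : (fun h : R => h^-1 *: ((F \o c) (h *: (1 : R) + 0) - (F \o c) 0)) @ 0^' --> l.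
  exact: dFc1.
move=> /cvgrPdist_lt /(_ _ Fpos) /=.
rewrite /= F0 => /nbhs_ballP [e /= e0 He].
near=> t.
have tgt0 : 0 < t by [].
have tlte : t < e by near: t; exact: nbhs_right_lt.
split.
- have /(_ _) := He t; rewrite /ball /= sub0r normrN gtr0_norm // => /(_ tlte).
  move=> /(_ (lt0r_neq0 tgt0)); rewrite subr0 addr0 /= [_ *: 1]mulr1.
  rewrite ltr_distlC => /andP[+ _].
  by rewrite subrr pmulr_rgt0 // invr_gt0.
- have /(_ _) := He (- t); rewrite /ball /= sub0r normrN normrN gtr0_norm // => /(_ tlte).
  rewrite oppr_eq0 => /(_ (lt0r_neq0 tgt0)); rewrite subr0 addr0 /= [_ *: 1]mulr1.
  rewrite ltr_distlC => /andP[+ _].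
  by rewrite subrr nmulr_rgt0 // invr_lt0 oppr_lt0.
Unshelve. all: by end_near. Qed.

(** * Normals of a surface *)

Section LocalParam.
Variable R : realType.

Lemma open_cube n : open (cube R n).
Proof.
have H (u : 'rV[R]_n) (i : 'I_n) : cube R n u ->
    nbhs u [set v : 'rV[R]_n | `|v 0 i| < 1].
  move=> cu; have : (fun v : 'rV[R]_n => `|v 0 i|) @ u --> `|u 0 i|.
    exact: (cvg_norm (@coord_continuous R 1 n 0 i u)).
  by move=> /cvgr_lt /(_ _ (cu i)).
rewrite openE => u cu.
exact: (@filter_forall _ _ (fun i (v : 'rV[R]_n) => `|v 0 i| < 1) _
  (nbhs_filter (u : 'rV[R]_n)) (fun i => H u i cu)).
Qed.

Lemma smooth_differentiable (V W : normedModType R) (U : set V) (f : V -> W) x :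
  smooth_on U f -> U x -> differentiable f x.
Proof. by move=> /(_ 1%N) [+ _] Ux; apply. Qed.

Lemma smooth_derive_continuous (V W : normedModType R) (U : set V) (f : V -> W) v x :
  smooth_on U f -> U x -> {for x, continuous (fun y => 'D_v f y)}.
Proof. by move=> /(_ 1%N) [_ +] Ux => /(_ v); apply. Qed.

Lemma sign_inj (b b' : bool) (x : R) :
  0 < (-1) ^+ (~~ b) * x -> 0 < (-1) ^+ (~~ b') * x -> b = b'.
Proof. by case: b; case: b' => //=; rewrite !(mul1r, mulN1r) => ? ?; exfalso; lra. Qed.

(** A parametrization is open onto its image: a small neighbourhood of [u] is sent to the trace on
    [S] of an open set. *)
Lemma local_param_near (S : set 'rV[R]_4) phi u (Q : set 'rV[R]_2) :
  local_param S phi -> cube R 2 u -> (\forall v \near u, Q v) ->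
  \forall p \near phi u, S p -> exists v, [/\ cube R 2 v, Q v & phi v = p].
Proof.
move=> [_ _ _ phio] cu Qu.
pose A := interior (Q `&` cube R 2).
have oA : open A by exact: open_interior.
have Au : A u by apply: filterI => //; apply: open_nbhs_nbhs; split => //; exact: open_cube.
have Ac : A `<=` cube R 2 by move=> v /interior_subset [].
have [U oU phiA] := phio A oA Ac.
have Uu : U (phi u).
  by have [] : (S `&` U) (phi u) by rewrite -phiA; exists u.
have : \forall p \near phi u, U p by apply: open_nbhs_nbhs.
apply: filterS => p Up Sp.
have : (S `&` U) p by [].
by rewrite -phiA => -[v /interior_subset [Qv cv] <-]; exists v.
Qed.

Lemma local_param_surf (S : set 'rV[R]_4) phi u :
  local_param S phi -> cube R 2 u -> S (phi u).
Proof.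
move=> [_ _ _ phio] cu.
have [U _ phiA] := phio _ (@open_cube 2) (@subset_refl _ _).
by have [] : (S `&` U) (phi u) by rewrite -phiA; exists u.
Qed.

Lemma row_jacobian m n (f : 'rV[R]_m -> 'rV[R]_n) u i :
  row i ('J f u) = 'd f u (delta_mx 0 i).
Proof. by rewrite rowE /jacobian mul_rV_lin1. Qed.

End LocalParam.

Section Normals.
Variables (R : realType) (D : diagram R).
Local Notation S := (surf D).
Local Notation pr p := (p *m projmx D).
Implicit Types (p q : 'rV[R]_4) (n v w y : 'rV[R]_3) (F : 'rV[R]_3 -> R).

Lemma normal_vec_ex p : S p -> exists n, normal_vec D p n.
Proof.
by move=> /atlas_cover [phi aphi [u cu phiu]]; eexists; exists phi, u; split.
Qed.

Lemma row_mulmx2 (A : 'M[R]_2) (B : 'M[R]_(2, 4)) i :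
  row i (A *m B) = A i 0 *: row 0 B + A i 1 *: row 1 B.
Proof.
apply/rowP => j; rewrite !mxE !big_ord_recl big_ord0 addr0 /=.
by congr (_ * B _ j + A i _ * B _ j); apply: val_inj.
Qed.

Lemma det2 (A : 'M[R]_2) : \det A = A 0 0 * A 1 1 - A 0 1 * A 1 0.
Proof.
pose f (i j : nat) := A (inord i) (inord j).
have -> : A = \matrix_(i, j) f i j by apply/matrixP => i j; rewrite mxE /f !inord_val.
rewrite (expand_det_row _ 0) !big_ord_recl !big_ord0 /cofactor !det_mx11 !mxE /= /bump /=; ring.
Qed.

(** The tangent frames of two parametrizations differ by [M], which multiplies the cross product by
    [\det M]; this is positive because the atlas is oriented. *)
Lemma normal_vec_prop p n n' : normal_vec D p n -> normal_vec D p n' ->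
  exists2 d : R, 0 < d & n = d *: n'.
Proof.
move=> [phi [u [aphi cu phiu ->]]] [psi [v [apsi cv psiv ->]]].
have [M M0 ->] := atlas_oriented aphi apsi cu cv (etrans phiu (esym psiv)).
exists (\det M) => //.
by rewrite !row_mulmx2 !mulmxDl -!scalemxAl cross3_lincomb det2.
Qed.

Definition gradient (F : 'rV[R]_3 -> R) y : 'rV[R]_3 := \row_k 'd F y (delta_mx 0 k).

Lemma diff_gradient F y w : 'd F y w = dot3 (gradient F y) w.
Proof.
have lz k : 'd F y (w 0 k *: delta_mx 0 k) = 'd F y (delta_mx 0 k) * w 0 k.
  by rewrite mulrC linearZ.
by rewrite {1}(row_sum_delta w) linear_sum sum3 dot3E !lz !mxE.
Qed.

Definition vanishes_near (F : 'rV[R]_3 -> R) (p : 'rV[R]_4) :=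
  \forall p' \near p, S p' -> F (pr p') = 0.

(* [F] vanishes on the surface, so its differential kills the tangent plane and is
   therefore a multiple of the scalar product with the normal. *)
Lemma diff_normal F p n v : differentiable F (pr p) -> vanishes_near F p ->
  normal_vec D p n ->
  'd F (pr p) v * dot3 n n = dot3 v n * 'd F (pr p) n.
Proof.
move=> dF F0 [phi [u [aphi cu phiu ->]]].
pose g := gradient F (pr p); have gE := diff_gradient F (pr p).
have dphi : differentiable phi u.
  by have [sphi _ _ _] := atlas_param aphi; exact: smooth_differentiable sphi cu.
have tangent i : dot3 g (row i ('J phi u) *m projmx D) = 0.
  rewrite row_jacobian -gE -phiu.
  have dpr : differentiable (fun q => pr q) (phi u) by exact: mulmxr_differentiable.
  have dFpr : differentiable F ((fun q => pr q) (phi u)) by rewrite phiu.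
  have dprphi := differentiable_comp dphi dpr.
  have E : 'd F (pr (phi u)) ('d phi u (delta_mx 0 i) *m projmx D) =
    'd (F \o ((fun q => pr q) \o phi)) u (delta_mx 0 i).
    rewrite (diff_compE _ dprphi dFpr) (diff_compE _ dphi dpr) diff_mulmxr; reflexivity.
  rewrite {}E -(deriveE _ (differentiable_comp dprphi dFpr)).
  rewrite (@near_eq_derive _ _ _ _ (cst 0)); first exact: derive_cst.
  have Sphi : \forall w \near u, S (phi w).
    have : \forall w \near u, cube R 2 w by apply: open_nbhs_nbhs; split => //; exact: open_cube.
    by apply: filterS => w; apply: local_param_surf; exact: atlas_param aphi.
  have H : \forall w \near u, S (phi w) -> F (pr (phi w)) = 0.
    have C : phi @ u --> phi u := differentiable_continuous dphi.
    have F0u : nbhs (phi u) [set q | S q -> F (pr q) = 0] by rewrite phiu.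
    exact: C F0u.
  by apply: filterS2 Sphi H => w Sw /(_ Sw).
by rewrite !gE; exact: dot3_cross.
Qed.

Definition immersed p := forall n, normal_vec D p n -> n != 0.

Lemma diff_normal_neq0 F p n v : differentiable F (pr p) -> vanishes_near F p ->
  normal_vec D p n -> n != 0 -> 'd F (pr p) v != 0 -> 'd F (pr p) n != 0.
Proof.
move=> dF F0 pn n0 Fv; apply/negP => /eqP Fn.
have /eqP := diff_normal v dF F0 pn.
by rewrite Fn mulr0 mulf_eq0 (negbTE Fv) gt_eqF // dot3_gt0.
Qed.

Lemma diff_normal_sign F p n n' : normal_vec D p n -> normal_vec D p n' ->
  0 < 'd F (pr p) n -> 0 < 'd F (pr p) n'.
Proof.
move=> pn pn'; have [d d0 ->] := normal_vec_prop pn pn'.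
by rewrite !diff_gradient !dot3E !mxE => h; nra.
Qed.

(* The differential of [F] does not vanish on the normals, which vary continuously in a
   local parametrization, so its sign on them is locally constant. *)
Lemma orientation_const (F : 'rV[R]_3 -> R) (O : set 'rV[R]_3) (P : set 'rV[R]_4) :
  (forall y, O y -> differentiable F y) ->
  (forall v y, O y -> {for y, continuous (fun z => 'D_v F z)}) ->
  P `<=` S -> connected P -> (forall p, P p -> \forall q \near p, S q -> O (pr q)) ->
  (forall p, P p -> vanishes_near F p) ->
  (forall p, P p -> exists v, 'd F (pr p) v != 0) ->
  (forall p, P p -> immersed p) ->
  exists e : bool, forall p n, P p -> normal_vec D p n ->
    0 < (-1) ^+ e * 'd F (pr p) n.
Proof.
move=> dF cF PS cP PO F0 Fn0 imm.
have PO' p : P p -> O (pr p) by move=> Pp; apply: (nbhs_singleton (PO p Pp)); exact: PS.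
pose sg p := `[< exists2 n, normal_vec D p n & 0 < 'd F (pr p) n >].
have sgE p n : P p -> normal_vec D p n -> 0 < (-1) ^+ (~~ sg p) * 'd F (pr p) n.
  move=> Pp pn; case: (asboolP (exists2 n, normal_vec D p n & 0 < 'd F (pr p) n)) => h.
    have -> : sg p = true by apply/asboolP.
    by case: h => n' pn' /(diff_normal_sign pn' pn); rewrite /= mul1r.
  have -> : sg p = false by apply/negP => /asboolP.
  have [v Fv] := Fn0 p Pp.
  have := diff_normal_neq0 (dF _ (PO' _ Pp)) (F0 _ Pp) pn (imm _ Pp _ pn) Fv.
  rewrite neq_lt => /orP[|Fn]; first by rewrite expr1 mulN1r oppr_gt0.
  by case: h; exists n.
have lc p : P p -> \forall q \near p, P q -> sg q = sg p.
  move=> Pp; have [phi aphi [u cu phiu]] := atlas_cover (PS _ Pp).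
  have [sphi _ _ _] := atlas_param aphi.
  pose T i (z : 'rV[R]_2) := 'D_(delta_mx 0 i) phi z *m projmx D.
  pose N (z : 'rV[R]_2) := cross3 (T 0 z) (T 1 z).
  have nN (z : 'rV[R]_2) : cube R 2 z -> normal_vec D (phi z) (N z).
    move=> cw; exists phi, z; split => //.
    by rewrite !row_jacobian /N /T !deriveE //; exact: smooth_differentiable sphi cw.
  pose h (z : 'rV[R]_2) := \sum_k 'D_(delta_mx 0 k) F (pr (phi z)) * N z 0 k.
  have hE (z : 'rV[R]_2) : O (pr (phi z)) -> h z = 'd F (pr (phi z)) (N z).
    by move=> Ow; rewrite diff_gradient dot3E /h sum3 !mxE !deriveE //; exact: dF.
  have cD i : {for u, continuous (fun z => 'D_(delta_mx 0 i) phi z)}.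
    exact: smooth_derive_continuous sphi cu.
  have cT i : {for u, continuous (T i)}.
    exact: (continuous_comp (cD i) (@mulmxr_continuous R _ _ _ _ _)).
  have cpr : {for u, continuous (fun z => pr (phi z))}.
    apply: (continuous_comp _ (@mulmxr_continuous R _ _ _ _ _)).
    by apply: differentiable_continuous; exact: smooth_differentiable sphi cu.
  have cTk i k : {for u, continuous (fun z => T i z 0 k)}.
    exact: (continuous_comp (cT i) (@coord_continuous R _ _ 0 k _)).
  have cN k : {for u, continuous (fun z => N z 0 k)}.
    move: k; apply: ord3.
    - have E z : N z 0 0 = T 0 z 0 1 * T 1 z 0 2 - T 0 z 0 2 * T 1 z 0 1.
        by rewrite /N cross3E row3E0.
      rewrite (funext E).
      by apply: (@cvg_minor R _ (nbhs u) (nbhs_filter u)); exact: cTk.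
    - have E z : N z 0 1 = T 0 z 0 2 * T 1 z 0 0 - T 0 z 0 0 * T 1 z 0 2.
        by rewrite /N cross3E row3E1.
      rewrite (funext E).
      by apply: (@cvg_minor R _ (nbhs u) (nbhs_filter u)); exact: cTk.
    - have E z : N z 0 2 = T 0 z 0 0 * T 1 z 0 1 - T 0 z 0 1 * T 1 z 0 0.
        by rewrite /N cross3E row3E2.
      rewrite (funext E).
      by apply: (@cvg_minor R _ (nbhs u) (nbhs_filter u)); exact: cTk.
  have ch : h @ u --> h u.
    apply: (@cvg_sum R _ _ (nbhs u) (nbhs_filter u)) => k.
    apply: (@continuousM R _ _ _ u); last exact: cN.
    have cDF : {for pr (phi u), continuous (fun y => 'D_(delta_mx 0 k) F y)}.
      by apply: cF; rewrite phiu; exact: PO'.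
    exact: (continuous_comp cpr cDF).
  have h0 : 0 < (-1) ^+ (~~ sg p) * h u.
    by rewrite hE phiu; [apply: sgE => //; rewrite -phiu; exact: nN | exact: PO'].
  have : \forall z \near u, 0 < (-1) ^+ (~~ sg p) * h z.
    have : (fun z => (-1) ^+ (~~ sg p) * h z) @ u --> (-1) ^+ (~~ sg p) * h u.
      exact: (@cvgMl_tmp R _ (nbhs u) (nbhs_filter u) h _ _ ch).
    by move=> /cvgr_gt; apply.
  move=> /(local_param_near (atlas_param aphi) cu); rewrite phiu => H.
  apply: filterS H => q Hq Pq; have [z [cw hw phiw]] := Hq (PS _ Pq).
  rewrite hE ?phiw in hw; last exact: PO'.
  have qn := nN z cw; rewrite phiw in qn.
  exact: sign_inj (sgE q _ Pq qn) hw.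
have [[p0 Pp0]|P0] := pselect (exists p, P p); last first.
  by exists true => p n Pp; case: P0; exists p.
exists (~~ sg p0) => p n Pp pn.
by rewrite -(locally_constant_connected cP lc Pp0 Pp); exact: sgE.
Qed.

End Normals.

(** * Charts around double and triple points *)

Section Coordinates.
Variable R : realType.

Definition box (r : R) : set 'rV[R]_3 := [set w | forall i, `|w 0 i| < r].

Lemma near_coord n (u : 'rV[R]_n) i (P : set R) :
  (\forall x \near u 0 i, P x) -> nbhs u [set v : 'rV[R]_n | P (v 0 i)].
Proof. by move=> uP; exact: (@coord_continuous R 1 n 0 i u _ uP). Qed.

Lemma near_norm_lt (x r : R) : `|x| < r -> \forall z \near x, `|z| < r.
Proof.
move=> xr; have : (fun z : R => `|z|) @ x --> `|x| by exact: norm_continuous.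
by move=> /cvgr_lt; apply.
Qed.

Lemma near_box r w : box r w -> \forall v \near w, box r v.
Proof.
move=> bw; apply: (@filter_forall _ _ (fun i (v : 'rV[R]_3) => `|v 0 i| < r) _
  (nbhs_filter (w : 'rV[R]_3))) => i.
by apply: (@near_coord 3 w i [set x | `|x| < r]); exact: near_norm_lt.
Qed.

(** Deleting a coordinate is written as a matrix product, as are the sign changes of [flipmx] below,
    so that differentiability and derivatives come from linear maps. *)
Definition dropmx (i : 'I_3) : 'M[R]_(3, 2) := \matrix_(a, j) (a == lift i j)%:R.

Lemma dropE i (w : 'rV[R]_3) j : (w *m dropmx i) 0 j = w 0 (lift i j).
Proof.
rewrite mxE (bigD1 (lift i j)) //= mxE eqxx mulr1 big1 ?addr0 // => a ai.
by rewrite mxE (negbTE ai) mulr0.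
Qed.

Lemma coord_plane_drop i (w : 'rV[R]_3) : w 0 i = 0 -> coord_plane i (w *m dropmx i) = w.
Proof.
move=> wi; apply/rowP => k; rewrite mxE.
by case: unliftP => [j ->|->]; rewrite ?dropE.
Qed.

Lemma drop_coord_plane i (u : 'rV[R]_2) : coord_plane i u *m dropmx i = u.
Proof. by apply/rowP => j; rewrite dropE mxE liftK. Qed.

Lemma coord_plane_self i (u : 'rV[R]_2) : coord_plane i u 0 i = 0.
Proof. by rewrite mxE unlift_none. Qed.

Lemma cube_coord_plane i (u : 'rV[R]_2) : cube R 2 u -> box 1 (coord_plane i u).
Proof. by move=> cu k; rewrite mxE; case: unliftP => [j _|_] //; rewrite normr0. Qed.

Lemma cube_drop i (w : 'rV[R]_3) : box 1 w -> cube R 2 (w *m dropmx i).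
Proof. by move=> bw j; rewrite dropE. Qed.

Definition flipmx (e : 'I_3 -> bool) : 'M[R]_3 := diag_mx (\row_k (-1) ^+ e k).

Lemma flipE e (w : 'rV[R]_3) k : (w *m flipmx e) 0 k = (-1) ^+ e k * w 0 k.
Proof. by rewrite mul_mx_diag !mxE mulrC. Qed.

Lemma flipK e (w : 'rV[R]_3) : w *m flipmx e *m flipmx e = w.
Proof. by apply/rowP => k; rewrite !flipE mulrA -expr2 sqrr_sign mul1r. Qed.

Lemma box_flip e r (w : 'rV[R]_3) : box r w -> box r (w *m flipmx e).
Proof. by move=> bw k; rewrite flipE normrM normr_sign mul1r. Qed.

Lemma diff_coordE (V : normedModType R) n (f : V -> 'rV[R]_n) x v i :
  differentiable f x -> 'd (fun y => f y 0 i) x v = ('d f x v) 0 i.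
Proof.
move=> df.
have dfi : differentiable (fun y => f y 0 i) x.
  exact: (differentiable_comp df (@differentiable_coord R _ _ _ 0 i)).
rewrite -(deriveE v dfi) -(deriveE v df) derive_mx ?mxE //.
exact: diff_derivable.
Qed.

Lemma differentiable_coordE (V : normedModType R) n (f : V -> 'rV[R]_n) x i :
  differentiable f x -> differentiable (fun y => f y 0 i) x.
Proof. by move=> df; exact: (differentiable_comp df (@differentiable_coord R _ _ _ 0 i)). Qed.

Lemma smooth_coord_derive_continuous (V : normedModType R) n (U : set V)
    (f : V -> 'rV[R]_n) v x i : open U -> smooth_on U f -> U x ->
  {for x, continuous (fun y => 'D_v (fun z => f z 0 i) y)}.
Proof.
move=> oU sf Ux.
have E y : U y -> 'D_v (fun z => f z 0 i) y = ('D_v f y) 0 i.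
  move=> Uy; have df := smooth_differentiable sf Uy.
  by rewrite deriveE ?diff_coordE // -?deriveE //; exact: differentiable_coordE.
have C : {for x, continuous (fun y => ('D_v f y) 0 i)}.
  have cD : {for x, continuous (fun y => 'D_v f y)} by exact: smooth_derive_continuous sf Ux.
  exact: (continuous_comp cD (@coord_continuous R 1 n 0 i ('D_v f x))).
rewrite /prop_for /continuous_at E //.
apply: cvg_trans C; apply: near_eq_cvg.
have : \forall y \near x, U y by apply: open_nbhs_nbhs.
by apply: filterS => y Uy; rewrite E.
Qed.

Lemma convex_gt0 (x y t : R) : 0 < x -> 0 < y -> 0 <= t <= 1 -> 0 < (1 - t) * x + t * y.
Proof.
move=> x0 y0 /andP[t0 t1]; have [->|tn0] := eqVneq t 0; first by rewrite subr0 mul1r mul0r addr0.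
apply: ltr_wpDl; first by rewrite mulr_ge0 ?subr_ge0 // ltW.
by rewrite mulr_gt0 // lt0r tn0.
Qed.

Lemma convex_norm_lt (r x y t : R) : `|x| < r -> `|y| < r -> 0 <= t <= 1 ->
  `|(1 - t) * x + t * y| < r.
Proof.
rewrite !ltr_norml => /andP[? ?] /andP[? ?] t01.
have h1 : 0 < (1 - t) * (r - x) + t * (r - y) by apply: convex_gt0; rewrite ?subr_gt0.
have h2 : 0 < (1 - t) * (x + r) + t * (y + r) by apply: convex_gt0; rewrite // -ltrBlDr sub0r.
by apply/andP; split; lra.
Qed.

Definition seg m (w w' : 'rV[R]_m) (t : R) : 'rV[R]_m := w + t *: (w' - w).

Lemma seg0 m (w w' : 'rV[R]_m) : seg w w' 0 = w.
Proof. by rewrite /seg scale0r addr0. Qed.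

Lemma seg1 m (w w' : 'rV[R]_m) : seg w w' 1 = w'.
Proof. by rewrite /seg scale1r addrC subrK. Qed.

Lemma segE m (w w' : 'rV[R]_m) t k : seg w w' t 0 k = (1 - t) * w 0 k + t * w' 0 k.
Proof. by rewrite !mxE; ring. Qed.

Lemma seg_continuous m (w w' : 'rV[R]_m) : continuous (seg w w').
Proof.
move=> t; apply: cvgD; first exact: cvg_cst.
exact: scalel_continuous.
Qed.

Lemma convex_connected m (A : set 'rV[R]_m) :
  (forall w w' t, A w -> A w' -> 0 <= t <= 1 -> A (seg w w' t)) -> connected A.
Proof.
move=> convA; have [[a Aa]|nA] := pselect (exists a, A a); last first.
  suff -> : A = set0 by exact: connected0.
  by apply/seteqP; split=> // a Aa; apply: nA; exists a.
suff -> : A = connected_component A a by exact: component_connected.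
apply/seteqP; split=> [w Aw|w]; last exact: connected_component_sub.
rewrite -[a](seg0 a w) (@connected_component_path R _ A (seg a w)) ?seg1.
- exact: connected_component_refl.
- by move=> t _; exact: seg_continuous.
- by move=> t; exact: convA.
Qed.

Lemma connected_cube m : connected (cube R m).
Proof.
apply: convex_connected => w w' t cw cw' t01 i; rewrite segE.
exact: convex_norm_lt.
Qed.

End Coordinates.

(** * Charts and the sheets over them *)

Section Charts.
Variables (R : realType) (D : diagram R).
Local Notation S := (surf D).
Local Notation pr p := (p *m projmx D).
Implicit Types (p q : 'rV[R]_4) (n w y : 'rV[R]_3).

(* Coordinates [coords c] on an open piece of R^3 centred at [point c 0], with values in
   the cube of half-side [rad c]; [point c] is their inverse. *)
Record chart := Chart {
  rad : R;
  rad_gt0 : 0 < rad;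
  coords : 'rV[R]_3 -> 'rV[R]_3;
  point : 'rV[R]_3 -> 'rV[R]_3;
  point_diff : forall w, box rad w -> differentiable point w;
  pointK : forall w, box rad w -> coords (point w) = w;
  coords_diff : forall w, box rad w -> differentiable coords (point w);
  chart_near : forall w, box rad w ->
    \forall y \near point w, exists2 w', box rad w' & point w' = y }.

Lemma point_continuous (c : chart) w : box (rad c) w -> {for w, continuous (point c)}.
Proof. by move=> bw; apply: differentiable_continuous; exact: point_diff. Qed.

Lemma diff_coords_point (c : chart) w v : box (rad c) w ->
  'd (coords c) (point c w) ('d (point c) w v) = v.
Proof.
move=> bw; have dp := point_diff bw; have dc := coords_diff bw.
rewrite -(diff_compE v dp dc) -(deriveE v (differentiable_comp dp dc)).
rewrite (@near_eq_derive _ _ _ _ id) ?derive_id //.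
by apply: filterS (near_box bw) => w' bw'; rewrite /= pointK.
Qed.

(* Over the chart, the surface consists of the sheets [w 0 i = 0] for [i] in [wall], and
   [lft i w] is the point over [w] in the [i]-th sheet.  By [lift_orient], the normal of
   the [i]-th sheet points to the side [0 < w 0 i]. *)
Record planes (c : chart) (wall : pred 'I_3) (lft : 'I_3 -> 'rV[R]_3 -> 'rV[R]_4) : Prop :=
  Planes {
  lift_surf : forall i w, wall i -> box (rad c) w -> w 0 i = 0 -> S (lft i w);
  lift_proj : forall i w, wall i -> box (rad c) w -> w 0 i = 0 ->
    pr (lft i w) = point c w;
  lift_diff : forall i w, wall i -> box (rad c) w -> differentiable (lft i) w;
  planes_cover : forall p w, S p -> box (rad c) w -> pr p = point c w ->
    exists i, [/\ wall i, w 0 i = 0 & p = lft i w];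
  lift_inj : forall i j w, wall i -> wall j -> box (rad c) w ->
    w 0 i = 0 -> w 0 j = 0 -> lft i w = lft j w -> i = j;
  lift_near : forall i w, wall i -> box (rad c) w -> w 0 i = 0 ->
    \forall p \near lft i w, S p -> exists w', [/\ box (rad c) w', w' 0 i = 0 & p = lft i w'];
  lift_orient : forall i w n, wall i -> box (rad c) w -> w 0 i = 0 ->
    normal_vec D (lft i w) n -> 0 < 'd (fun y => coords c y 0 i) (point c w) n }.

(* A differentiable left inverse of the projection prevents it from collapsing a tangent
   vector of the surface. *)
Lemma immersed_retraction p (r : 'rV[R]_3 -> 'rV[R]_4) :
  differentiable r (pr p) -> (\forall q \near p, S q -> r (pr q) = q) ->
  immersed D p.
Proof.
move=> dr rK n [phi [u [aphi cu phiu ->]]]; apply/negP => /eqP /cross3_eq0 [x [y [xy0]]].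
rewrite !scalemxAl -mulmxDl !row_jacobian -!linearZ -linearD.
set d := _ *: _ + _ *: _ => dpr.
have aparam := atlas_param aphi; have [sphi phifree _ _] := aparam.
have dphi : differentiable phi u by exact: smooth_differentiable sphi cu.
have dprm : differentiable (fun q => pr q) (phi u) by exact: mulmxr_differentiable.
have dr' : differentiable r ((fun q => pr q) (phi u)) by rewrite phiu.
have dprphi := differentiable_comp dphi dprm.
have E : 'd (r \o ((fun q => pr q) \o phi)) u d = 0.
  by rewrite (diff_compE _ dprphi dr') (diff_compE _ dphi dprm) diff_mulmxr dpr linear0.
have E2 : 'd phi u d = 0.
  have e1 := deriveE d (differentiable_comp dprphi dr').
  have e2 := deriveE d dphi.
  refine (etrans (esym e2) (etrans _ (etrans e1 E))).
  apply: near_eq_derive.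
  have Sphi : \forall z \near u, S (phi z).
    have : \forall z \near u, cube R 2 z by apply: open_nbhs_nbhs; split => //; exact: open_cube.
    by apply: filterS => z; apply: local_param_surf; exact: aparam.
  have H : \forall z \near u, S (phi z) -> r (pr (phi z)) = phi z.
    have C : phi @ u --> phi u := differentiable_continuous dphi.
    have F0u : nbhs (phi u) [set q | S q -> r (pr q) = q] by rewrite phiu.
    exact: C F0u.
  by apply: filterS2 Sphi H => z Sz /(_ Sz).
have d0 : d = 0.
  apply: (row_free_inj (phifree u cu)); rewrite mul0mx.
  by rewrite /jacobian mul_rV_lin1.
move/rowP: d0 => d0; move: xy0; have := d0 0; have := d0 1.
rewrite !mxE /= !mulr1 !mulr0 addr0 add0r => -> ->.
by rewrite eqxx.
Qed.


(** The coordinates of the model are kept up to signs. Along each piece the normals stay on one side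
    of the coordinate plane, so reflecting the axes where this side is negative gives the
    orientation required by [planes]. *)
Lemma planes_of_model (V : set 'rV[R]_3) (Psi Psi' : 'rV[R]_3 -> 'rV[R]_3)
    (wall : pred 'I_3) (phi : 'I_3 -> 'rV[R]_2 -> 'rV[R]_4) :
  diffeo_on V (cube R 3) Psi Psi' ->
  (forall i, wall i -> local_param S (phi i)) ->
  (forall p, S p -> V (pr p) -> exists i u, [/\ wall i, cube R 2 u & phi i u = p]) ->
  (forall i u, wall i -> cube R 2 u -> V (pr (phi i u))) ->
  (forall i j u v, wall i -> wall j -> cube R 2 u -> cube R 2 v -> phi i u = phi j v -> i = j) ->
  (forall i u, wall i -> cube R 2 u -> Psi (pr (phi i u)) = coord_plane i u) ->
  forall y, V y -> Psi y = 0 ->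
  exists c lft, planes c wall lft /\ point c 0 = y.
Proof.
move=> [[oV _] [sPsi sPsi'] [VPsi cPsi'] PsiK Psi'K] param cover Vphi phi_inj model y Vy y0.
have {}PsiK z : V z -> Psi' (Psi z) = z by move=> Vz; apply: PsiK; rewrite inE.
have {}Psi'K z : cube R 3 z -> Psi (Psi' z) = z by move=> Vz; apply: Psi'K; rewrite inE.
have dPsi z : V z -> differentiable Psi z by move=> ?; exact: smooth_differentiable sPsi _.
have dPsi' z : cube R 3 z -> differentiable Psi' z.
  by move=> ?; exact: smooth_differentiable sPsi' _.
have nearV z : V z -> \forall z' \near z, V z' by move=> ?; apply: open_nbhs_nbhs.
have dphi i u : wall i -> cube R 2 u -> differentiable (phi i) u.
  by move=> /param [sphi _ _ _] cu; exact: smooth_differentiable sphi cu.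
have near_piece i u : wall i -> cube R 2 u -> \forall q \near phi i u, S q ->
    exists2 v, cube R 2 v & phi i v = q.
  move=> wi cu; have := local_param_near (param i wi) cu (@filterT _ _ (nbhs_filter u)).
  by apply: filterS => q Hq /Hq [v [cv _ <-]]; exists v.
have imm i u : wall i -> cube R 2 u -> immersed D (phi i u).
  (* Taking coordinates, forgetting the [i]-th and applying [phi i] inverts the projection on the
     [i]-th piece. *)
  move=> wi cu; pose r z := phi i (Psi z *m dropmx R i).
  have rE v : cube R 2 v -> r (pr (phi i v)) = phi i v.
    by move=> cv; rewrite /r model // drop_coord_plane.
  apply: (@immersed_retraction _ r).
    apply: (@differentiable_comp _ _ _ _ (fun z => Psi z *m dropmx R i) (phi i)).
      apply: (@differentiable_comp _ _ _ _ Psi (fun z => z *m dropmx R i)); last exact: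
        mulmxr_differentiable.
      by apply: dPsi; exact: Vphi.
    by rewrite model // drop_coord_plane; exact: dphi.
  have := near_piece i u wi cu.
  by apply: filterS => q Hq /Hq [v cv <-]; exact: rE.
pose F i := fun z => Psi z 0 i.
have orient i : exists e : bool, wall i -> forall u n, cube R 2 u ->
    normal_vec D (phi i u) n -> 0 < (-1) ^+ e * 'd (F i) (pr (phi i u)) n.
  have [wi|nwi] := boolP (wall i); last by exists true.
  have [||||||||e He] := @orientation_const R D (F i) V (phi i @` cube R 2).
  - by move=> z Vz; apply: differentiable_coordE; exact: dPsi.
  - by move=> v z Vz; exact: (smooth_coord_derive_continuous oV sPsi Vz).
  - by move=> _ [u cu <-]; apply: local_param_surf cu; exact: param.
  - apply: connected_continuous_connected; first exact: connected_cube.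
    apply: continuous_in_subspaceT => u; rewrite inE => cu.
    by apply: differentiable_continuous; exact: dphi.
  - move=> _ [u cu <-].
    have H : \forall q \near phi i u, V (pr q).
      have C : (fun q => pr q) @ phi i u --> pr (phi i u).
        exact: mulmxr_continuous.
      by apply: C; apply: nearV; exact: Vphi.
    by apply: filterS H.
  - move=> _ [u cu <-]; have := near_piece i u wi cu.
    by apply: filterS => q Hq /Hq [v cv <-]; rewrite /F model // coord_plane_self.
  - move=> _ [u cu <-].
    have Vp := Vphi i u wi cu.
    have cw : cube R 3 (Psi (pr (phi i u))) by exact: VPsi.
    (* The velocity of the [i]-th coordinate line, along which the [i]-th coordinate has derivative
       1. *)
    exists ('d Psi' (Psi (pr (phi i u))) (delta_mx 0 i)).
    rewrite diff_coordE; last exact: dPsi.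
    have d1 : differentiable Psi (Psi' (Psi (pr (phi i u)))) by rewrite PsiK //; exact: dPsi.
    rewrite -[in X in 'd Psi X](PsiK _ Vp) -(diff_compE _ (dPsi' _ cw) d1).
    rewrite -deriveE; last by apply: differentiable_comp => //; exact: dPsi'.
    rewrite (@near_eq_derive _ _ _ _ id) ?derive_id ?mxE ?eqxx ?oner_neq0 //.
    have : \forall z \near Psi (pr (phi i u)), cube R 3 z.
      by apply: open_nbhs_nbhs; split => //; exact: open_cube.
    by apply: filterS => z cz; rewrite /= Psi'K.
  - by move=> _ [u cu <-]; exact: imm.
  by exists e => _ u n cu; apply: He; exists u.
have [e He] := choice orient.
pose E := flipmx R e.
have bE w : box 1 w -> cube R 3 (w *m E) by move=> bw; exact: (box_flip e bw).
pose cinv w := Psi' (w *m E).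
pose ccoord z := Psi z *m E.
have Vinv w : box 1 w -> V (cinv w) by move=> /bE; exact: cPsi'.
have c1 w : box 1 w -> differentiable cinv w.
  move=> bw; apply: (@differentiable_comp _ _ _ _ (fun w => w *m E) Psi').
    exact: mulmxr_differentiable.
  by apply: dPsi'; exact: bE.
have c2 w : box 1 w -> ccoord (cinv w) = w.
  by move=> bw; rewrite /ccoord /cinv Psi'K ?flipK //; exact: bE.
have c3 w : box 1 w -> differentiable ccoord (cinv w).
  move=> bw; apply: (@differentiable_comp _ _ _ _ Psi (fun z => z *m E)); last exact:
    mulmxr_differentiable.
  by apply: dPsi; exact: Vinv.
have c4 w : box 1 w -> \forall z \near cinv w, exists2 w', box 1 w' & cinv w' = z.
  move=> bw; have := nearV _ (Vinv w bw); apply: filterS => z Vz.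
  exists (Psi z *m E); last by rewrite /cinv flipK PsiK.
  exact: (box_flip e (VPsi z Vz)).
pose c := Chart ltr01 c1 c2 c3 c4.
pose lft i w := phi i (w *m E *m dropmx R i).
have cd i w : box 1 w -> cube R 2 (w *m E *m dropmx R i).
  by move=> bw; apply: cube_drop; exact: bE.
have E0 (w : 'rV[R]_3) i : w 0 i = 0 -> (w *m E) 0 i = 0 by move=> wi; rewrite flipE wi mulr0.
have projE i w : wall i -> box 1 w -> w 0 i = 0 -> pr (lft i w) = cinv w.
  move=> wi bw w0; rewrite /cinv -(coord_plane_drop (E0 _ _ w0)) -model ?PsiK //; last exact: cd.
  by apply: Vphi => //; exact: cd.
exists c, lft; split; last by rewrite /= /cinv mul0mx -y0 PsiK.
split => /=.
- by move=> i w wi bw w0; apply: local_param_surf (param i wi) _; exact: cd.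
- exact: projE.
- move=> i w wi bw; apply: (@differentiable_comp _ _ _ _ (fun w => w *m E *m dropmx R i) (phi i)).
    by apply: (@differentiable_comp _ _ _ _ (fun w => w *m E) (fun w => w *m dropmx R i));
      exact: mulmxr_differentiable.
  by apply: dphi => //; exact: cd.
- move=> p w Sp bw pw.
  have Vp : V (pr p) by rewrite pw; exact: Vinv.
  have [i [u [wi cu pu]]] := cover p Sp Vp; exists i.
  have wE : w *m E = coord_plane i u.
    by rewrite -model // pu pw /cinv Psi'K //; exact: bE.
  split => //; last by rewrite /lft wE drop_coord_plane.
  have := coord_plane_self i u; rewrite -wE flipE => /eqP.
  by rewrite mulf_eq0 signr_eq0 => /eqP.
- by move=> i j w wi wj bw _ _; apply: phi_inj => //; exact: cd.
- move=> i w wi bw w0; have := near_piece i _ wi (cd i w bw).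
  apply: filterS => q Hq /Hq [v cv <-]; exists (coord_plane i v *m E); split.
  + by apply: box_flip; exact: cube_coord_plane.
  + by apply: E0; exact: coord_plane_self.
  + by rewrite /lft flipK drop_coord_plane.
- move=> i w n wi bw w0 pn.
  have Vp := Vinv w bw.
  rewrite diff_coordE; last exact: (c3 w bw).
  rewrite (diff_compE (g := fun z => z *m E)); [|exact: dPsi|exact: mulmxr_differentiable].
  rewrite diff_mulmxr flipE -diff_coordE; last exact: dPsi.
  by rewrite -(projE i) //; apply: He => //; exact: cd.
Qed.

End Charts.

Section BoxCoordinates.
Variable R : realType.
Implicit Types (w : 'rV[R]_3).

Definition upd w (j : 'I_3) (x : R) : 'rV[R]_3 := \row_k (if k == j then x else w 0 k).

Lemma updE w j x k : upd w j x 0 k = if k == j then x else w 0 k.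
Proof. by rewrite mxE. Qed.

Lemma upd_same w j x : upd w j x 0 j = x.
Proof. by rewrite updE eqxx. Qed.

Lemma upd_other w j x k : k != j -> upd w j x 0 k = w 0 k.
Proof. by rewrite updE => /negbTE ->. Qed.

Lemma upd_add w j (x : R) : w + x *: delta_mx 0 j = upd w j (w 0 j + x).
Proof.
apply/rowP => k; rewrite !mxE eqxx /=.
by have [->|] := eqVneq k j; rewrite ?mulr1 // mulr0 addr0.
Qed.

Lemma box_upd r w j x : box r w -> `|x| < r -> box r (upd w j x).
Proof. by move=> bw xr k; rewrite updE; case: ifP. Qed.

Lemma box0 r : 0 < r -> box r (0 : 'rV[R]_3).
Proof. by move=> r0 k; rewrite mxE normr0. Qed.

Lemma box_le r r' w : r <= r' -> box r w -> box r' w.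
Proof. by move=> rr bw k; exact: lt_le_trans (bw k) rr. Qed.

Lemma near_right (P : set R) : (\forall t \near (0 : R), P t) -> \forall t \near 0^'+, P t.
Proof. exact: cvg_within. Qed.

Lemma box_seg r w w' t : box r w -> box r w' -> 0 <= t <= 1 -> box r (seg w w' t).
Proof.
by move=> bw bw' t01 k; rewrite segE; exact: convex_norm_lt.
Qed.

Lemma seg_sign w w' (t : R) k : 0 < w 0 k * w' 0 k -> 0 <= t <= 1 ->
  0 < w 0 k * seg w w' t 0 k.
Proof.
move=> ww' t01; rewrite segE mulrDr !(mulrCA (w 0 k)); apply: convex_gt0 => //.
by rewrite -expr2 exprn_even_gt0 //=; apply: contraTneq ww' => ->; rewrite mul0r ltxx.
Qed.

Lemma near_sides w : nbhs w [set w' : 'rV[R]_3 | forall k, w 0 k != 0 -> 0 < w 0 k * w' 0 k].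
Proof.
apply: (@filter_forall _ _ (fun k (w' : 'rV[R]_3) => w 0 k != 0 -> 0 < w 0 k * w' 0 k) _
  (nbhs_filter (w : 'rV[R]_3))) => k.
have [->|wk] := eqVneq (w 0 k) 0; first exact: nearW.
have H : \forall x \near w 0 k, 0 < w 0 k * x.
  have : (fun x => w 0 k * x) @ w 0 k --> w 0 k * w 0 k by apply: cvgMl_tmp; exact: cvg_id.
  move=> /cvgr_gt; apply; rewrite -expr2 exprn_even_gt0 //=.
by apply: filterS (near_coord H) => w' /= + _.
Qed.

Lemma nbhs0_box (A : set 'rV[R]_3) : nbhs (0 : 'rV[R]_3) A ->
  exists2 r, 0 < r & box r `<=` A.
Proof.
move=> /nbhs_ballP [r r0 rA]; exists r => // w bw; apply: rA; split => // i j.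
by rewrite (ord1 i) mxE /ball /= sub0r normrN; exact: bw.
Qed.

End BoxCoordinates.

(** * Semi-sheets and crossing curves inside a chart *)

Section ChartGeometry.
Variables (R : realType) (D : diagram R).
Local Notation S := (surf D).
Local Notation pr p := (p *m projmx D).
Implicit Types (p q : 'rV[R]_4) (n w y : 'rV[R]_3).

Definition shadow : set 'rV[R]_3 := [set y | exists2 p, S p & pr p = y].

(* The union of the semi-sheets is [regular], the union of the sheets is [above]. *)
Definition regular : set 'rV[R]_4 := S `\` closure (double_set D).

Definition above : set 'rV[R]_4 := S `\` closure (lower_set D).

Lemma proj_continuous p : {for p, continuous (fun q => pr q)}.
Proof. exact: mulmxr_continuous. Qed.

Lemma coords_near (c : chart R) w (P : set 'rV[R]_3) :
  box (rad c) w -> nbhs w P ->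
  \forall y \near point c w, exists w', [/\ box (rad c) w', point c w' = y & P w'].
Proof.
move=> bw wP.
have C : coords c @ point c w --> coords c (point c w).
  by apply: differentiable_continuous; exact: coords_diff.
have H : \forall y \near point c w, P (coords c y) by apply: C; rewrite pointK.
apply: filterS2 H (chart_near bw) => y Py [w' bw' w'y].
by exists w'; split => //; rewrite -w'y pointK in Py.
Qed.

Lemma shrink_near (c : chart R) r : r <= rad c ->
  forall w, box r w -> \forall y \near point c w, exists2 w', box r w' & point c w' = y.
Proof.
move=> rc w bw; have := coords_near (box_le rc bw) (near_box bw).
by apply: filterS => y [w' [_ ? ?]]; exists w'.
Qed.

Definition shrink (c : chart R) r (r0 : 0 < r) (rc : r <= rad c) : chart R :=
  Chart r0 (fun w bw => point_diff (box_le rc bw))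
    (fun w bw => pointK (box_le rc bw)) (fun w bw => coords_diff (box_le rc bw))
    (shrink_near rc).

Lemma chart_small (c : chart R) (W : set 'rV[R]_3) : nbhs (point c 0) W ->
  exists r, [/\ 0 < r, r <= rad c & forall w, box r w -> W (point c w)].
Proof.
move=> nW; have C := point_continuous (box0 (rad_gt0 c)).
have [r r0 rW] := nbhs0_box (C _ nW).
exists (Num.min r (rad c)); split; first by rewrite lt_min r0 rad_gt0.
  by rewrite ge_min lexx orbT.
by move=> w bw; apply: rW; apply: box_le bw; rewrite ge_min lexx.
Qed.

(** The straight line through a zero of [F], in a direction where [F] increases, is read in the
    chart. This serves twice: with [F] a coordinate vanishing on a wall, and with [F] the equation
    of the umbrella at a branch point. *)
Lemma line_sides (c : chart R) (F : 'rV[R]_3 -> R) w n (P : set 'rV[R]_3) :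
  box (rad c) w -> differentiable F (point c w) -> F (point c w) = 0 ->
  0 < 'd F (point c w) n -> nbhs w P ->
  \forall t \near 0^'+, exists w1 w2,
    [/\ [/\ box (rad c) w1, point c w1 = point c w + t *: n, 0 < F (point c w1) & P w1] &
        [/\ box (rad c) w2, point c w2 = point c w - t *: n, F (point c w2) < 0 & P w2]].
Proof.
move=> bw dF F0 Fn wP.
pose g (t : R) := point c w + t *: n.
have dgs : differentiable (fun t : R => t *: n) 0 by exact: differentiableZl.
have dg : differentiable g 0 by apply: differentiableD.
have g0 : g 0 = point c w by rewrite /g scale0r addr0.
have Dg : 'D_1 g 0 = n.
  rewrite /g deriveD ?derive_cst ?add0r; [|exact: derivable_cst|exact: diff_derivable].
  by rewrite deriveE // diffZl // -deriveE // derive_id scale1r.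
have sides : \forall t \near 0^'+, 0 < F (g t) /\ F (g (- t)) < 0.
  apply: (@curve_sides _ _ g F).
  - exact: diff_derivable.
  - by rewrite g0.
  - by rewrite g0.
  - by rewrite g0 Dg.
have N : nbhs (g 0) [set y | exists w', [/\ box (rad c) w', point c w' = y & P w']].
  by rewrite g0; exact: coords_near.
have nearg : nbhs (0 : R) [set t | exists w', [/\ box (rad c) w', point c w' = g t & P w']].
  exact: (differentiable_continuous dg N).
have nearNg : nbhs (- (0 : R)) [set t | exists w', [/\ box (rad c) w', point c w' = g t & P w']].
  by rewrite oppr0.
have nearg' : nbhs (0 : R) [set t | exists w', [/\ box (rad c) w', point c w' = g (- t) & P w']].
  have C : (fun t : R => - t) @ (0 : R) --> - (0 : R) by apply: cvgN; exact: cvg_id.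
  exact: (C _ nearNg).
apply: filterS3 sides (near_right nearg) (near_right nearg').
move=> t [s1 s2] [w1 [b1 e1 P1]] [w2 [b2 e2 P2]]; exists w1, w2.
by split; split; rewrite ?e1 // e2 // /g scaleNr.
Qed.

Section Planes.
Variables (c : chart R) (wall : pred 'I_3) (lft : 'I_3 -> 'rV[R]_3 -> 'rV[R]_4).
Hypothesis pc : planes D c wall lft.
Local Notation box := (box (rad c)).

(** The coordinates of a lifted point can be read off from its projection, so they are close to [w]
    when the point is close to [lft i w]. *)
Lemma lift_near_in i w (P : set 'rV[R]_3) : wall i -> box w -> w 0 i = 0 -> nbhs w P ->
  \forall p \near lft i w, S p -> exists w', [/\ box w', w' 0 i = 0, p = lft i w' & P w'].
Proof.
move=> wi bw w0 wP.
have N : nbhs (pr (lft i w)) [set y | exists w', [/\ box w', point c w' = y & P w']].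
  by rewrite (lift_proj pc) //; exact: coords_near.
have H : nbhs (lft i w) [set p | exists w', [/\ box w', point c w' = pr p & P w']].
  exact: (@proj_continuous (lft i w) _ N).
apply: filterS2 H (lift_near pc wi bw w0) => p [w' [bw' w'p Pw']] + Sp.
move=> /(_ Sp) [w'' [bw'' w''0 pE]]; exists w''; split => //.
rewrite pE (lift_proj pc) // in w'p.
by rewrite -(pointK bw'') -w'p pointK.
Qed.

Definition generic w := forall i, wall i -> w 0 i != 0.

Lemma generic_shadow w : box w -> generic w <-> ~ shadow (point c w).
Proof.
move=> bw; split=> [gw [p Sp pw]|nsh i wi].
  have [i [wi w0 _]] := planes_cover pc Sp bw pw.
  by have := gw i wi; rewrite w0 eqxx.
apply/eqP => w0; apply: nsh; exists (lft i w); first exact: (lift_surf pc).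
exact: (lift_proj pc).
Qed.

Definition on_wall i w := [/\ wall i, box w & w 0 i = 0].

Definition off_others i w := forall j, wall j -> j != i -> w 0 j != 0.

(** Around [w] the coordinates of the other walls keep their nonzero signs, so a surface point near
    [lft i w] shares its projection with no other surface point. *)
Lemma lift_regular i w : on_wall i w -> off_others i w -> regular (lft i w).
Proof.
move=> [wi bw w0] ow; split; first exact: (lift_surf pc).
have := lift_near_in wi bw w0 (near_sides w) => H cl.
have [q [[Sq [q' [Sq' qq' qnq']]] Hq]] := cl _ H.
have {Hq} [w' [bw' w'0 qE sw']] := Hq Sq.
have pq' : pr q' = point c w' by rewrite -qq' qE (lift_proj pc).
have [j [wj w'j q'E]] := planes_cover pc Sq' bw' pq'.
have [ji|ji] := eqVneq j i; first by apply: qnq'; rewrite qE q'E ji.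
by have := sw' j (ow j wj ji); rewrite w'j mulr0 ltxx.
Qed.

Lemma regular_off i w : on_wall i w -> regular (lft i w) -> off_others i w.
Proof.
move=> [wi bw w0] [_ ncl] j wj ji; apply/eqP => wj0; apply: ncl; apply: subset_closure.
split; first exact: (lift_surf pc).
exists (lft j w); split; first exact: (lift_surf pc).
  by rewrite /same_proj !(lift_proj pc).
by move=> /(lift_inj pc wi wj bw w0 wj0) ij; rewrite ij eqxx in ji.
Qed.

Definition comp p := connected_component regular p.

Definition same_sides i w w' := forall j, wall j -> j != i -> 0 < w 0 j * w' 0 j.

(** A straight segment in the wall that meets no other wall lifts to a path of regular points. *)
Lemma comp_lift i w w' : on_wall i w -> on_wall i w' -> same_sides i w w' ->
  comp (lft i w) = comp (lft i w').
Proof.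
move=> [wi bw w0] [_ bw' w'0] ss; rewrite /comp.
rewrite -[in LHS](seg0 w w') -[in RHS](seg1 w w').
have b t : 0 <= t <= 1 -> box (seg w w' t) by exact: box_seg.
apply: (@connected_component_path R _ regular (fun t => lft i (seg w w' t))) => t t01.
  apply: (continuous_comp (@seg_continuous R 3 w w' t)).
  by apply: differentiable_continuous; apply: (lift_diff pc) => //; exact: b.
apply: lift_regular.
  by split => //; [exact: b | rewrite segE w0 w'0 !mulr0 addr0].
move=> j wj ji; have := seg_sign (ss j wj ji) t01.
by apply: contraTneq => ->; rewrite mulr0 ltxx.
Qed.

Lemma normal_sides i w n (P : set 'rV[R]_3) : on_wall i w ->
  normal_vec D (lft i w) n -> nbhs w P ->
  \forall t \near 0^'+, exists w1 w2,
    [/\ [/\ box w1, point c w1 = point c w + t *: n, 0 < w1 0 i & P w1] &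
        [/\ box w2, point c w2 = point c w - t *: n, w2 0 i < 0 & P w2]].
Proof.
move=> [wi bw w0] pn wP.
have dF : differentiable (fun y => coords c y 0 i) (point c w).
  by apply: differentiable_coordE; exact: coords_diff.
have F0 : coords c (point c w) 0 i = 0 by rewrite pointK.
apply: filterS (line_sides bw dF F0 (lift_orient pc wi bw w0 pn) wP).
by move=> t [w1 [w2 [[b1 e1 + P1] [b2 e2 + P2]]]]; rewrite !pointK //; exists w1, w2.
Qed.

(** Along this curve the [j]-th coordinate has derivative 1. As it vanishes on the [j]-th sheet and
    increases along its normal, [diff_normal] turns this derivative into a positive scalar product
    with the normal. *)
Lemma lift_crossing i j w : on_wall i w -> on_wall j w -> i != j ->
  crossing_curve D (lft i w) (lft j w) (fun t => lft i (w + t *: delta_mx 0 j)).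
Proof.
move=> [wi bw w0] [wj _ wj0] ij.
pose g (t : R) := w + t *: delta_mx 0 j : 'rV[R]_3.
have g0 : g 0 = w by rewrite /g scale0r addr0.
have dgs : differentiable (fun t : R => t *: (delta_mx 0 j : 'rV[R]_3)) 0.
  exact: differentiableZl.
have dg : differentiable g 0 := differentiableD (differentiable_cst w 0) dgs.
have gi t : g t 0 i = 0 by rewrite /g upd_add upd_other.
have nb : \forall t \near (0 : R), box (g t).
  have N : nbhs (g 0) box by rewrite g0; exact: near_box.
  exact: (differentiable_continuous dg N).
have dl : differentiable (lft i) (g 0) by rewrite g0; exact: (lift_diff pc).
have dc : differentiable (fun t => lft i (g t)) 0 by exact: (differentiable_comp dg dl).
split; first by rewrite -/(g 0) g0.
- by apply: filterS nb => t bt; exact: (lift_surf pc wi bt (gi t)).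
- exact: diff_derivable.
have [n pn] := normal_vec_ex (lift_surf pc wj bw wj0); exists n => //.
pose F y : R := coords c y 0 j.
have dF : differentiable F (point c w).
  by apply: differentiable_coordE; exact: coords_diff.
have Fn := lift_orient pc wj bw wj0 pn.
have van : vanishes_near D F (lft j w).
  by apply: filterS (lift_near pc wj bw wj0) => p Hp /Hp [w' [bw' w'0 ->]];
    rewrite /F (lift_proj pc) // pointK.
set v := (X in dot3 X n).
have Fv : 'd F (point c w) v = 1.
  have dpr : differentiable (fun q => pr q) (lft i (g 0)) by exact: mulmxr_differentiable.
  have dcp := differentiable_comp dc dpr.
  have prg0 : pr (lft i (g 0)) = point c w by rewrite g0 (lift_proj pc).
  have dF' : differentiable F (pr (lft i (g 0))) by rewrite prg0.
  have e1 := diff_compE (1 : R) dcp dF'.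
  have e2 := diff_compE (1 : R) dc dpr.
  have -> : v = 'd ((fun q => pr q) \o (fun t => lft i (g t))) 0 1.
    by rewrite e2 diff_mulmxr /v (deriveE _ dc).
  rewrite -prg0; refine (etrans (esym e1) _).
  have e3 := deriveE (1 : R) (differentiable_comp dcp dF').
  refine (etrans (esym e3) _).
  rewrite (@near_eq_derive _ _ _ _ id) ?derive_id //.
  apply: filterS nb => t bt /=.
  by rewrite /F (lift_proj pc) // pointK // /g upd_add upd_same wj0 add0r.
have H : 'd F (pr (lft j w)) v * dot3 n n = dot3 v n * 'd F (pr (lft j w)) n.
  by apply: diff_normal => //; rewrite (lift_proj pc).
rewrite (lift_proj pc) // Fv mul1r in H.
have n0 : n != 0 by apply: contraTneq Fn => ->; rewrite linear0 ltxx.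
by have := dot3_gt0 n0; rewrite H pmulr_lgt0.
Qed.

(** The same comparison read backwards: a positive scalar product with the normal makes the [j]-th
    coordinate increase at time 0, so every crossing curve goes from the negative to the positive
    side of the wall. *)
Lemma crossing_sides i j w (P : set 'rV[R]_3) cv : on_wall i w -> on_wall j w -> i != j ->
  crossing_curve D (lft i w) (lft j w) cv -> nbhs w P ->
  \forall t \near 0^'+, exists w1 w2,
    [/\ [/\ on_wall i w1, lft i w1 = cv t, 0 < w1 0 j & P w1] &
        [/\ on_wall i w2, lft i w2 = cv (- t), w2 0 j < 0 & P w2]].
Proof.
move=> [wi bw w0] [wj _ wj0] ij [cv0 Scv dcv [n pn vn]] wP.
have dc : differentiable cv 0 by exact/derivable1_diffP.
have prw : pr (lft i w) = point c w by rewrite (lift_proj pc).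
pose F y : R := coords c y 0 j.
have dF : differentiable F (point c w).
  by apply: differentiable_coordE; exact: coords_diff.
have Fn := lift_orient pc wj bw wj0 pn.
have van : vanishes_near D F (lft j w).
  by apply: filterS (lift_near pc wj bw wj0) => p Hp /Hp [w' [bw' w'0 ->]];
    rewrite /F (lift_proj pc) // pointK.
set v := (X in dot3 X n) in vn.
have Fv : 0 < 'd F (point c w) v.
  have H : 'd F (pr (lft j w)) v * dot3 n n = dot3 v n * 'd F (pr (lft j w)) n.
    by apply: diff_normal => //; rewrite (lift_proj pc).
  rewrite (lift_proj pc) // in H.
  have n0 : n != 0 by apply: contraTneq Fn => ->; rewrite linear0 ltxx.
  by rewrite -(pmulr_lgt0 _ (dot3_gt0 n0)) H mulr_gt0.
have dpr : differentiable (fun q => pr q) (cv 0) by exact: mulmxr_differentiable.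
have dFp : differentiable F (pr (cv 0)) by rewrite cv0 prw.
have dG : differentiable (F \o (fun q => pr q)) (cv 0) by exact: (differentiable_comp dpr dFp).
have sides : \forall t \near 0^'+, 0 < F (pr (cv t)) /\ F (pr (cv (- t))) < 0.
  apply: (@curve_sides _ _ cv (F \o (fun q => pr q))) => //.
  - by rewrite /= cv0 prw /F pointK.
  - by rewrite (diff_compE _ dpr dFp) diff_mulmxr cv0 prw.
pose Q p := exists w', [/\ box w', w' 0 i = 0, p = lft i w' & P w'].
have N : nbhs (cv 0) [set p | S p -> Q p] by rewrite cv0; exact: lift_near_in.
have N1 : nbhs (0 : R) [set t | S (cv t) -> Q (cv t)] := differentiable_continuous dc N.
have N2 : nbhs (0 : R) [set t | Q (cv t)] by apply: filterS2 N1 Scv => t; apply.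
have N3 : nbhs (- (0 : R)) [set t | Q (cv t)] by rewrite oppr0.
have C : (fun t : R => - t) @ (0 : R) --> - (0 : R) by apply: cvgN; exact: cvg_id.
have N4 : nbhs (0 : R) [set t | Q (cv (- t))] := C _ N3.
apply: filterS3 sides (near_right N2) (near_right N4).
move=> t [s1 s2] [w1 [b1 z1 e1 P1]] [w2 [b2 z2 e2 P2]]; exists w1, w2.
rewrite e1 /F (lift_proj pc) // pointK // in s1.
rewrite e2 /F (lift_proj pc) // pointK // in s2.
Qed.

End Planes.

End ChartGeometry.

(** * Transport across semi-sheets *)

Definition updb (s : 'I_3 -> bool) (i : 'I_3) (b : bool) : 'I_3 -> bool :=
  fun k => if k == i then b else s k.

(* Transport from a vertex of the cube along the axes in a fixed order; commuting squares
   make the result compatible with every edge. *)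
Lemma cube_label (G : Type) (T : 'I_3 -> ('I_3 -> bool) -> G -> G) :
  (forall i s b, T i (updb s i b) = T i s) ->
  (forall i j s g, i != j -> s i = false -> s j = false ->
    T j (updb s i true) (T i s g) = T i (updb s j true) (T j s g)) ->
  (forall i s g, exists g', T i s g' = g) ->
  forall s0 g, exists lam : ('I_3 -> bool) -> G, lam s0 = g /\
    forall i s, s i = false -> lam (updb s i true) = T i s (lam s).
Proof.
move=> indep sq surj s0 g.
pose f (a b c : bool) : 'I_3 -> bool := fun k => [:: a; b; c]`_k.
have fE s : s = f (s 0) (s 1) (s 2) by apply/funext; apply: ord3.
have u0 a b c x : updb (f a b c) 0 x = f x b c by apply/funext; apply: ord3.
have u1 a b c x : updb (f a b c) 1 x = f a x c by apply/funext; apply: ord3.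
have u2 a b c x : updb (f a b c) 2 x = f a b x by apply/funext; apply: ord3.
pose lam0 g0 (s : 'I_3 -> bool) :=
  let g1 := if s 0 then T 0 (f false false false) g0 else g0 in
  let g2 := if s 1 then T 1 (f (s 0) false false) g1 else g1 in
  if s 2 then T 2 (f (s 0) (s 1) false) g2 else g2.
(* The value at the all-false vertex is found by pulling [g] back along the path to [s0], one edge
   at a time, by surjectivity. *)
have [g0 g0E] : exists g0, lam0 g0 s0 = g.
  rewrite /lam0.
  have [g2 <-] : exists g2, (if s0 2 then T 2 (f (s0 0) (s0 1) false) g2 else g2) = g.
    by case: (s0 2); [exact: surj | exists g].
  have [g1 <-] : exists g1, (if s0 1 then T 1 (f (s0 0) false false) g1 else g1) = g2.
    by case: (s0 1); [exact: surj | exists g2].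
  have [g0 <-] : exists g0, (if s0 0 then T 0 (f false false false) g0 else g0) = g1.
    by case: (s0 0); [exact: surj | exists g1].
  by exists g0.
exists (lam0 g0); split => // i s; rewrite (fE s).
have sq01 c g' : T 1 (f true false c) (T 0 (f false false c) g') =
    T 0 (f false true c) (T 1 (f false false c) g').
  by have := sq 0 1 (f false false c) g'; rewrite u0 u1; apply.
have sq02 b g' : T 2 (f true b false) (T 0 (f false b false) g') =
    T 0 (f false b true) (T 2 (f false b false) g').
  by have := sq 0 2 (f false b false) g'; rewrite u0 u2; apply.
have sq12 a g' : T 2 (f a true false) (T 1 (f a false false) g') =
    T 1 (f a false true) (T 2 (f a false false) g').
  by have := sq 1 2 (f a false false) g'; rewrite u1 u2; apply.
move: i (s 0) (s 1) (s 2) => i a b c; move: i; apply: ord3 => h.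
- have {h} -> : a = false by [].
  rewrite u0 /lam0 /f /= -/(f _ _ _) -/(f _ _ _).
  by case: b; case: c; rewrite /= ?sq01 ?sq02 ?sq01.
- have {h} -> : b = false by [].
  rewrite u1 /lam0 /f /=.
  by case: c; rewrite /= ?sq12.
- have {h} -> : c = false by [].
  by rewrite u2 /lam0 /f /=.
Qed.

Lemma right_ex (R : realType) (P Q : R -> Prop) :
  (\forall t \near (0 : R)^'+, P t) -> (\forall t \near (0 : R)^'+, Q t) ->
  exists t, [/\ 0 < t, P t & Q t].
Proof.
move=> HP HQ; apply: (@filter_ex _ _ (at_right_proper_filter (0 : R))).
by near=> t; split; [|near: t; exact: HP|near: t; exact: HQ].
Unshelve. all: by end_near. Qed.

(** * Sections of a transport near double and triple points *)

Section Good.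
Variables (R : realType) (D : diagram R).
Local Notation S := (surf D).
Local Notation pr p := (p *m projmx D).
Implicit Types (p q : 'rV[R]_4) (n w y : 'rV[R]_3) (A B : set 'rV[R]_4).
Local Notation regular := (regular D).
Local Notation shadow := (shadow D).
Local Notation comp := (comp D).

Definition is_component (Z : set 'rV[R]_4) A := (connected_component Z @` Z) A.

Lemma component_eq (Z A : set 'rV[R]_4) p : is_component Z A -> A p ->
  A = connected_component Z p.
Proof. by move=> [q Zq <-] /same_connected_component. Qed.

Lemma comp_component p : regular p -> is_component regular (comp p).
Proof. by move=> rp; exists p. Qed.

Lemma comp_refl p : regular p -> comp p p.
Proof. by move=> rp; apply: connected_component_refl. Qed.

(** The projection and the height together are invertible linear coordinates on R^4. *)
Lemma height_neq p q : same_proj D p q -> p <> q -> height D p != height D q.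
Proof.
move=> pq npq; apply/negP => /eqP hpq; apply: npq.
have E : p *m row_mx (projmx D) (hgt D) = q *m row_mx (projmx D) (hgt D).
  rewrite !mul_mx_row pq; congr row_mx.
  by apply/rowP => k; rewrite (ord1 k).
by have := congr1 (mulmx^~ (invmx (row_mx (projmx D) (hgt D)))) E;
  rewrite !mulmxK // ?proj_hgt_unit.
Qed.

Section Axis.
Variables (c : chart R) (wall : pred 'I_3) (lft : 'I_3 -> 'rV[R]_3 -> 'rV[R]_4).
Hypothesis pc : planes D c wall lft.
Local Notation box := (box (rad c)).
Local Notation on_wall := (on_wall c wall).
Local Notation off_others := (off_others wall).

Definition off_both i j w := forall k, wall k -> k != i -> k != j -> w 0 k != 0.

Lemma upd_on_wall i j w x : on_wall i w -> i != j -> `|x| < rad c -> on_wall i (upd w j x).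
Proof. by move=> [wi bw w0] ij xr; split => //; [exact: box_upd | rewrite upd_other]. Qed.

Lemma upd_off i j w x : off_both i j w -> x != 0 -> off_others i (upd w j x).
Proof.
move=> ow x0 k wk ki; rewrite updE; have [//|kj] := eqVneq k j; exact: (ow k wk ki kj).
Qed.

Lemma behind_in i j w A : on_wall i w -> on_wall j w -> i != j ->
  behind D (lft i w) (lft j w) A ->
  exists w', [/\ on_wall i w', w' 0 j < 0, (forall k, w 0 k != 0 ->
    0 < w 0 k * w' 0 k) & A (lft i w')].
Proof.
move=> wi wj ij [cv cvP Acv].
have H := crossing_sides pc wi wj ij cvP (near_sides w).
have [t [_ At [w1 [w2 [_ [? e ? ?]]]]]] := right_ex Acv H.
by exists w2; split => //; rewrite e.
Qed.

Lemma ahead_in i j w A : on_wall i w -> on_wall j w -> i != j ->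
  ahead D (lft i w) (lft j w) A ->
  exists w', [/\ on_wall i w', 0 < w' 0 j, (forall k, w 0 k != 0 ->
    0 < w 0 k * w' 0 k) & A (lft i w')].
Proof.
move=> wi wj ij [cv cvP Acv].
have H := crossing_sides pc wi wj ij cvP (near_sides w).
have [t [_ At [w1 [w2 [H1 _]]]]] := right_ex Acv H.
have [? e ? ?] := H1.
by exists w1; split => //; rewrite e.
Qed.

Lemma comp_upd i j w x x' : on_wall i w -> i != j -> off_both i j w ->
  `|x| < rad c -> `|x'| < rad c -> 0 < x * x' ->
  comp (lft i (upd w j x)) = comp (lft i (upd w j x')).
Proof.
move=> wi ij ow xr xr' xx; apply: (comp_lift pc); try exact: upd_on_wall.
move=> k wk ki; rewrite !updE; case: eqP => // /eqP kj.
by rewrite -expr2 exprn_even_gt0 //=; exact: ow.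
Qed.

Lemma near_norm0 : \forall t \near (0 : R), `|t| < rad c.
Proof. by apply: near_norm_lt; rewrite normr0 rad_gt0. Qed.

Lemma behind_comp i j w x : on_wall i w -> on_wall j w -> i != j -> off_both i j w ->
  0 < x < rad c -> behind D (lft i w) (lft j w) (comp (lft i (upd w j (- x)))).
Proof.
move=> wi wj ij ow /andP[x0 xr]; exists (fun t => lft i (w + t *: delta_mx 0 j)).
  exact: (lift_crossing pc).
have wj0 : w 0 j = 0 by case: wj.
near=> t; rewrite upd_add wj0 add0r.
have t0 : 0 < t by [].
have tr : `|- t| < rad c by rewrite normrN; near: t; apply: near_right; exact: near_norm0.
rewrite (@comp_upd i j w (- x) (- t)) //; last 2 first.
- by rewrite normrN gtr0_norm.
- by rewrite mulrNN mulr_gt0.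
apply: comp_refl; apply: (lift_regular pc); first exact: upd_on_wall.
by apply: upd_off => //; rewrite oppr_eq0 gt_eqF.
Unshelve. all: by end_near. Qed.

Lemma ahead_comp i j w x : on_wall i w -> on_wall j w -> i != j -> off_both i j w ->
  0 < x < rad c -> ahead D (lft i w) (lft j w) (comp (lft i (upd w j x))).
Proof.
move=> wi wj ij ow /andP[x0 xr]; exists (fun t => lft i (w + t *: delta_mx 0 j)).
  exact: (lift_crossing pc).
have wj0 : w 0 j = 0 by case: wj.
near=> t; rewrite upd_add wj0 add0r.
have t0 : 0 < t by [].
have tr : `|t| < rad c by near: t; apply: near_right; exact: near_norm0.
rewrite (@comp_upd i j w x t) //; last 2 first.
- by rewrite gtr0_norm.
- by rewrite mulr_gt0.
apply: comp_refl; apply: (lift_regular pc); first exact: upd_on_wall.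
by apply: upd_off => //; rewrite gt_eqF.
Unshelve. all: by end_near. Qed.

Lemma comp_axis i j w w' x : on_wall i w -> i != j -> off_both i j w -> on_wall i w' ->
  (forall k, w 0 k != 0 -> 0 < w 0 k * w' 0 k) -> `|x| < rad c -> 0 < w' 0 j * x ->
  comp (lft i w') = comp (lft i (upd w j x)).
Proof.
move=> wi ij ow wi' ss xr w'x; apply: (comp_lift pc) => //; first exact: upd_on_wall.
move=> k wk ki; rewrite updE; case: eqP => [-> //|/eqP kj].
by rewrite mulrC; apply: ss; exact: ow.
Qed.

(** The curve in [behind] is arbitrary, but near its crossing point it comes from the part of the
    wall with negative [j]-th coordinate and the nonzero signs of [w] elsewhere, and this part lies
    in a single semi-sheet. *)
Lemma behind_uniq i j w A x : on_wall i w -> on_wall j w -> i != j -> off_both i j w ->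
  0 < x < rad c -> is_component regular A ->
  behind D (lft i w) (lft j w) A -> A = comp (lft i (upd w j (- x))).
Proof.
move=> wi wj ij ow /andP[x0 xr] cA /(behind_in wi wj ij) [w' [wi' w'j ss Aw']].
rewrite (component_eq cA Aw'); apply: comp_axis => //.
  by rewrite normrN gtr0_norm.
by rewrite mulrN oppr_gt0 pmulr_llt0.
Qed.

Lemma ahead_uniq i j w A x : on_wall i w -> on_wall j w -> i != j -> off_both i j w ->
  0 < x < rad c -> is_component regular A ->
  ahead D (lft i w) (lft j w) A -> A = comp (lft i (upd w j x)).
Proof.
move=> wi wj ij ow /andP[x0 xr] cA /(ahead_in wi wj ij) [w' [wi' w'j ss Aw']].
rewrite (component_eq cA Aw'); apply: comp_axis => //.
  by rewrite gtr0_norm.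
by rewrite mulr_gt0.
Qed.

Lemma lift_neq i j w : on_wall i w -> on_wall j w -> i != j -> lft i w <> lft j w.
Proof.
move=> [wi bw w0] [wj _ wj0] ij /(lift_inj pc wi wj bw w0 wj0) E.
by rewrite E eqxx in ij.
Qed.

Lemma double_point_lift i j w : on_wall i w -> on_wall j w -> i != j -> off_both i j w ->
  height D (lft i w) < height D (lft j w) -> double_point D (lft i w) (lft j w).
Proof.
move=> [wi bw w0] [wj _ wj0] ij ow h; split => //.
- by split; exact: (lift_surf pc).
- by rewrite /same_proj !(lift_proj pc).
move=> r Sr; rewrite /same_proj (lift_proj pc wi) // => rw.
have [k [wk wk0 ->]] := planes_cover pc Sr bw rw.
have [->|ki] := eqVneq k i; first by left.
have [->|kj] := eqVneq k j; first by right.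
by have := ow k wk ki kj; rewrite wk0 eqxx.
Qed.

End Axis.

Section Sections.
Variables (G : Type) (T : set 'rV[R]_4 -> G -> G).

(* [T A] is the effect of crossing the semi-sheet [A] along its normal.  The values of
   [tau] on the projected surface itself are irrelevant. *)
Definition good (W : set 'rV[R]_3) (tau : 'rV[R]_3 -> G) : Prop :=
  (forall y, W y -> ~ shadow y -> \forall y' \near y, tau y' = tau y) /\
  (forall p n, regular p -> W (pr p) -> normal_vec D p n ->
    \forall t \near 0^'+, tau (pr p + t *: n) = T (comp p) (tau (pr p - t *: n))).

Definition square_rule := forall p q A A' B B', double_point D p q ->
  is_component regular A -> is_component regular A' ->
  is_component regular B -> is_component regular B' ->
  behind D p q A -> ahead D p q A' -> behind D q p B -> ahead D q p B' ->
  forall g, T B' (T A g) = T A' (T B g).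

Definition T_bij := forall A, is_component regular A -> bijective (T A).

Lemma good_sub W W' tau : W' `<=` W -> good W tau -> good W' tau.
Proof. by move=> WW [g1 g2]; split=> [y /WW|p n rp /WW]; [exact: g1 | exact: g2]. Qed.

Lemma good_path (c : chart R) W tau (g : R -> 'rV[R]_3) : good W tau ->
  (forall t, 0 <= t <= 1 -> [/\ {for t, continuous g}, box (rad c) (g t),
     W (point c (g t)) & ~ shadow (point c (g t))]) ->
  tau (point c (g 0)) = tau (point c (g 1)).
Proof.
move=> [tauc _] gP.
apply: (@locally_constant_segment R G (fun t => tau (point c (g t)))) => t t01.
have [cg bg Wg ng] := gP t t01.
have C : {for t, continuous (fun t => point c (g t))}.
  exact: (continuous_comp cg (point_continuous bg)).
have H : nbhs t [set s | tau (point c (g s)) = tau (point c (g t))].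
  exact: (C _ (tauc _ Wg ng)).
by apply: filterS H.
Qed.

Section InChart.
Variables (c : chart R) (wall : pred 'I_3) (lft : 'I_3 -> 'rV[R]_3 -> 'rV[R]_4).
Hypothesis pc : planes D c wall lft.
Local Notation box := (box (rad c)).
Local Notation on_wall := (on_wall c wall).
Local Notation off_others := (off_others wall).
Local Notation generic := (generic wall).
Variable W : set 'rV[R]_3.
Hypothesis cW : forall w, box w -> W (point c w).

Lemma good_const tau w w' : good W tau -> box w -> box w' ->
  (forall i, wall i -> 0 < w 0 i * w' 0 i) -> tau (point c w) = tau (point c w').
Proof.
move=> gtau bw bw' ss.
rewrite -[in LHS](seg0 w w') -[in RHS](seg1 w w').
apply: (good_path gtau) => t t01.
have bt : box (seg w w' t) by exact: box_seg.
split; [exact: seg_continuous|exact: bt|exact: cW|].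
apply/(generic_shadow pc bt) => i wi.
have := seg_sign (ss i wi) t01.
by apply: contraTneq => ->; rewrite mulr0 ltxx.
Qed.

(** The crossing rule concerns points of the normal line close to the surface; by [good_const] they
    can be replaced by the points [upd w i x] on the two sides of the wall. *)
Lemma good_cross tau i w x1 x2 : good W tau -> on_wall i w -> off_others i w ->
  `|x1| < rad c -> `|x2| < rad c -> x1 < 0 < x2 ->
  tau (point c (upd w i x2)) = T (comp (lft i w)) (tau (point c (upd w i x1))).
Proof.
move=> gtau onw ow xr1 xr2 /andP[x10 x20]; have [wi bw w0] := onw.
have [_ cross] := gtau.
have rw := lift_regular pc onw ow.
have prw : pr (lft i w) = point c w by rewrite (lift_proj pc).
have [n pn] := normal_vec_ex (lift_surf pc wi bw w0).
have Wp : W (pr (lft i w)) by rewrite prw; exact: cW.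
have H1 := cross _ _ rw Wp pn.
have H2 := normal_sides pc onw pn (near_sides w).
have [t [_ E [w1 [w2 [[b1 e1 s1 P1] [b2 e2 s2 P2]]]]]] := right_ex H1 H2.
rewrite prw -e1 -e2 in E.
rewrite (@good_const tau (upd w i x2) w1) ?(@good_const tau (upd w i x1) w2) //.
- exact: box_upd.
- move=> k wk; rewrite updE; case: eqP => [->|/eqP ki]; last by apply: P2; exact: ow.
  by rewrite -mulrNN mulr_gt0 // oppr_gt0.
- exact: box_upd.
- move=> k wk; rewrite updE; case: eqP => [->|/eqP ki]; last by apply: P1; exact: ow.
  by rewrite mulr_gt0.
Qed.

Lemma upd_upd w i (x y' : R) : upd (upd w i x) i y' = upd w i y'.
Proof. by apply/rowP => k; rewrite !updE; case: eqP. Qed.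

Lemma upd_id w i : upd w i (w 0 i) = w.
Proof. by apply/rowP => k; rewrite updE; case: eqP => // ->. Qed.

Lemma good_step tau tau' w i x : T_bij -> good W tau -> good W tau' ->
  box w -> generic w -> `|x| < rad c -> (wall i -> x != 0) ->
  tau (point c w) = tau' (point c w) ->
  tau (point c (upd w i x)) = tau' (point c (upd w i x)).
Proof.
move=> bT g g' bw gw xr x0 E.
have bu : box (upd w i x) by exact: box_upd.
have [wi|nwi] := boolP (wall i); last first.
  have ss k : wall k -> 0 < w 0 k * upd w i x 0 k.
    move=> wk; rewrite updE; case: eqP => [ki|_]; first by rewrite ki (negbTE nwi) in wk.
    by rewrite -expr2 exprn_even_gt0 //=; exact: gw.
  by rewrite -(good_const g bw bu ss) -(good_const g' bw bu ss).
have {}x0 := x0 wi; have wi0 := gw i wi.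
have wir := bw i.
have ow x' : off_others i (upd w i x') by move=> k wk ki; rewrite upd_other //; exact: gw.
have onw : on_wall i (upd w i 0).
  by split => //; [apply: box_upd => //; rewrite normr0 rad_gt0 | rewrite upd_same].
have cross tau0 x1 x2 : good W tau0 -> `|x1| < rad c -> `|x2| < rad c -> x1 < 0 < x2 ->
    tau0 (point c (upd w i x2)) = T (comp (lft i (upd w i 0))) (tau0 (point c (upd w i x1))).
  by move=> g0 r1 r2 x12; have := good_cross g0 onw (ow 0) r1 r2 x12; rewrite !upd_upd.
have [xs|xw] := ltP 0 (w 0 i * x).
  have ss k : wall k -> 0 < w 0 k * upd w i x 0 k.
    move=> wk; rewrite updE; case: eqP => [->//|_].
    by rewrite -expr2 exprn_even_gt0 //=; exact: gw.
  by rewrite -(good_const g bw bu ss) -(good_const g' bw bu ss).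
move: wi0; rewrite neq_lt => /orP[wneg|wpos].
  have x_pos : 0 < x by rewrite lt0r x0 /=; nra.
  have n12 : w 0 i < 0 < x by rewrite wneg x_pos.
  by rewrite (cross tau _ _ g wir xr n12) (cross tau' _ _ g' wir xr n12) upd_id E.
have x_neg : x < 0 by rewrite lt_neqAle x0 /=; nra.
have n12 : x < 0 < w 0 i by rewrite wpos x_neg.
(* Against the direction of the normal, injectivity of the transport takes the equality back across
   the wall. *)
have := cross tau _ _ g xr wir n12; have := cross tau' _ _ g' xr wir n12.
rewrite !upd_id E => -> /esym; apply: bij_inj; apply: bT; apply: comp_component.
exact: (lift_regular pc).
Qed.

(** The coordinates of [w] are replaced by those of [w'] one at a time; the intermediate points are
    generic because both endpoints are. *)
Lemma good_unique_planes tau tau' w w' : T_bij -> good W tau -> good W tau' ->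
  box w -> generic w -> box w' -> generic w' ->
  tau (point c w) = tau' (point c w) -> tau (point c w') = tau' (point c w').
Proof.
move=> bT g g' bw gw bw' gw' E.
have step u i : box u -> generic u -> tau (point c u) = tau' (point c u) ->
    [/\ box (upd u i (w' 0 i)), generic (upd u i (w' 0 i)) &
      tau (point c (upd u i (w' 0 i))) = tau' (point c (upd u i (w' 0 i)))].
  move=> bu gu Eu; split; first by apply: box_upd => //; exact: bw'.
    by move=> k wk; rewrite updE; have [ki|_] := eqVneq k i; [apply: gw'; rewrite -ki|exact: gu].
  by apply: good_step => //; exact: gw'.
have [b0 g0 E0] := step _ 0 bw gw E.
have [b1 g1 E1] := step _ 1 b0 g0 E0.
have [_ _ E2] := step _ 2 b1 g1 E1.
have -> : w' = upd (upd (upd w 0 (w' 0 0)) 1 (w' 0 1)) 2 (w' 0 2) by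
  apply/rowP; apply: ord3; rewrite !updE.
exact: E2.
Qed.

End InChart.

Section Existence.
Variables (c : chart R) (wall : pred 'I_3) (lft : 'I_3 -> 'rV[R]_3 -> 'rV[R]_4).
Hypothesis pc : planes D c wall lft.
Local Notation box := (box (rad c)).
Local Notation on_wall := (on_wall c wall).
Local Notation off_others := (off_others wall).
Local Notation off_both := (off_both wall).
Local Notation generic := (generic wall).

Definition corner (h : R) (s : 'I_3 -> bool) : 'rV[R]_3 :=
  \row_k (if s k then h else - h).

Lemma cornerE h s k : corner h s 0 k = if s k then h else - h.
Proof. by rewrite mxE. Qed.

Lemma chart_square i j w x : square_rule -> on_wall i w -> on_wall j w -> i != j ->
  off_both i j w -> 0 < x < rad c -> forall g,
  T (comp (lft j (upd w i x))) (T (comp (lft i (upd w j (- x)))) g) =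
  T (comp (lft i (upd w j x))) (T (comp (lft j (upd w i (- x)))) g).
Proof.
move=> sq wi wj ij ow xr g; have ji : j != i by rewrite eq_sym.
have ow' : off_both j i w by move=> k wk kj ki; exact: ow.
have [x0 xr'] := andP xr.
have cc a b z : on_wall a w -> a != b -> off_both a b w -> `|z| < rad c -> z != 0 ->
    is_component regular (comp (lft a (upd w b z))).
  move=> wa ab oab zr z0; apply: comp_component; apply: (lift_regular pc).
    exact: upd_on_wall.
  exact: upd_off.
have x1 : `|x| < rad c by rewrite gtr0_norm.
have x2 : `|- x| < rad c by rewrite normrN.
have x3 : x != 0 by rewrite gt_eqF.
have x4 : - x != 0 by rewrite oppr_eq0.
(* The square rule distinguishes the lower sheet from the upper one, so the two orders of the
   heights are treated apart; exchanging [i] and [j] reverses the equality. *)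
have nh : height D (lft i w) != height D (lft j w).
  apply: height_neq; last exact: (lift_neq pc).
  by case: wi => ? ? ?; case: wj => ? ? ?; rewrite /same_proj !(lift_proj pc).
move: nh; rewrite neq_lt => /orP[h|h].
  have dp := double_point_lift pc wi wj ij ow h.
  apply: (sq _ _ _ _ _ _ dp); [exact: cc|exact: cc|exact: cc|exact: cc|..].
  - exact: (behind_comp pc).
  - exact: (ahead_comp pc).
  - exact: (behind_comp pc).
  - exact: (ahead_comp pc).
have dp := double_point_lift pc wj wi ji ow' h.
apply/esym; apply: (sq _ _ _ _ _ _ dp); [exact: cc|exact: cc|exact: cc|exact: cc|..].
- exact: (behind_comp pc).
- exact: (ahead_comp pc).
- exact: (behind_comp pc).
- exact: (ahead_comp pc).
Qed.

Lemma good_exists_planes w0 g : square_rule -> T_bij -> box w0 -> generic w0 ->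
  exists tau, good [set y | exists2 w, box w & point c w = y] tau /\ tau (point c w0) = g.
Proof.
move=> sq bT bw0 gw0; pose h := rad c / 2.
have h0 : 0 < h by rewrite divr_gt0 ?rad_gt0.
have hr : h < rad c by rewrite /h; have := rad_gt0 c; lra.
pose pt := corner h; have ptE := cornerE h; rewrite -/pt in ptE.
have bpt s : box (pt s).
  by move=> k; rewrite ptE; case: (s k); rewrite ?normrN gtr0_norm.
have pt0 s k : pt s 0 k != 0.
  by rewrite ptE; case: (s k); rewrite ?oppr_eq0 gt_eqF.
have r0 : `|0 : R| < rad c by rewrite normr0 rad_gt0.
(* The edge from the corner [s] in direction [i] crosses the wall [i] at the point [upd (pt s) i 0];
   in a direction without wall it acts trivially. *)
pose Ti i s g0 := if wall i then T (comp (lft i (upd (pt s) i 0))) g0 else g0.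
have on_pt i s : wall i -> on_wall i (upd (pt s) i 0).
  by move=> wi; split => //; [exact: box_upd | rewrite upd_same].
have off_pt i s : off_others i (upd (pt s) i 0) by move=> k wk ki; rewrite upd_other.
have [|||lam [lam0 lamS]] := @cube_label G Ti _ _ _
    (fun k => wall k && (0 < w0 0 k)) g.
- move=> i s b; apply/funext => g0; rewrite /Ti; case: (wall i) => //.
  have -> // : upd (pt (updb s i b)) i 0 = upd (pt s) i 0.
  by apply/rowP => k; rewrite !updE !ptE /updb; case: eqP.
- move=> i j s g0 ij si sj; rewrite /Ti.
  have ji : j != i by rewrite eq_sym.
  have indep a b : wall b -> ~~ wall a -> comp (lft b (upd (pt (updb s a true)) b 0)) =
      comp (lft b (upd (pt s) b 0)).
    move=> wb nwa; apply: (comp_lift pc); [exact: on_pt|exact: on_pt|].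
    move=> k wk kb; rewrite !updE (negbTE kb) !ptE /updb.
    have [ka|_] := eqVneq k a; first by rewrite ka (negbTE nwa) in wk.
    by rewrite -ptE -expr2 exprn_even_gt0 //=.
  have [wi|nwi] := boolP (wall i); have [wj|nwj] := boolP (wall j) => //.
  + pose w := upd (upd (pt s) i 0) j 0.
    have bw : box w by apply: box_upd => //; exact: box_upd.
    have Ei : on_wall i w by split => //; rewrite /w upd_other // upd_same.
    have Ej : on_wall j w by split => //; rewrite /w upd_same.
    have ow : off_both i j w by move=> k wk ki kj; rewrite /w !upd_other.
    have xr : 0 < h < rad c by rewrite h0.
    have := chart_square sq Ei Ej ij ow xr g0.
    have -> : upd w i h = upd (pt (updb s i true)) j 0.
      apply/rowP => k; rewrite /w !updE !ptE /updb.
      by have [->|ki] := eqVneq k i; rewrite ?(negbTE ij).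
    have -> : upd w j (- h) = upd (pt s) i 0.
      apply/rowP => k; rewrite /w !updE !ptE.
      by have [->|kj] := eqVneq k j; rewrite ?(negbTE ji) // sj.
    have -> : upd w j h = upd (pt (updb s j true)) i 0.
      apply/rowP => k; rewrite /w !updE !ptE /updb.
      by have [->|kj] := eqVneq k j; rewrite ?(negbTE ji).
    have -> // : upd w i (- h) = upd (pt s) j 0.
    apply/rowP => k; rewrite /w !updE !ptE.
    by have [->|ki] := eqVneq k i; rewrite ?(negbTE ij) // si.
  + by rewrite indep.
  + by rewrite indep.
- move=> i s g0; rewrite /Ti; have [wi|nwi] := boolP (wall i); last by exists g0.
  have rg : regular (lft i (upd (pt s) i 0)).
    by apply: (lift_regular pc); [exact: on_pt | exact: off_pt].
  have [f fK Kf] := bT _ (comp_component rg).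
  by exists (f g0).
(* Directions without wall are recorded as [false], so that [sg] is constant near each generic
   point. *)
pose sg w : 'I_3 -> bool := fun k => wall k && (0 < w 0 k).
exists (fun y => lam (sg (coords c y))); split; last by rewrite pointK.
split=> [_ [w bw <-] ns|p n rp [w bw wp] pn].
  have gw : generic w by apply/(generic_shadow pc bw).
  apply: filterS (coords_near bw (near_sides w)) => _ [w' [bw' <- ss]].
  rewrite !pointK //; congr lam; apply/funext => k; rewrite /sg.
  case wk: (wall k) => //=; have := ss k (gw k wk).
  have := gw k wk; rewrite neq_lt => /orP[a|a].
    by rewrite nmulr_rgt0 // => b; rewrite !ltNge !ltW.
  by rewrite pmulr_rgt0 // a => ->.
have [i [wi w_i pE]] := planes_cover pc rp.1 bw (esym wp).
have onw : on_wall i w by [].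
rewrite pE in rp pn *.
have ow := regular_off pc onw rp.
rewrite (lift_proj pc) //.
apply: filterS (normal_sides pc onw pn (near_sides w)) => t [w1 [w2 [[b1 e1 s1 P1] [b2 e2 s2 P2]]]].
rewrite -e1 -e2 !pointK //.
have -> : sg w1 = updb (sg w2) i true.
  apply/funext => k; rewrite /sg /updb; case: eqP => [->|/eqP ki]; first by rewrite wi s1.
  case wk: (wall k) => //=; have wk0 := ow k wk ki.
  have := P1 k wk0; have := P2 k wk0; move: wk0; rewrite neq_lt => /orP[a|a].
    by rewrite !nmulr_rgt0 // => b b'; rewrite !ltNge !ltW.
  by rewrite !pmulr_rgt0 // => -> ->.
rewrite lamS; last by rewrite /sg wi /= ltNge ltW.
rewrite /Ti wi; congr (T _ _); apply: (comp_lift pc) => //; first exact: on_pt.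
move=> k wk ki; rewrite upd_other // ptE /sg wk /=.
have wk0 := ow k wk ki; have := P2 k wk0; case: ifP => [b|/negbT b].
  by rewrite pmulr_lgt0 // => a; rewrite mulr_gt0.
rewrite -leNgt in b => a; rewrite mulNr oppr_gt0 pmulr_rlt0 //; nra.
Qed.

End Existence.

End Sections.
End Good.

(** * Branch points *)

Section UmbrellaModel.
Variable R : realType.
Implicit Types (u : 'rV[R]_2) (w : 'rV[R]_3).

Definition row2 (x y : R) : 'rV[R]_2 := \row_(k < 2) [:: x; y]`_k.

Lemma row2E0 x y : row2 x y 0 0 = x. Proof. by rewrite mxE. Qed.
Lemma row2E1 x y : row2 x y 0 1 = y. Proof. by rewrite mxE. Qed.

Lemma ord2 (P : 'I_2 -> Prop) : P 0 -> P 1 -> forall i, P i.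
Proof.
move=> P0 P1 [[|[|]] // h].
- by rewrite (_ : Ordinal h = 0) //; apply: val_inj.
- by rewrite (_ : Ordinal h = 1) //; apply: val_inj.
Qed.

Local Notation wh := (@whitney_umbrella R).

Lemma whE u : wh u = row3 (u 0 0) (u 0 0 * u 0 1) (u 0 1 ^+ 2).
Proof. by []. Qed.

(** The implicit equation b^2 = a^2 c of the Whitney umbrella. *)
Definition umb w : R := w 0 1 * w 0 1 - w 0 0 * w 0 0 * w 0 2.

Lemma umb_wh u : umb (wh u) = 0.
Proof. by rewrite /umb whE !row3E; ring. Qed.

Lemma wh_inj u u' : u 0 0 != 0 -> wh u = wh u' -> u = u'.
Proof.
rewrite !whE => u0 /rowP E; have := E 0; have := E 1; rewrite !row3E => e1 e0.
apply/rowP; apply: ord2 => //; rewrite -e0 in e1.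
exact: (mulfI u0 e1).
Qed.

(** Zeros of [umb] outside the image form the handle of the umbrella: a zero with nonzero a is the
    image of (a, b / a), and one with a = b = 0 and nonnegative c is the image of (0, sqrt c). *)
Lemma umb_image w : umb w = 0 -> (forall u, wh u <> w) ->
  [/\ w 0 0 = 0, w 0 1 = 0 & w 0 2 < 0].
Proof.
move=> F0 nw; move: F0; rewrite /umb -!expr2 => /eqP; rewrite subr_eq0 => /eqP E.
have [w0|w0] := eqVneq (w 0 0) 0; last first.
  exfalso; apply: (nw (row2 (w 0 0) (w 0 1 / w 0 0))).
  rewrite whE !(row2E0, row2E1) [RHS]row3_eta; congr row3.
    by rewrite mulrC divfK.
  by rewrite expr_div_n E mulrC mulKf // sqrf_eq0.
have w1 : w 0 1 = 0 by move: E; rewrite w0 expr0n /= mul0r => /eqP; rewrite sqrf_eq0 => /eqP.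
split => //; rewrite ltNge; apply/negP => w2.
apply: (nw (row2 0 (Num.sqrt (w 0 2)))).
by rewrite whE !(row2E0, row2E1) sqr_sqrtr // mul0r [RHS]row3_eta w0 w1.
Qed.

(** For a radius at most 1 the bound on y^2 gives |y| < 1, so |x y| is bounded by |x|. *)
Lemma box_wh r u : r <= 1 -> `|u 0 0| < r -> u 0 1 ^+ 2 < r -> box r (wh u).
Proof.
move=> r1 ux uy; have uy1 : `|u 0 1| < 1.
  by rewrite -(@ltr_pXn2r _ 2) ?nnegrE // expr1n real_normK ?num_real // (lt_le_trans uy).
rewrite whE; apply: ord3; rewrite row3E //.
  rewrite normrM; apply: le_lt_trans ux.
  by rewrite ler_piMr // ltW.
by rewrite ger0_norm // sqr_ge0.
Qed.

Lemma box_whP r u : box r (wh u) -> `|u 0 0| < r /\ u 0 1 ^+ 2 < r.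
Proof.
rewrite whE => b; have := b 0; have := b 2; rewrite !row3E.
by rewrite ger0_norm ?sqr_ge0.
Qed.

Lemma row3_continuous (T : topologicalType) (f g h : T -> R) x :
  {for x, continuous f} -> {for x, continuous g} -> {for x, continuous h} ->
  {for x, continuous (fun z => row3 (f z) (g z) (h z))}.
Proof.
move=> cf cg ch; apply: mx_continuous => i; rewrite (ord1 i); apply: ord3.
- by rewrite (funext (fun z => row3E0 (f z) (g z) (h z))).
- by rewrite (funext (fun z => row3E1 (f z) (g z) (h z))).
- by rewrite (funext (fun z => row3E2 (f z) (g z) (h z))).
Qed.

End UmbrellaModel.

Section Derivatives.
Variables (R : realType) (V : normedModType R) (f0 f1 f2 : V -> R).
(** The equation of the umbrella evaluated on three scalar functions; its derivative is expanded
    below so that continuity and nonvanishing can be read off. *)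
Definition umb3 (y : V) : R := f1 y * f1 y - f0 y * f0 y * f2 y.

Lemma differentiable_umb3 y : differentiable f0 y -> differentiable f1 y ->
  differentiable f2 y -> differentiable umb3 y.
Proof.
move=> d0 d1 d2.
apply: (@differentiableB _ _ _ (fun y => f1 y * f1 y) (fun y => f0 y * f0 y * f2 y)).
  exact: (differentiableM d1 d1).
exact: (differentiableM (differentiableM d0 d0) d2).
Qed.

Lemma derive_umb3 y v : derivable f0 y v -> derivable f1 y v -> derivable f2 y v ->
  'D_v umb3 y = (f1 y * 'D_v f1 y + f1 y * 'D_v f1 y) -
    (f0 y * f0 y * 'D_v f2 y + f2 y * (f0 y * 'D_v f0 y + f0 y * 'D_v f0 y)).
Proof.
move=> d0 d1 d2.
have d00 : derivable (f0 * f0) y v := derivableM d0 d0.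
have d11 : derivable (f1 * f1) y v := derivableM d1 d1.
have d002 : derivable (f0 * f0 * f2) y v := derivableM d00 d2.
rewrite (_ : umb3 = f1 * f1 - f0 * f0 * f2) //.
by rewrite (deriveB d11 d002) (deriveM d1 d1) (deriveM d00 d2) (deriveM d0 d0).
Qed.

Lemma derive_umb3_continuous (U : set V) v x : open U -> U x ->
  (forall y, U y -> [/\ differentiable f0 y, differentiable f1 y & differentiable f2 y]) ->
  [/\ {for x, continuous (fun y => 'D_v f0 y)}, {for x, continuous (fun y => 'D_v f1 y)} &
    {for x, continuous (fun y => 'D_v f2 y)}] ->
  {for x, continuous (fun y => 'D_v umb3 y)}.
Proof.
move=> oU Ux dU [c0 c1 c2].
pose K y := (f1 y * 'D_v f1 y + f1 y * 'D_v f1 y) -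
    (f0 y * f0 y * 'D_v f2 y + f2 y * (f0 y * 'D_v f0 y + f0 y * 'D_v f0 y)).
have E y : U y -> 'D_v umb3 y = K y.
  by move=> /dU [d0 d1 d2]; apply: derive_umb3; exact: diff_derivable.
have [d0 d1 d2] := dU x Ux.
have C0 := differentiable_continuous d0.
have C1 := differentiable_continuous d1.
have C2 := differentiable_continuous d2.
rewrite /prop_for /continuous_at E //.
have C : K @ x --> K x := cvgB (cvgD (cvgM C1 c1) (cvgM C1 c1))
  (cvgD (cvgM (cvgM C0 C0) c2) (cvgM C2 (cvgD (cvgM C0 c0) (cvgM C0 c0)))).
have H : {near x, K =1 (fun y => 'D_v umb3 y)}.
  have : \forall y \near x, U y by apply: open_nbhs_nbhs.
  by apply: filterS => y Uy; rewrite E.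
by move=> A /C; apply: filterS2 H => y Ky; rewrite /preimage /= -Ky.
Qed.


End Derivatives.

Section Umbrella.
Variables (R : realType) (D : diagram R).
Local Notation S := (surf D).
Local Notation pr p := (p *m projmx D).
Local Notation wh := (@whitney_umbrella R).
Implicit Types (p q : 'rV[R]_4) (n w y : 'rV[R]_3) (u : 'rV[R]_2).

(** The domain of [phi] is described through the box of the chart, so that it shrinks with the
    chart. Unlike [planes], this record contains no orientation: [umbrella_C1] supplies the
    continuity of derivatives from which the side of the normals is determined. *)
Record umbrella (c : chart R) (phi : 'rV[R]_2 -> 'rV[R]_4) : Prop := Umbrella {
  umbrella_rad : rad c <= 1;
  umbrella_surf : forall u, box (rad c) (wh u) -> S (phi u);
  umbrella_proj : forall u, box (rad c) (wh u) -> pr (phi u) = point c (wh u);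
  umbrella_continuous : forall u, box (rad c) (wh u) -> {for u, continuous phi};
  umbrella_cover : forall p w, S p -> box (rad c) w -> pr p = point c w ->
    exists2 u, wh u = w & p = phi u;
  umbrella_inj : forall u v, box (rad c) (wh u) -> box (rad c) (wh v) ->
    phi u = phi v -> u = v;
  umbrella_near : forall u (P : set 'rV[R]_2), box (rad c) (wh u) -> nbhs u P ->
    \forall p \near phi u, S p -> exists v, [/\ box (rad c) (wh v), P v & p = phi v];
  umbrella_C1 : forall w v k, box (rad c) w ->
    {for point c w, continuous (fun y => 'D_v (fun z => coords c z 0 k) y)} }.

Lemma chart_at p : S p ->
  (exists c wall lft i, [/\ planes D c wall lft, wall i, point c 0 = pr p & p = lft i 0]) \/
  (exists c phi, [/\ umbrella c phi, point c 0 = pr p & p = phi 0]).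
Proof.
move=> Sp; have [] := proj_generic Sp.
- move=> [k [k3 [V [Psi [Psi' [phi [[Vy y0] diffeo param [img disj] model]]]]]]]; left.
  pose wall : pred 'I_3 := fun i => (i < k)%N.
  (* The [k] pieces of the model become the walls with index below [k]; the other indices get a
     constant map. *)
  pose phi3 (i : 'I_3) := if (insub (val i) : option 'I_k) is Some j then phi j else fun _ => 0.
  have phi3E (i : 'I_3) (wi : wall i) : phi3 i = phi (Ordinal (wi : (i < k)%N)).
    by rewrite /phi3 insubT.
  have widenE (i : 'I_3) (wi : (i < k)%N) : widen_ord k3 (Ordinal wi) = i by exact: val_inj.
  have [||||||||c [lft [pc c0]]] := @planes_of_model R D V Psi Psi' wall phi3 _ _ _ _ _ _ (pr p).
  - exact: diffeo.
  - by move=> i wi; rewrite phi3E; exact: param.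
  - move=> q Sq Vq; have : [set p | S p /\ V (pr p)] q by [].
    rewrite img => -[j _ [u cu uq]]; exists (widen_ord k3 j), u.
    have wj : wall (widen_ord k3 j) by exact: (ltn_ord j).
    split => //; rewrite phi3E -uq; congr (phi _ _); exact: val_inj.
  - move=> i u wi cu; rewrite phi3E.
    suff [] : [set p | S p /\ V (pr p)] (phi (Ordinal wi) u) by [].
    by rewrite img; exists (Ordinal wi) => //; exists u.
  - move=> i j u v wi wj cu cv; rewrite !phi3E => /(disj _ _ _ _ cu cv) E.
    by rewrite -(widenE i wi) -(widenE j wj) E.
  - by move=> i u wi cu; rewrite phi3E model //; congr coord_plane; exact: widenE.
  - exact: Vy.
  - exact: y0.
  have b0 : box (rad c) 0 by apply: box0; exact: rad_gt0.
  have [i [wi _ pE]] := planes_cover pc Sp b0 (esym c0).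
  by exists c, wall, lft, i.
- move=> [V [Psi [Psi' [phi [[Vy y0] diffeo param [img _] model]]]]]; right.
  have [[oV _] [sPsi sPsi'] [VPsi cPsi'] PsiK Psi'K] := diffeo.
  have {}PsiK z : V z -> Psi' (Psi z) = z by move=> Vz; apply: PsiK; rewrite inE.
  have {}Psi'K z : cube R 3 z -> Psi (Psi' z) = z by move=> Vz; apply: Psi'K; rewrite inE.
  have c1 w : box 1 w -> differentiable Psi' w.
    by move=> bw; exact: smooth_differentiable sPsi' bw.
  have c3 w : box 1 w -> differentiable Psi (Psi' w).
    by move=> bw; apply: (smooth_differentiable sPsi); exact: cPsi'.
  have c4 w : box 1 w -> \forall z \near Psi' w, exists2 w', box 1 w' & Psi' w' = z.
    move=> bw; have Vw : V (Psi' w) by exact: cPsi'.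
    have : \forall z \near Psi' w, V z by apply: open_nbhs_nbhs.
    by apply: filterS => z Vz; exists (Psi z); [exact: VPsi|exact: PsiK].
  pose c := Chart ltr01 c1 Psi'K c3 c4.
  have [sphi phifree phiinj _] := param ord0.
  have cu u : box 1 (wh u) -> cube R 2 u.
    move=> /box_whP [ux uy]; apply: ord2 => //.
    by rewrite -(@ltr_pXn2r _ 2) ?nnegrE // expr1n real_normK ?num_real.
  have bu u : cube R 2 u -> box 1 (wh u).
    move=> cu'; apply: box_wh => //.
    by rewrite -real_normK ?num_real // expr_lt1.
  have inV u : cube R 2 u -> S (phi ord0 u) /\ V (pr (phi ord0 u)).
    move=> cu'; suff : [set p | S p /\ V (pr p)] (phi ord0 u) by [].
    by rewrite img; exists ord0 => //; exists u.
  have cover q w : S q -> box 1 w -> pr q = Psi' w -> exists2 u, wh u = w & q = phi ord0 u.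
    move=> Sq bw qw; have : [set p | S p /\ V (pr p)] q by split => //; rewrite qw; exact: cPsi'.
    rewrite img => -[j _ [u cu' uq]]; rewrite (ord1 j) in uq; exists u => //.
    by rewrite -(model ord0) // uq qw Psi'K.
  have b0 : box 1 (0 : 'rV[R]_3) by apply: box0.
  have wh0 u : wh u = 0 -> u = 0.
    rewrite whE => /rowP E; have := E 0; have := E 2; rewrite !row3E !mxE => /eqP.
    rewrite sqrf_eq0 => /eqP e1 e0; apply/rowP; apply: ord2; by rewrite mxE.
  exists c, (phi ord0); split => /=.
  + split => //=.
    * by move=> u /cu /inV [].
    * by move=> u bw; rewrite -(model ord0) ?PsiK //; [have [] := inV u (cu u bw) | exact: cu].
    * move=> u /cu cu'; apply: differentiable_continuous.
      exact: smooth_differentiable sphi cu'.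
    * by move=> u v /cu cu' /cu cv; apply: phiinj; rewrite inE.
    * move=> u P /cu cu' uP; have := local_param_near (param ord0) cu' uP.
      by apply: filterS => q Hq /Hq [v [cv Pv <-]]; exists v; split => //; exact: bu.
    * move=> w v k bw; apply: (smooth_coord_derive_continuous oV sPsi); exact: cPsi'.
  + by rewrite -y0 PsiK.
  + have [|u /wh0 -> //] := cover p 0 Sp b0.
    by rewrite -y0 PsiK.
Qed.

Section Facts.
Variables (c : chart R) (phi : 'rV[R]_2 -> 'rV[R]_4).
Hypothesis uc : umbrella c phi.
Local Notation box := (box (rad c)).

Lemma umbrella_regular u : box (wh u) -> u 0 0 != 0 -> regular D (phi u).
Proof.
move=> bu u0; split; first exact: (umbrella_surf uc).
have N : nbhs u [set v : 'rV[R]_2 | v 0 0 != 0].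
  apply: (@near_coord _ 2 u 0 [set x | x != 0]).
  by apply: open_nbhs_nbhs; split => //; exact: open_neq.
move=> cl; have [q [[Sq [q' [Sq' qq' nqq']]] Hq]] := cl _ (umbrella_near uc bu N).
have [v [bv v0 qE]] := Hq Sq; apply: nqq'.
have pq' : pr q' = point c (wh v) by rewrite -qq' qE (umbrella_proj uc).
have [v' v'v q'E] := umbrella_cover uc Sq' bv pq'.
by rewrite qE q'E (wh_inj v0 (esym v'v)).
Qed.

Lemma umbrella_double u : box (wh u) -> u 0 0 = 0 -> u 0 1 != 0 ->
  exists2 v, wh v = wh u & v = - u /\ phi u <> phi v.
Proof.
move=> bu u0 u1; have E : wh (- u) = wh u by rewrite !whE !mxE u0; congr row3; ring.
exists (- u) => //; split => // /(umbrella_inj uc bu _); rewrite E => /(_ bu) /rowP /(_ 1).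
by rewrite mxE => H; move/eqP: u1; apply; lra.
Qed.

Lemma umbrella_lower u : box (wh u) -> u 0 0 = 0 -> u 0 1 != 0 ->
  lower_set D (phi u) \/ lower_set D (phi (- u)).
Proof.
move=> bu u0 u1; have [v vu [vE nuv]] := umbrella_double bu u0 u1.
have bv : box (wh v) by rewrite vu.
have sp : same_proj D (phi u) (phi v).
  by rewrite /same_proj !(umbrella_proj uc) // vu.
have := height_neq sp nuv; rewrite neq_lt -vE => /orP[h|h]; [left|right].
  by split; [exact: (umbrella_surf uc)|exists (phi v); split => //; exact: (umbrella_surf uc)].
split; [exact: (umbrella_surf uc)|exists (phi u); split => //].
exact: (umbrella_surf uc).
Qed.

(** The points with parameters (0, y) and (0, -y) have the same projection, so one of them is lower,
    and both tend to the branch point as y tends to 0. *)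
Lemma branch_lower : closure (lower_set D) (phi 0).
Proof.
have wh00 : wh 0 = 0 by rewrite whE; apply/rowP; apply: ord3; rewrite row3E !mxE; ring.
have b0 : box (wh 0) by rewrite wh00; apply: box0; exact: rad_gt0.
move=> B nB.
have C := umbrella_continuous uc b0.
have N1 : nbhs (0 : 'rV[R]_2) [set u | B (phi u)] by exact: (C _ nB).
have [e /= e0 eB] := (nbhs_ballP _ _).1 N1.
pose y := Num.min (e / 2) (rad c / 2).
have y0 : 0 < y by rewrite lt_min !divr_gt0 // rad_gt0.
have ye : y < e by apply: le_lt_trans (_ : e / 2 < e); rewrite ?ge_min ?lexx //; lra.
have r0 := rad_gt0 c; have r1 := umbrella_rad uc.
have yr : y < rad c by apply: le_lt_trans (_ : rad c / 2 < _); rewrite ?ge_min ?lexx ?orbT //; lra.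
have bE (x : R) : `|x| = y -> box (wh (row2 0 x)) /\ B (phi (row2 0 x)).
  move=> xy; split.
    apply: box_wh => //; rewrite ?row2E0 ?normr0 // row2E1 -real_normK ?num_real // xy; nra.
  apply: eB; split => // i j; rewrite (ord1 i) mxE /ball /= sub0r normrN.
  by move: j; apply: ord2; rewrite ?row2E0 ?normr0 // row2E1 xy.
have yn : `|y| = y by rewrite gtr0_norm.
have [b1 B1] := bE y yn.
have [|b2 B2] := bE (- y); first by rewrite normrN.
have : lower_set D (phi (row2 0 y)) \/ lower_set D (phi (- row2 0 y)).
  by apply: umbrella_lower; rewrite ?row2E0 ?row2E1 ?gt_eqF.
have -> : - row2 0 y = row2 0 (- y).
  by apply/rowP; apply: ord2; rewrite mxE ?row2E0 ?row2E1 ?oppr0.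
by case=> h; eexists; split; [exact: h|exact: B1|exact: h|exact: B2].
Qed.

Lemma lower_double : closure (lower_set D) `<=` closure (double_set D).
Proof.
apply: closure_subset => p [Sp [q [Sq pq h]]]; split => //; exists q; split => // E.
by rewrite E ltxx in h.
Qed.

Lemma regular_umbrella u : box (wh u) -> regular D (phi u) -> u 0 0 != 0.
Proof.
move=> bu [_ ncl]; apply/eqP => u0; apply: ncl.
have [u1|u1] := eqVneq (u 0 1) 0.
  have -> : u = 0 by apply/rowP; apply: ord2; rewrite mxE.
  by apply: lower_double; exact: branch_lower.
have [v vu [_ nuv]] := umbrella_double bu u0 u1.
have bv : box (wh v) by rewrite vu.
apply: subset_closure; split; first exact: (umbrella_surf uc).
exists (phi v); split => //; first exact: (umbrella_surf uc).
by rewrite /same_proj !(umbrella_proj uc) // vu.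
Qed.

End Facts.
End Umbrella.

(** * Regions and sections around a branch point *)

Section UmbrellaSections.
Variables (R : realType) (D : diagram R).
Local Notation S := (surf D).
Local Notation pr p := (p *m projmx D).
Local Notation wh := (@whitney_umbrella R).
Local Notation regular := (regular D).
Local Notation shadow := (shadow D).
Local Notation comp := (comp D).
Implicit Types (p q : 'rV[R]_4) (n w y : 'rV[R]_3) (u : 'rV[R]_2).

(** Branch points are limits of lower points, so no regular point is a branch point. *)
Lemma regular_chart p : regular p ->
  exists c wall lft i, [/\ planes D c wall lft, wall i, point c 0 = pr p & p = lft i 0].
Proof.
move=> rp; have [//|[c [phi [uc c0 pE]]]] := chart_at rp.1.
have wh00 : wh 0 = 0 by rewrite whE; apply/rowP; apply: ord3; rewrite row3E !mxE; ring.
have b0 : box (rad c) (wh 0) by rewrite wh00; apply: box0; exact: rad_gt0.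
by rewrite pE in rp; have := regular_umbrella uc b0 rp; rewrite mxE eqxx.
Qed.

Lemma regular_immersed p : regular p -> immersed D p.
Proof.
move=> rp; have [c [wall [lft [i [pc wi c0 pE]]]]] := regular_chart rp.
have b0 : box (rad c) 0 by apply: box0; exact: rad_gt0.
have z0 : (0 : 'rV[R]_3) 0 i = 0 by rewrite mxE.
apply: (@immersed_retraction _ _ _ (fun y => lft i (coords c y))).
  rewrite -c0; apply: (@differentiable_comp _ _ _ _ (coords c) (lft i)).
    exact: coords_diff.
  by rewrite pointK //; exact: (lift_diff pc).
rewrite pE; apply: filterS (lift_near pc wi b0 z0) => q Hq /Hq [w' [bw' w'0 ->]].
by rewrite (lift_proj pc) // pointK.
Qed.

Section Facts.
Variables (c : chart R) (phi : 'rV[R]_2 -> 'rV[R]_4).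
Hypothesis uc : umbrella D c phi.
Local Notation box := (box (rad c)).

Definition half (s : bool) u : Prop := if s then 0 < u 0 0 else u 0 0 < 0.

Definition half_dom s : set 'rV[R]_2 := [set u | half s u /\ box (wh u)].

Lemma half_neq0 s u : half s u -> u 0 0 != 0.
Proof. by case: s => /= h; rewrite ?(gt_eqF h) // (lt_eqF h). Qed.

Lemma half_regular s u : half_dom s u -> regular (phi u).
Proof. by move=> [/half_neq0 u0 bu]; exact: (umbrella_regular uc). Qed.

(** The parameter domain is convex, because the square is a convex function. *)
Lemma half_connected s : connected (phi @` half_dom s).
Proof.
apply: connected_continuous_connected; last first.
  apply: continuous_in_subspaceT => u; rewrite inE => -[_ bu].
  exact: (umbrella_continuous uc).
apply: convex_connected => u v t [hu bu] [hv bv] t01; split.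
  move: hu hv; rewrite /half; case: s => hu hv; rewrite segE; first exact: convex_gt0.
  by rewrite -oppr_gt0 opprD -!mulrN; apply: convex_gt0; rewrite ?oppr_gt0.
have [ux uy] := box_whP bu; have [vx vy] := box_whP bv.
apply: box_wh; [exact: (umbrella_rad uc)|by rewrite segE; exact: convex_norm_lt|].
rewrite segE -subr_gt0.
have h : 0 < (1 - t) * (rad c - u 0 1 ^+ 2) + t * (rad c - v 0 1 ^+ 2).
  by apply: convex_gt0; rewrite ?subr_gt0.
have /andP[t0 t1] := t01.
have h2 : 0 <= (1 - t) * t * (u 0 1 - v 0 1) ^+ 2.
  by apply: mulr_ge0; [apply: mulr_ge0; rewrite ?subr_ge0|exact: sqr_ge0].
by apply: lt_le_trans h _; rewrite -subr_ge0; apply: le_trans h2 _; rewrite le_eqVlt;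
  apply/orP; left; apply/eqP; ring.
Qed.

Lemma half_comp s u v : half_dom s u -> half_dom s v -> comp (phi u) = comp (phi v).
Proof.
move=> hu hv; apply: same_connected_component.
apply: (connected_component_max _ _ (half_connected (s := s))); [by exists u| |by exists v].
by move=> _ [z hz <-]; exact: half_regular hz.
Qed.

Definition umbF y : R := umb (coords c y).

Lemma umbF_diff w : box w -> differentiable umbF (point c w).
Proof.
move=> bw; apply: (@differentiable_umb3 _ _ (fun y => coords c y 0 0)
  (fun y => coords c y 0 1) (fun y => coords c y 0 2));
  by apply: differentiable_coordE; exact: coords_diff.
Qed.

(** [orientation_const] applies to [umbF] on each half: there the differential is nonzero, being
    -x^2 along the third coordinate direction. *)
Lemma umbrella_side s : exists e : bool, forall u n, half_dom s u ->
  normal_vec D (phi u) n -> 0 < (-1) ^+ e * 'd umbF (point c (wh u)) n.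
Proof.
pose O := [set y | exists2 w, box w & point c w = y].
have oO : open O.
  by rewrite openE => _ [w bw <-]; exact: chart_near.
have [||||||||e He] := @orientation_const R D umbF O (phi @` half_dom s).
- by move=> _ [w bw <-]; exact: umbF_diff.
- move=> v _ [w bw <-]; apply: (derive_umb3_continuous oO); first by exists w.
    by move=> _ [w' bw' <-]; split; apply: differentiable_coordE; exact: coords_diff.
  by split; exact: (umbrella_C1 uc).
- by move=> _ [u [_ bu] <-]; exact: (umbrella_surf uc).
- exact: half_connected.
- move=> _ [u [_ bu] <-].
  have N : nbhs (pr (phi u)) O by rewrite (umbrella_proj uc) //; exact: chart_near.
  have H : nbhs (phi u) [set q | O (pr q)] by exact: (@proj_continuous R D (phi u) _ N).
  by apply: filterS H.
- move=> _ [u [_ bu] <-].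
  apply: filterS (umbrella_near uc bu (@filterT _ _ (nbhs_filter u))) => q Hq /Hq [v [bv _ ->]].
  by rewrite (umbrella_proj uc) // /umbF pointK // umb_wh.
- move=> _ [u [hu bu] <-]; rewrite (umbrella_proj uc) //.
  exists ('d (point c) (wh u) (delta_mx 0 2)).
  have dk k : differentiable (fun y => coords c y 0 k) (point c (wh u)).
    by apply: differentiable_coordE; exact: coords_diff.
  rewrite -deriveE; last exact: umbF_diff.
  set v := 'd _ _ _.
  have vk k : 'D_v (fun y => coords c y 0 k) (point c (wh u)) = (k == 2)%:R.
    rewrite deriveE // diff_coordE; last exact: coords_diff.
    by rewrite diff_coords_point // mxE eqxx.
  have dv k : derivable (fun y => coords c y 0 k) (point c (wh u)) v by exact: diff_derivable.
  have := derive_umb3 (dv 0) (dv 1) (dv 2).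
  rewrite !vk !pointK // => E.
  rewrite (_ : 'D_v umbF _ = - (u 0 0) ^+ 2); last first.
    by rewrite -[LHS]/('D_v (umb3 _ _ _) _) E whE !row3E /=; ring.
  by rewrite oppr_eq0 sqrf_eq0; exact: half_neq0 hu.
- by move=> _ [u hu <-]; apply: regular_immersed; exact: half_regular hu.
exists e => u n hu pn; rewrite -(umbrella_proj uc hu.2); apply: He => //.
Qed.

Lemma near_umb w : umb w != 0 -> nbhs w [set w' : 'rV[R]_3 | 0 < umb w * umb w'].
Proof.
move=> w0.
have ck k := @coord_continuous R 1 3 0 k w.
have C : (fun w' : 'rV[R]_3 => umb w * umb w') @ w --> umb w * umb w.
  apply: (@cvgMl_tmp _ _ _ (nbhs_filter w)).
  exact: (cvgB (cvgM (ck 1) (ck 1)) (cvgM (cvgM (ck 0) (ck 0)) (ck 2))).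
by apply: (cvgr_gt _ C); rewrite -expr2 exprn_even_gt0 //=.
Qed.

(* The image of [(x, y) |-> (x, x y, y^2)] cuts a cube into the parts of [b^2 < a^2 c] with
   [0 < a] and with [a < 0], and the rest, which is connected because the half-line
   [a = b = 0], [c < 0] does not belong to the image. *)
Definition chamber w : option bool := if umb w < 0 then Some (0 < w 0 0) else None.

Definition off_image w := forall u, wh u <> w.

Lemma umbrella_shadow w : box w -> off_image w <-> ~ shadow (point c w).
Proof.
move=> bw; split=> [ow [p Sp pw]|nsh u uw].
  by have [u uw _] := umbrella_cover uc Sp bw pw; exact: (ow u).
by apply: nsh; exists (phi u); rewrite -uw in bw *; [exact: (umbrella_surf uc)|exact:
  (umbrella_proj uc)].
Qed.

Lemma umb_off w : umb w != 0 -> off_image w.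
Proof. by move=> w0 u uw; rewrite -uw umb_wh eqxx in w0. Qed.

Lemma chamber_near w : off_image w -> nbhs w [set w' : 'rV[R]_3 | chamber w' = chamber w].
Proof.
move=> ow; have [w0|w0] := eqVneq (umb w) 0.
  have [z0 z1 z2] := umb_image w0 ow.
  have H : \forall x \near w 0 2, 0 < w 0 2 * x.
    have : (fun x => w 0 2 * x) @ w 0 2 --> w 0 2 * w 0 2 by apply: cvgMl_tmp; exact: cvg_id.
    by move=> /cvgr_gt; apply; rewrite -expr2 exprn_even_gt0 //= lt_eqF.
  apply: filterS (near_coord H) => w' /=; rewrite nmulr_rgt0 // => w'2.
  rewrite /chamber w0 ltxx ltNge (_ : 0 <= umb w') //.
  rewrite /umb subr_ge0 -!expr2; apply: le_trans (sqr_ge0 _).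
  by rewrite nmulr_lle0 ?sqr_ge0.
apply: filterS2 (near_umb w0) (near_sides w) => w' s1 s2; rewrite /= /chamber.
have [neg|pos|/eqP] := ltgtP (umb w) 0; last by rewrite (negbTE w0).
  have -> : umb w' < 0 by rewrite -(nmulr_rgt0 _ neg).
  have wn : w 0 0 != 0.
    by apply: contraTneq neg => e; rewrite /umb e !mul0r subr0 -expr2 -leNgt sqr_ge0.
  congr Some; have := s2 0 wn; move: wn; rewrite neq_lt => /orP[a|a].
    by rewrite nmulr_rgt0 // => b; rewrite !ltNge !ltW.
  by rewrite pmulr_rgt0 // a => ->.
by rewrite ltNge ltW // -(pmulr_rgt0 _ pos).
Qed.

Section Tau.
Variables (G : Type) (T : set 'rV[R]_4 -> G -> G).
Local Notation good := (good D T).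

Variable W : set 'rV[R]_3.
Hypothesis cW : forall w, box w -> W (point c w).

(** Lowering the third coordinate never meets the image: at a meeting point y^2 = c would force
    [umb w] to be nonpositive, hence zero, so [w] would lie on the handle, and then c is negative
    along the whole segment. *)
Lemma low_const tau w : good W tau -> box w -> off_image w -> 0 <= umb w ->
  tau (point c w) = tau (point c (upd w 2 (- (rad c / 2)))).
Proof.
move=> gtau bw ow u0; set w' := upd _ _ _.
have r0 := rad_gt0 c.
have bw' : box w' by apply: box_upd => //; rewrite normrN gtr0_norm; lra.
rewrite -[in LHS](seg0 w w') -[in RHS](seg1 w w').
apply: (good_path gtau) => t t01; have bt : box (seg w w' t) by exact: box_seg.
split; [exact: seg_continuous|exact: bt|exact: cW|apply/(umbrella_shadow bt) => u].
have /andP[t0 t1] := t01.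
rewrite whE => /rowP E; have := E 0; have := E 1; have := E 2.
rewrite !row3E !segE /w' !updE /= => e2 e1 e0.
have {}e0 : u 0 0 = w 0 0 by rewrite e0; ring.
have {}e1 : w 0 0 * u 0 1 = w 0 1 by rewrite -e0 e1; ring.
have w2 : 0 <= w 0 2 + rad c / 2.
  by have := bw 2; rewrite ltr_norml => /andP[? ?]; have := sqr_ge0 (u 0 1); rewrite e2; nra.
have uE : umb w = - (t * (w 0 2 + rad c / 2) * w 0 0 ^+ 2).
  rewrite /umb -e1 (_ : _ * _ * (_ * _) = w 0 0 ^+ 2 * (u 0 1) ^+ 2); last by ring.
  by rewrite e2; ring.
have umb0 : umb w = 0.
  apply/eqP; rewrite eq_le u0 andbT uE oppr_le0.
  by apply: mulr_ge0; [exact: mulr_ge0|exact: sqr_ge0].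
have [_ _ w2n] := umb_image umb0 ow.
by have := sqr_ge0 (u 0 1); rewrite e2; nra.
Qed.

Lemma chamber_const tau w w' : good W tau -> box w -> box w' -> off_image w -> off_image w' ->
  chamber w = chamber w' -> tau (point c w) = tau (point c w').
Proof.
move=> gtau bw bw' ow ow'; rewrite /chamber; have r0 := rad_gt0 c.
have [uw|uw] := ltP (umb w) 0; have [uw'|uw'] := ltP (umb w') 0 => //; last first.
  move=> _.
  (* The image has no point whose third coordinate is negative, so a straight segment joins the two
     lowered points. *)
  rewrite (low_const gtau bw ow uw) (low_const gtau bw' ow' uw').
  set v := upd w _ _; set v' := upd w' _ _.
  have bl (z : 'rV[R]_3) : box z -> box (upd z 2 (- (rad c / 2))).
    by move=> bz; apply: box_upd => //; rewrite normrN gtr0_norm; lra.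
  rewrite -[in LHS](seg0 v v') -[in RHS](seg1 v v').
  apply: (good_path gtau) => t t01.
  have bt : box (seg v v' t) by apply: box_seg => //; exact: bl.
  split; [exact: seg_continuous|exact: bt|exact: cW|apply/(umbrella_shadow bt) => u].
  rewrite whE => /rowP E; have := E 2.
  rewrite row3E segE /v /v' !updE /= => e2.
  by have := sqr_ge0 (u 0 1); rewrite e2; nra.
move=> [sE].
have nz (z : 'rV[R]_3) : umb z < 0 -> z 0 0 != 0.
  by move=> zn; apply: contraTneq zn => e; rewrite /umb e !mul0r subr0 -expr2 -leNgt sqr_ge0.
have sq (z : 'rV[R]_3) : umb z < 0 -> (z 0 1 / z 0 0) ^+ 2 < z 0 2.
  move=> zn; have z0 := nz z zn.
  rewrite expr_div_n ltr_pdivrMr ?exprn_even_gt0 //=.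
  by rewrite -subr_lt0 (_ : _ - _ = umb z) // /umb; ring.
have ww : 0 < w 0 0 * w' 0 0.
  have := nz _ uw; have := nz _ uw'; rewrite !neq_lt => /orP[a'|a'] /orP[a|a].
  - by rewrite nmulr_rgt0.
  - by move: sE; rewrite a ltNge ltW.
  - by move: sE; rewrite a' ltNge ltW.
  - by rewrite mulr_gt0.
pose lin (x x' t : R) := (1 - t) * x + t * x'.
pose b := w 0 1 / w 0 0; pose b' := w' 0 1 / w' 0 0.
(* In the coordinates a, b / a, c the chamber is the convex set (b / a)^2 < c with a of fixed sign,
   and the path is a segment there. *)
pose g t := row3 (lin (w 0 0) (w' 0 0) t) (lin (w 0 0) (w' 0 0) t * lin b b' t)
  (lin (w 0 2) (w' 0 2) t).
have g0 : g 0 = w.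
  rewrite /g /lin !subr0 !mul1r !mul0r !addr0 [RHS]row3_eta; congr row3.
  by rewrite mulrC divfK // nz.
have g1 : g 1 = w'.
  rewrite /g /lin !subrr !mul1r !mul0r !add0r [RHS]row3_eta; congr row3.
  by rewrite mulrC divfK // nz.
rewrite -[in LHS]g0 -[in RHS]g1.
have clin x x' t : {for t, continuous (lin x x')}.
  apply: (@cvgD _ _ _ _ (nbhs_filter t)); apply: (@cvgMr_tmp _ _ _ (nbhs_filter t));
    last exact: cvg_id.
  by apply: (@cvgB _ _ _ _ (nbhs_filter t)); [exact: cvg_cst|exact: cvg_id].
apply: (good_path gtau) => t t01; have /andP[t0 t1] := t01.
have a0 : lin (w 0 0) (w' 0 0) t != 0.
  have := seg_sign ww t01; rewrite segE -/(lin _ _ _).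
  by apply: contraTneq => ->; rewrite mulr0 ltxx.
have bc : lin b b' t ^+ 2 < lin (w 0 2) (w' 0 2) t.
  have h : 0 < (1 - t) * (w 0 2 - b ^+ 2) + t * (w' 0 2 - b' ^+ 2).
    by apply: convex_gt0; rewrite ?subr_gt0 //; exact: sq.
  have h2 : 0 <= (1 - t) * t * (b - b') ^+ 2 by apply: mulr_ge0; [apply: mulr_ge0;
    rewrite ?subr_ge0|exact: sqr_ge0].
  by rewrite /lin; nra.
have cr : `|lin (w 0 2) (w' 0 2) t| < rad c by apply: convex_norm_lt.
have ar : `|lin (w 0 0) (w' 0 0) t| < rad c by apply: convex_norm_lt.
have bt : box (g t).
  rewrite /g; apply: ord3; rewrite row3E // normrM; apply: le_lt_trans ar.
  rewrite ler_piMr // -(@ler_pXn2r _ 2) ?nnegrE // expr1n real_normK ?num_real // ltW //.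
  apply: lt_trans bc _; apply: le_lt_trans (ler_norm _) _.
  exact: lt_le_trans cr (umbrella_rad uc).
split; [|exact: bt|exact: cW|apply/(umbrella_shadow bt) => u].
  apply: row3_continuous; [exact: clin| |exact: clin].
  by apply: (@cvgM _ _ _ (nbhs_filter t)); exact: clin.
rewrite whE => /rowP E; have := E 0; have := E 1; have := E 2.
rewrite /g !row3E => e2 e1 e0; rewrite e0 in e1.
by move: bc; rewrite -e2 (mulfI a0 e1) ltxx.
Qed.


(** The normal line changes the sign of [umb]: the positive side belongs to the chamber [None], the
    negative side near the half [s] to [Some s], and [e] tells in which direction the normal
    points. *)
Lemma umbrella_sides s (e : bool) u n : half_dom s u ->
  (forall v m, half_dom s v -> normal_vec D (phi v) m ->
    0 < (-1) ^+ e * 'd umbF (point c (wh v)) m) ->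
  normal_vec D (phi u) n ->
  \forall t \near 0^'+, exists w1 w2,
    [/\ [/\ box w1, point c w1 = point c (wh u) + t *: n, off_image w1 &
          chamber w1 = if e then Some s else None] &
        [/\ box w2, point c w2 = point c (wh u) - t *: n, off_image w2 &
          chamber w2 = if e then None else Some s]].
Proof.
move=> hu He pn; have := He u n hu pn; have [hs bu] := hu.
have dF := umbF_diff bu.
have F0 : umbF (point c (wh u)) = 0 by rewrite /umbF pointK // umb_wh.
have u0 : wh u 0 0 != 0 by rewrite whE row3E; exact: half_neq0 hs.
have pos w : box w -> 0 < umbF (point c w) -> off_image w /\ chamber w = None.
  move=> bw; rewrite /umbF pointK // => h; split; first by apply: umb_off; rewrite gt_eqF.
  by rewrite /chamber ltNge ltW.
have neg w : box w -> umbF (point c w) < 0 -> (forall k, wh u 0 k != 0 -> 0 < wh u 0 k * w 0 k) ->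
    off_image w /\ chamber w = Some s.
  move=> bw; rewrite /umbF pointK // => h near; split; first by apply: umb_off; rewrite lt_eqF.
  rewrite /chamber h; congr Some; have := near 0 u0; move: hs; rewrite /half whE row3E.
  case: s {hu He} => a; first by rewrite pmulr_rgt0.
  by rewrite nmulr_rgt0 // => b; rewrite ltNge ltW.
case: e {He} => /=; rewrite ?mul1r ?mulN1r => Fn.
  have Fn' : 0 < 'd umbF (point c (wh u)) (- n) by rewrite linearN.
  apply: filterS (line_sides bu dF F0 Fn' (near_sides (wh u))) =>
    t [w1 [w2 [[b1 e1 s1 P1] [b2 e2 s2 P2]]]].
  exists w2, w1; have [? ?] := pos _ b1 s1; have [? ?] := neg _ b2 s2 P2.
  by split; split; rewrite ?e1 ?e2 // ?scalerN // opprK.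
apply: filterS (line_sides bu dF F0 Fn (near_sides (wh u))) =>
  t [w1 [w2 [[b1 e1 s1 P1] [b2 e2 s2 P2]]]].
exists w1, w2; have [? ?] := pos _ b1 s1; have [? ?] := neg _ b2 s2 P2.
by split; split.
Qed.

Lemma umbrella_cross s (e : bool) u tau w1 w2 : half_dom s u ->
  (forall v m, half_dom s v -> normal_vec D (phi v) m ->
    0 < (-1) ^+ e * 'd umbF (point c (wh v)) m) ->
  good W tau -> box w1 -> box w2 -> off_image w1 -> off_image w2 ->
  chamber w1 = (if e then Some s else None) -> chamber w2 = (if e then None else Some s) ->
  tau (point c w1) = T (comp (phi u)) (tau (point c w2)).
Proof.
move=> hu He gtau b1 b2 o1 o2 ch1 ch2; have [_ bu] := hu.
have [n pn] := normal_vec_ex (umbrella_surf uc bu).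
have prE := umbrella_proj uc bu.
have Wu : W (pr (phi u)) by rewrite prE; exact: cW.
have H1 := gtau.2 _ _ (half_regular hu) Wu pn.
have [t [_ E [w1' [w2' [[b1' e1 o1' c1'] [b2' e2 o2' c2']]]]]] :=
  right_ex H1 (umbrella_sides hu He pn).
rewrite prE -e1 -e2 in E.
rewrite (chamber_const gtau b1 b1' o1 o1' (etrans ch1 (esym c1'))).
by rewrite (chamber_const gtau b2 b2' o2 o2' (etrans ch2 (esym c2'))).
Qed.

Lemma chamber_ex k : exists w, [/\ box w, off_image w & chamber w = k].
Proof.
have r0 := rad_gt0 c; pose h := rad c / 2.
have h0 : 0 < h by rewrite divr_gt0.
have hr : h < rad c by rewrite /h; lra.
have n0 : `|0 : R| < rad c by rewrite normr0.
have nh : `|h| < rad c by rewrite gtr0_norm.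
case: k => [s|].
  pose w := row3 (if s then h else - h) 0 h.
  have uw : umb w = - h ^+ 3 by rewrite /umb /w !row3E; case: ifP => _; ring.
  have un : umb w < 0 by rewrite uw oppr_lt0 exprn_gt0.
  exists w; split; [|by apply: umb_off; rewrite lt_eqF|].
    by rewrite /w; apply: ord3; rewrite row3E //; case: ifP; rewrite ?normrN.
  by rewrite /chamber un /w row3E; case: ifP => _; rewrite ?h0 // oppr_gt0 ltNge ltW.
pose w := row3 0 h 0.
have uw : umb w = h ^+ 2 by rewrite /umb /w !row3E; ring.
have up : 0 < umb w by rewrite uw exprn_gt0.
exists w; split; [|by apply: umb_off; rewrite gt_eqF|by rewrite /chamber ltNge ltW].
by rewrite /w; apply: ord3; rewrite row3E.
Qed.

Lemma half_dom_ex s : exists u, half_dom s u.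
Proof.
have r0 := rad_gt0 c; exists (row2 (if s then rad c / 2 else - (rad c / 2)) 0).
split; first by rewrite /half row2E0; case: s; rewrite ?oppr_lt0 divr_gt0.
apply: box_wh; [exact: (umbrella_rad uc)| |by rewrite row2E1 expr0n].
by rewrite row2E0; case: s; rewrite ?normrN gtr0_norm ?divr_gt0 //; lra.
Qed.

(** Each half separates the chamber [None] from one chamber [Some s], and the transport across it is
    injective, so agreement passes both ways. *)
Lemma good_unique_umbrella tau tau' w w' : T_bij D T -> good W tau -> good W tau' ->
  box w -> off_image w -> box w' -> off_image w' ->
  tau (point c w) = tau' (point c w) -> tau (point c w') = tau' (point c w').
Proof.
move=> bT g g' bw ow bw' ow' E.
pose agree k := forall z, box z -> off_image z -> chamber z = k ->
  tau (point c z) = tau' (point c z).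
have agree1 z : box z -> off_image z -> tau (point c z) = tau' (point c z) -> agree (chamber z).
  move=> bz oz Ez v bv ov vz.
  by rewrite (chamber_const g bv bz ov oz vz) (chamber_const g' bv bz ov oz vz).
have step s : agree None <-> agree (Some s).
  have [u hu] := half_dom_ex s; have [e He] := umbrella_side s.
  have [w1 [b1 o1 c1]] := chamber_ex (if e then Some s else None).
  have [w2 [b2 o2 c2]] := chamber_ex (if e then None else Some s).
  have cr := umbrella_cross hu He g b1 b2 o1 o2 c1 c2.
  have cr' := umbrella_cross hu He g' b1 b2 o1 o2 c1 c2.
  have Tinj := bij_inj (bT _ (comp_component (half_regular hu))).
  have a12 : agree (chamber w1) <-> agree (chamber w2).
    split=> a; apply: agree1 => //.
      by apply: Tinj; rewrite -cr -cr'; exact: a.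
    by rewrite cr cr' a.
  by rewrite c1 c2 in a12; case: e {He cr cr' c1 c2} a12 => a12 //; split => /a12.
have all k : agree k.
  have : agree (chamber w) by exact: agree1.
  case: (chamber w) => [s /step|] aN; case: k => [s'|] //; exact/step.
exact: (all (chamber w')).
Qed.

End Tau.

Section Existence.
Variables (G : Type) (T : set 'rV[R]_4 -> G -> G).

Lemma good_exists_umbrella w0 g : T_bij D T -> box w0 -> off_image w0 ->
  exists tau, good D T [set y | exists2 w, box w & point c w = y] tau /\ tau (point c w0) = g.
Proof.
move=> bT bw0 ow0.
have /choice [us hus] := half_dom_ex; have /choice [e He] := umbrella_side.
have Tbij s : bijective (T (comp (phi (us s)))).
  by apply: bT; apply: comp_component; exact: half_regular (hus s).
have /choice [f Hf] : forall s, exists f, cancel (T (comp (phi (us s)))) f /\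
    cancel f (T (comp (phi (us s)))).
  by move=> s; have [f fK Kf] := Tbij s; exists f.
(* The value [g0] on the chamber [None] determines the two others, by transport across the
   corresponding half, forwards or backwards according to its normal. *)
pose lam g0 k := match k with
  | None => g0
  | Some s => if e s then T (comp (phi (us s))) g0 else f s g0 end.
have lamE g0 s : lam g0 (if e s then Some s else None) =
    T (comp (phi (us s))) (lam g0 (if e s then None else Some s)).
  by rewrite /lam; case es: (e s); rewrite ?es // (Hf s).2.
have [g0 g0E] : exists g0, lam g0 (chamber w0) = g.
  rewrite /lam; case: (chamber w0) => [s|]; last by exists g.
  case: (e s); first by exists (f s g); exact: (Hf s).2.
  by exists (T (comp (phi (us s))) g); exact: (Hf s).1.
exists (fun y => lam g0 (chamber (coords c y))); split; last by rewrite pointK.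
split=> [_ [w bw <-] ns|p n rp [w bw wp] pn].
  have ow : off_image w by apply/(umbrella_shadow bw).
  apply: filterS (coords_near bw (chamber_near ow)) => _ [w' [bw' <- chw]].
  by rewrite !pointK //; congr lam.
have [u uw pE] := umbrella_cover uc rp.1 bw (esym wp).
rewrite pE in rp pn wp *; rewrite -uw in bw wp.
have [s hs] : exists s, half_dom s u.
  have := regular_umbrella uc bw rp; rewrite neq_lt => /orP[h|h].
    by exists false.
  by exists true.
rewrite -wp; apply: filterS (umbrella_sides hs (He s) pn) =>
  t [w1 [w2 [[b1 e1 o1 c1] [b2 e2 o2 c2]]]].
by rewrite -e1 -e2 !pointK // c1 c2 lamE (half_comp (hus s) hs).
Qed.

End Existence.
End Facts.
End UmbrellaSections.

(** * Monodromy *)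

Section Monodromy.
Variables (R : realType) (D : diagram R).
Local Notation S := (surf D).
Local Notation pr p := (p *m projmx D).
Local Notation regular := (regular D).
Local Notation shadow := (shadow D).
Local Notation comp := (comp D).
Implicit Types (p q : 'rV[R]_4) (n w y z : 'rV[R]_3) (A B N W : set 'rV[R]_3).

Lemma shadow_closed : closed shadow.
Proof.
have -> : shadow = (fun p => pr p) @` S by [].
apply: compact_closed; first exact: norm_hausdorff.
apply: continuous_compact; last exact: surf_compact.
by apply: continuous_subspaceT => p; exact: mulmxr_continuous.
Qed.

Lemma near_off_shadow y : ~ shadow y -> \forall z \near y, ~ shadow z.
Proof.
move=> ny; apply: (@open_nbhs_nbhs _ y (~` shadow)); split => //.
exact: closed_openC shadow_closed.
Qed.

Lemma planes_shrink (c : chart R) wall lft r (r0 : 0 < r) (rc : r <= rad c) :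
  planes D c wall lft -> planes D (shrink r0 rc) wall lft.
Proof.
move=> pc; have bl w : box r w -> box (rad c) w by exact: box_le.
split => /=.
- by move=> i w wi /bl bw w0; exact: (lift_surf pc).
- by move=> i w wi /bl bw w0; exact: (lift_proj pc).
- by move=> i w wi /bl bw; exact: (lift_diff pc).
- by move=> p w Sp /bl bw pw; exact: (planes_cover pc).
- by move=> i j w wi wj /bl bw; exact: (lift_inj pc).
- move=> i w wi bw w0; apply: filterS (lift_near_in pc wi (bl _ bw) w0 (near_box bw)).
  by move=> p Hp /Hp [w' [_ ? ? ?]]; exists w'.
- by move=> i w n wi /bl bw w0; exact: (lift_orient pc).
Qed.

Lemma umbrella_shrink (c : chart R) phi r (r0 : 0 < r) (rc : r <= rad c) :
  umbrella D c phi -> umbrella D (shrink r0 rc) phi.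
Proof.
move=> uc; have bl w : box r w -> box (rad c) w by exact: box_le.
split => /=.
- exact: le_trans rc (umbrella_rad uc).
- by move=> u /bl bu; exact: (umbrella_surf uc).
- by move=> u /bl bu; exact: (umbrella_proj uc).
- by move=> u /bl bu; exact: (umbrella_continuous uc).
- by move=> p w Sp /bl bw pw; exact: (umbrella_cover uc).
- by move=> u v /bl bu /bl bv; exact: (umbrella_inj uc).
- move=> u P bu uP.
  have C : {for u, continuous (@whitney_umbrella R)}.
    have ck k : {for u, continuous (fun u : 'rV[R]_2 => u 0 k)}.
      exact: (@coord_continuous R 1 2 0 k u).
    have -> : @whitney_umbrella R =
      fun u : 'rV[R]_2 => row3 (u 0 0) (u 0 0 * u 0 1) (u 0 1 * u 0 1) by [].
    apply: row3_continuous; [exact: ck|exact: (cvgM (ck 0) (ck 1))|exact: (cvgM (ck 1) (ck 1))].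
  have N : nbhs u [set v | box r (whitney_umbrella v)] by exact: (C _ (near_box bu)).
  apply: filterS (umbrella_near uc (bl _ bu) (filterI uP N)) => p Hp /Hp [v [_ [Pv bv] ->]].
  by exists v.
- by move=> w v k /bl bw; exact: (umbrella_C1 uc).
Qed.

(** Off the projected surface a translated box without walls serves as a chart, so that such points
    fall under the case of planes. *)
Lemma empty_chart y : ~ shadow y -> exists c : chart R, planes D c xpred0 (fun _ _ =>
  0) /\ point c 0 = y.
Proof.
move=> ny; have did (x : 'rV[R]_3) : differentiable (fun z : 'rV[R]_3 => z) x.
  by have [] := is_diff_id x.
have N : nbhs (0 : 'rV[R]_3) [set w | ~ shadow (y + w)].
  have C : (fun w => y + w) @ (0 : 'rV[R]_3) --> y + 0.
    have d0 : differentiable (fun w : 'rV[R]_3 => y + w) 0.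
      exact: (differentiableD (differentiable_cst y 0) (did 0)).
    exact: (differentiable_continuous d0).
  have H : nbhs (y + 0) [set z | ~ shadow z] by rewrite addr0; exact: near_off_shadow.
  exact: (C _ H).
have [r r0 rN] := nbhs0_box N.
have dp w : box r w -> differentiable (fun w => y + w) w.
  by move=> _; exact: (differentiableD (differentiable_cst y w) (did w)).
have pK w : box r w -> (y + w) - y = w by move=> _; rewrite addrC addKr.
have dc w : box r w -> differentiable (fun z => z - y) (y + w).
  move=> _; exact: (differentiableB (did (y + w)) (differentiable_cst y (y + w))).
have cn w : box r w -> \forall z \near y + w, exists2 w', box r w' & y + w' = z.
  move=> bw; have C : (fun z => z - y) @ (y + w) --> y + w - y.
    exact: (differentiable_continuous (dc w bw)).
  have H : nbhs (y + w - y) (box r) by rewrite pK //; exact: near_box.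
  have H2 : nbhs (y + w) [set z | box r (z - y)] by exact: (C _ H).
  apply: filterS H2 => z bz; exists (z - y) => //; exact: subrKC.
exists (Chart r0 dp pK dc cn); split; last by rewrite /= addr0.
split => //= p w Sp bw pw; exfalso; apply: (rN w bw).
by exists p.
Qed.

(** * Continuation along segments *)

Section Transport.
Variables (G : Type) (T : set 'rV[R]_4 -> G -> G).
Hypotheses (bT : T_bij D T) (sqT : square_rule D T).
Local Notation good := (good D T).

Definition solvable N := forall z g, N z -> ~ shadow z -> exists tau, good N tau /\ tau z = g.

Definition rigid N := forall W tau tau' z z', N `<=` W -> good W tau -> good W tau' ->
  N z -> ~ shadow z -> N z' -> ~ shadow z' -> tau z = tau' z -> tau z' = tau' z'.

(** The local input of the continuation, at regular, singular and exterior points alike. The set [N]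
    is the image of a box of a chart, shrunk into [W]. *)
Lemma local_chart y W : nbhs y W ->
  exists N, [/\ nbhs y N, N `<=` W, exists2 z, N z & ~ shadow z, rigid N & solvable N].
Proof.
move=> yW.
have planes_case c wall lft : planes D c wall lft -> point c 0 = y ->
    exists N, [/\ nbhs y N, N `<=` W, exists2 z, N z & ~ shadow z, rigid N & solvable N].
  move=> pc c0; have [|r [r0 rc rW]] := @chart_small R c W; first by rewrite c0.
  have pc' := planes_shrink r0 rc pc; set c' := shrink r0 rc in pc'.
  exists [set y | exists2 w, box (rad c') w & point c' w = y]; split.
  - by have := chart_near (box0 (rad_gt0 c')); rewrite /= c0.
  - by move=> _ [w bw <-]; exact: rW.
  - have h0 : 0 < r / 2 by rewrite divr_gt0.
    pose w : 'rV[R]_3 := row3 (r / 2) (r / 2) (r / 2).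
    have we i : w 0 i = r / 2 by move: i; apply: ord3; rewrite /w row3E.
    have bw : box (rad c') w by move=> i; rewrite we gtr0_norm //=; lra.
    exists (point c' w); first by exists w.
    by apply/(generic_shadow pc' bw) => i _; rewrite we gt_eqF.
  - move=> W' tau tau' _ _ NW g g' [w bw <-] ns [w' bw' <-] ns'.
    apply: (good_unique_planes pc' (W := W') _ bT g g') => //.
    + by move=> v bv; apply: NW; exists v.
    + exact/(generic_shadow pc' bw).
    + exact/(generic_shadow pc' bw').
  - move=> _ g [w bw <-] ns; apply: (good_exists_planes pc' g sqT bT bw).
    exact/(generic_shadow pc' bw).
have umbrella_case c phi : umbrella D c phi -> point c 0 = y ->
    exists N, [/\ nbhs y N, N `<=` W, exists2 z, N z & ~ shadow z, rigid N & solvable N].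
  move=> uc c0; have [|r [r0 rc rW]] := @chart_small R c W; first by rewrite c0.
  have uc' := umbrella_shrink r0 rc uc; set c' := shrink r0 rc in uc'.
  exists [set y | exists2 w, box (rad c') w & point c' w = y]; split.
  - by have := chart_near (box0 (rad_gt0 c')); rewrite /= c0.
  - by move=> _ [w bw <-]; exact: rW.
  - have [w [bw ow _]] := chamber_ex c' None; exists (point c' w); first by exists w.
    exact/(umbrella_shadow uc' bw).
  - move=> W' tau tau' _ _ NW g g' [w bw <-] ns [w' bw' <-] ns'.
    apply: (good_unique_umbrella uc' (W := W') _ bT g g') => //.
    + by move=> v bv; apply: NW; exists v.
    + exact/(umbrella_shadow uc' bw).
    + exact/(umbrella_shadow uc' bw').
  - move=> _ g [w bw <-] ns; apply: (good_exists_umbrella uc' g bT bw).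
    exact/(umbrella_shadow uc' bw).
have [[p Sp py]|ny] := pselect (shadow y); last first.
  by have [c [pc c0]] := empty_chart ny; exact: planes_case pc c0.
have [[c [wall [lft [i [pc _ c0 _]]]]]|[c [phi [uc c0 _]]]] := chart_at Sp.
  by apply: planes_case pc _; rewrite c0.
by apply: umbrella_case uc _; rewrite c0.
Qed.

Lemma shadow_dense y W : nbhs y W -> exists2 z, W z & ~ shadow z.
Proof. by move=> /local_chart [N [_ NW [z Nz nz] _ _]]; exists z => //; exact: NW. Qed.

Definition convex_set W := forall z z' t, W z -> W z' -> 0 <= t <= 1 -> W (seg z z' t).

(** What propagates along the segment is agreement near a point, off the projected surface;
    agreement at the point itself would say nothing where the segment meets that surface. *)
Lemma good_unique W tau tau' z z' : open W -> convex_set W -> good W tau -> good W tau' ->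
  W z -> ~ shadow z -> W z' -> ~ shadow z' -> tau z = tau' z -> tau z' = tau' z'.
Proof.
move=> oW cW g g' Wz nz Wz' nz' E.
pose P y := nbhs y [set v | ~ shadow v -> tau v = tau' v].
have lc (t : R) : 0 <= t <= 1 -> \forall s \near t, 0 <= s <= 1 -> P (seg z z' s) = P (seg z z' t).
  move=> t01; have Wt : W (seg z z' t) by exact: cW.
  have [N [tN NW _ rN _]] := local_chart (open_nbhs_nbhs (conj oW Wt)).
  have spread x : nbhs x N -> P x -> forall v, N v -> ~ shadow v -> tau v = tau' v.
    move=> xN Px v Nv nv; have [u [Nu Pu] nu] := shadow_dense (filterI xN Px).
    exact: (rN W tau tau' u v NW g g' Nu nu Nv nv (Pu nu)).
  have tN' : nbhs t [set s | nbhs (seg z z' s) N].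
    exact: (@seg_continuous R 3 z z' t _ (nbhs_interior tN)).
  apply: filterS tN' => s sN _; apply/propext; split=> Px.
    by apply: filterS tN => v Nv; exact: spread sN Px v Nv.
  by apply: filterS sN => v Nv; exact: spread tN Px v Nv.
have := locally_constant_segment lc; rewrite seg0 seg1 => P01.
have Pz : P z.
  have [N [zN NW _ rN _]] := local_chart (open_nbhs_nbhs (conj oW Wz)).
  have Nz := nbhs_singleton zN; apply: filterS zN => v Nv nv.
  exact: (rN W tau tau' z v NW g g' Nz nz Nv nv E).
have : P z' by rewrite -P01.
by move=> /nbhs_singleton; apply.
Qed.

Lemma normal_off_shadow p n : regular p -> normal_vec D p n ->
  \forall t \near 0^'+, ~ shadow (pr p + t *: n) /\ ~ shadow (pr p - t *: n).
Proof.
move=> rp pn; have [c [wall [lft [i [pc wi c0 pE]]]]] := regular_chart rp.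
have b0 : box (rad c) 0 by apply: box0; exact: rad_gt0.
have onw : on_wall c wall i 0 by split => //; rewrite mxE.
rewrite pE in rp pn; have ow := regular_off pc onw rp.
have only k : wall k -> k = i.
  by move=> wk; apply/eqP; apply: contraTT isT => ki; have := ow k wk ki; rewrite mxE eqxx.
rewrite -c0; apply: filterS (normal_sides pc onw pn (near_sides 0)).
move=> t [w1 [w2 [[b1 e1 s1 _] [b2 e2 s2 _]]]]; rewrite -e1 -e2; split.
  by apply/(generic_shadow pc b1) => k /only ->; rewrite gt_eqF.
by apply/(generic_shadow pc b2) => k /only ->; rewrite lt_eqF.
Qed.

(** Values on the projected surface do not matter, since close to a regular point the normal line
    meets it nowhere else. *)
Lemma good_ext W tau tau' : open W -> good W tau ->
  (forall v, W v -> ~ shadow v -> tau' v = tau v) -> good W tau'.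
Proof.
move=> oW [g1 g2] E; split=> [y Wy ny|p n rp Wp pn].
  have nW : \forall z \near y, W z by apply: open_nbhs_nbhs.
  apply: filterS3 (g1 y Wy ny) nW (near_off_shadow ny) => z zy Wz nz.
  by rewrite !E.
have nW (e : R) : \forall t \near (0 : R), W (pr p + t *: (e *: n)).
  have C : (fun t : R => pr p + t *: (e *: n)) @ (0 : R) --> pr p + 0 *: (e *: n).
    exact: (cvgD (cvg_cst _) (@scalel_continuous _ _ (e *: n) (0 : R))).
  have H : nbhs (pr p + 0 *: (e *: n)) W by rewrite scale0r addr0; apply: open_nbhs_nbhs.
  exact: (C _ H).
apply: filterS2 (filterI (g2 p n rp Wp pn) (normal_off_shadow rp pn))
  (filterI (near_right (nW 1)) (near_right (nW (- 1)))) => t [tE [n1 n2]] [W1 W2].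
rewrite scale1r in W1; rewrite scaleN1r scalerN in W2.
by rewrite !E.
Qed.

Lemma good_glue A B s s' : open A -> open B -> good A s -> good B s' ->
  (forall v, A v -> B v -> ~ shadow v -> s v = s' v) ->
  exists tau, [/\ good (A `|` B) tau & forall v, A v -> tau v = s v].
Proof.
move=> oA oB gs gs' E; exists (fun v => if pselect (A v) then s v else s' v).
have EA v : A v -> (if pselect (A v) then s v else s' v) = s v by case: pselect.
split => //.
have gA : good A (fun v => if pselect (A v) then s v else s' v).
  by apply: good_ext oA gs _ => v Av _; exact: EA.
have gB : good B (fun v => if pselect (A v) then s v else s' v).
  by apply: good_ext oB gs' _ => v Bv nv; case: pselect => // Av; exact: E.
split=> [y [Ay|By]|p n rp [Ap|Bp]].
- exact: gA.1.
- exact: gB.1.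
- exact: gA.2.
- exact: gB.2.
Qed.

Variables (y0 : 'rV[R]_3) (g0 : G).
Hypothesis ny0 : ~ shadow y0.

Definition tube y (rho t : R) : set 'rV[R]_3 :=
  [set v | exists2 s, 0 <= s <= t & `|v - seg y0 y s| < rho].

Lemma tube_open y rho t : open (tube y rho t).
Proof.
rewrite openE => v [s st vs].
have : \forall z \near v, `|z - seg y0 y s| < rho.
  have C : (fun z => `|z - seg y0 y s|) @ v --> `|v - seg y0 y s|.
    exact: (cvg_norm (cvgB (@cvg_id _ (nbhs v)) (cvg_cst _))).
  exact: (cvgr_lt _ C).
by apply: filterS => z zs; exists s.
Qed.

Lemma ball_convex (x : 'rV[R]_3) rho z z' t (x' : 'rV[R]_3) :
  `|z - x| < rho -> `|z' - x'| < rho -> 0 <= t <= 1 ->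
  `|seg z z' t - seg x x' t| < rho.
Proof.
move=> zx zx' t01; have -> : seg z z' t - seg x x' t = (1 - t) *: (z - x) + t *: (z' - x').
  by apply/rowP => k; rewrite !mxE; ring.
have /andP[t0 t1] := t01.
apply: le_lt_trans (ler_normD _ _) _; rewrite !normrZ (ger0_norm t0) ger0_norm ?subr_ge0 //.
rewrite -subr_gt0.
have := @convex_gt0 R (rho - `|z - x|) (rho - `|z' - x'|) t _ _ t01.
rewrite !subr_gt0 => /(_ zx zx') h; lra.
Qed.

Lemma tube_convex y rho t : convex_set (tube y rho t).
Proof.
move=> z z' a [s /andP[s0 st] zs] [s' /andP[s'0 s't] z's] a01; have /andP[a0 a1] := a01.
exists ((1 - a) * s + a * s').
  apply/andP; split; first by rewrite addr_ge0 // mulr_ge0 // subr_ge0.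
  have h1 : 0 <= (1 - a) * (t - s) by rewrite mulr_ge0 // subr_ge0.
  have h2 : 0 <= a * (t - s') by rewrite mulr_ge0 // subr_ge0.
  by lra.
have -> : seg y0 y ((1 - a) * s + a * s') = seg (seg y0 y s) (seg y0 y s') a.
  by apply/rowP => k; rewrite !segE; ring.
exact: ball_convex.
Qed.

(** [delta] is a Lebesgue number of the segment for the neighbourhoods given by [local_chart]. *)
Lemma lebesgue y : exists2 delta : R, 0 < delta & forall t, 0 <= t <= 1 ->
  exists N, [/\ solvable N, rigid N & forall v, `|v - seg y0 y t| < delta -> N v].
Proof.
pose P (delta t : R) :=
  exists N, [/\ solvable N, rigid N & forall v, `|v - seg y0 y t| < delta -> N v].
have K : compact `[0 : R, 1]%classic by exact: segment_compact.
have H : \forall d \near (0 : R)^'+, `[0 : R, 1]%classic `<=` P d.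
  apply: ((compact_near_coveringP _).1 K R ((0 : R)^'+) P _).
  move=> t _; have [N [tN _ _ rN sN]] := local_chart (@filterT _ _ (nbhs_filter (seg y0 y t))).
  have [e /= e0 eN] := (nbhs_ballP _ _).1 tN.
  have e20 : 0 < e / 2 by rewrite divr_gt0.
  have C : seg y0 y @ t --> seg y0 y t by exact: seg_continuous.
  have H1 : \forall t' \near t, `|seg y0 y t - seg y0 y t'| < e / 2.
    by move/cvgrPdist_lt : C; apply.
  have H2 : \forall d \near (0 : R)^'+, d < e / 2 by exact: nbhs_right_lt.
  exists ([set t' | `|seg y0 y t - seg y0 y t'| < e / 2], [set d | d < e / 2]) => //.
  move=> [t' d] [/= h1 h2]; exists N; split => // v vd; apply: eN.
  rewrite -ball_normE /= -(subrK (seg y0 y t') (seg y0 y t)) -addrA.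
  apply: le_lt_trans (ler_normD _ _) _; rewrite -(normrN (seg y0 y t' - v)) opprB.
  by have := lt_trans vd h2; lra.
by have [d [d0 dP _]] := right_ex H H; exists d.
Qed.

Lemma tube_section y : exists rho tau, [/\ 0 < rho, good (tube y rho 1) tau & tau y0 = g0].
Proof.
have [delta d0 HN] := lebesgue y; pose rho := delta / 2.
have rho0 : 0 < rho by rewrite divr_gt0.
(* A parameter step of length [eta] moves the point of the segment by less than [rho]; as [rho] is
   half of [delta], the tube around the new piece fits into the [delta]-ball around the last point
   reached. The added 1 covers the case [y = y0]. *)
pose eta := rho / (`|y - y0| + 1).
have n1 : 0 < `|y - y0| + 1 by rewrite ltr_wpDl.
have eta0 : 0 < eta by rewrite divr_gt0.
have short a b : 0 <= b - a <= eta -> `|seg y0 y b - seg y0 y a| < rho.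
  move=> /andP[ab0 ab]; have -> : seg y0 y b - seg y0 y a = (b - a) *: (y - y0).
    by apply/rowP => k; rewrite !mxE; ring.
  rewrite normrZ ger0_norm //; apply: le_lt_trans (_ : eta * `|y - y0| < _).
    exact: ler_wpM2r.
  by rewrite /eta -mulrA gtr_pMr // ltr_pdivrMl // mulr1 ltrDl.
pose t (m : nat) : R := Num.min 1 (m%:R * eta).
have t01 m : 0 <= t m <= 1.
  by rewrite le_min ler01 ge_min lexx /= mulr_ge0 // ltW.
have tS m : 0 <= t m.+1 - t m <= eta.
  have h : m.+1%:R * eta = m%:R * eta + eta by rewrite -natr1 mulrDl mul1r.
  by rewrite /t h /Num.min; case: ifP => h1; case: ifP => h2; lra.
have start s : 0 <= s -> tube y rho s y0.
  by move=> s0; exists 0; rewrite ?lexx //= seg0 subrr normr0.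
have ball_tube m v : `|v - seg y0 y (t m)| < rho -> tube y rho (t m) v.
  by move=> vm; exists (t m) => //; have /andP[-> _] := t01 m; rewrite lexx.
have IH m : exists tau, good (tube y rho (t m)) tau /\ tau y0 = g0.
  elim: m => [|m [s [gs s0]]].
    have h01 : 0 <= (0 : R) <= 1 by rewrite lexx ler01.
    have [N [sN rN NB]] := HN 0 h01.
    have Ny0 : N y0 by apply: NB; rewrite seg0 subrr normr0.
    have [tau [gtau tau0]] := sN y0 g0 Ny0 ny0; exists tau; split => //.
    apply: good_sub gtau => v [a]; rewrite /t mul0r => /andP[a0 a1].
    have -> : a = 0 by apply/eqP; rewrite eq_le a0 andbT; apply: le_trans a1 _;
      rewrite ge_min lexx orbT.
    by move=> va; apply: NB; apply: lt_trans va _; rewrite /rho; lra.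
  have [N [sN rN NB]] := HN (t m) (t01 m).
  pose B := [set v : 'rV[R]_3 | `|v - seg y0 y (t m)| < delta].
  have oB : open B.
    rewrite openE => v Bv.
    have C : (fun z => `|z - seg y0 y (t m)|) @ v --> `|v - seg y0 y (t m)|.
      exact: (cvg_norm (cvgB (@cvg_id _ (nbhs v)) (cvg_cst _))).
    exact: (cvgr_lt _ C).
  have cB : convex_set B.
    move=> z z' a Bz Bz' a01; rewrite /B /=.
    have -> : seg y0 y (t m) = seg (seg y0 y (t m)) (seg y0 y (t m)) a.
      by rewrite /seg subrr scaler0 addr0.
    exact: ball_convex.
  have Bm : B (seg y0 y (t m)) by rewrite /B /= subrr normr0.
  have Tm : tube y rho (t m) (seg y0 y (t m)) by apply: ball_tube; rewrite subrr normr0.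
  have oT := @tube_open y rho (t m); have cT := @tube_convex y rho (t m).
  have oI : open (tube y rho (t m) `&` B) by exact: openI.
  have [z [Tz Bz] nz] := shadow_dense (open_nbhs_nbhs (conj oI (conj Tm Bm))).
  (* The next section is chosen to agree with [s] at one point of the overlap; as the overlap is
     convex, they agree on all of it off the projected surface. *)
  have [s' [gs' s'z]] := sN z (s z) (NB z Bz) nz.
  have gs'B : good B s' by apply: good_sub gs' => v; exact: NB.
  have agree v : tube y rho (t m) v -> B v -> ~ shadow v -> s v = s' v.
    move=> Tv Bv nv; apply: (@good_unique _ s s' z v oI) => //.
    - move=> a b c [Ta Ba] [Tb Bb] c01; split; [exact: cT|exact: cB].
    - by apply: good_sub gs => ? [].
    - by apply: good_sub gs'B => ? [].
  have [tau [gtau tauE]] := good_glue oT oB gs gs'B agree.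
  exists tau; split; last by rewrite tauE //; apply: start; have /andP[] := t01 m.
  apply: good_sub gtau => v [a /andP[a0 a1] va].
  have [am|am] := leP a (t m); first by left; exists a => //; rewrite a0.
  right; rewrite /B /= -(subrK (seg y0 y a) v) -addrA.
  apply: le_lt_trans (ler_normD _ _) _.
  have h : `|seg y0 y a - seg y0 y (t m)| < rho.
    by apply: short; have /andP[? ?] := tS m; apply/andP; split; lra.
  by move: va h; rewrite /rho; lra.
have [m m1] : exists m : nat, 1 <= m%:R * eta.
  exists (Num.bound (eta^-1)); rewrite -ler_pdivrMr // mul1r ltW //.
  by apply: archi_boundP; rewrite invr_ge0 ltW.
have [tau [gtau tau0]] := IH m; exists rho, tau; split => //.
by move: gtau; rewrite /t; have -> : Num.min 1 (m%:R * eta) = 1 by apply/min_idPl.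
Qed.

Lemma tube_end y rho : 0 < rho -> tube y rho 1 y.
Proof. by move=> r0; exists 1; rewrite ?ler01 ?lexx // seg1 subrr normr0. Qed.

Lemma tube_start y rho : 0 < rho -> tube y rho 1 y0.
Proof. by move=> r0; exists 0; rewrite ?ler01 ?lexx // seg0 subrr normr0. Qed.

(** Every [y] has its own tube, with its own radius. The sections of two tubes agree off the
    projected surface on the intersection, which is convex and contains [y0], so the values taken at
    the ends of the tubes fit together. *)
Theorem monodromy : exists tau, good setT tau /\ tau y0 = g0.
Proof.
have /choice [F HF] : forall y, exists rs : R * ('rV[R]_3 -> G),
    [/\ 0 < rs.1, good (tube y rs.1 1) rs.2 & rs.2 y0 = g0].
  by move=> y; have [rho [tau H]] := tube_section y; exists (rho, tau).
pose tau y := (F y).2 y; exists tau.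
have E y v : tube y (F y).1 1 v -> ~ shadow v -> tau v = (F y).2 v.
  have [r0 g1 e1] := HF y; have [r0' g1' e1'] := HF v.
  move=> Tv nv; rewrite /tau.
  apply: (@good_unique (tube y (F y).1 1 `&` tube v (F v).1 1) _ _ y0 v) => //.
  - by apply: openI; exact: tube_open.
  - by move=> a b c [? ?] [? ?] c01; split; exact: tube_convex.
  - by apply: good_sub g1' => ? [].
  - by apply: good_sub g1 => ? [].
  - by split; exact: tube_start.
  - by split => //; exact: tube_end.
  - by rewrite e1 e1'.
split; last by rewrite /tau; have [] := HF y0.
have gy y : good (tube y (F y).1 1) tau.
  have [r0 g1 _] := HF y; apply: good_ext (@tube_open _ _ _) g1 _ => v; exact: E.
split=> [y _ ny|p n rp _ pn].
  by apply: (gy y).1 => //; apply: tube_end; have [] := HF y.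
by apply: (gy (pr p)).2 => //; apply: tube_end; have [] := HF (pr p).
Qed.

Lemma good_unique_global tau tau' : good setT tau -> good setT tau' ->
  tau y0 = tau' y0 -> forall z, ~ shadow z -> tau z = tau' z.
Proof.
move=> g g' E z nz; apply: (@good_unique setT tau tau' y0 z openT) => //.
Qed.

End Transport.
End Monodromy.

(** * Sheets and semi-sheets *)

Section Sheets.
Variables (R : realType) (D : diagram R).
Local Notation S := (surf D).
Local Notation pr p := (p *m projmx D).
Local Notation regular := (regular D).
Local Notation above := (above D).
Local Notation comp := (comp D).
Implicit Types (p q : 'rV[R]_4) (n w z : 'rV[R]_3) (A B : set 'rV[R]_4).

Lemma regular_above : regular `<=` above.
Proof. by move=> p [Sp ncl]; split => // /lower_double. Qed.

Lemma above_near p : above p -> \forall q \near p, S q -> above q.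
Proof.
move=> [Sp ncl].
have : \forall q \near p, (~` closure (lower_set D)) q.
  apply: open_nbhs_nbhs; split => //.
  exact: closed_openC (@closed_closure _ _).
by apply: filterS => q ? ?; split.
Qed.

Lemma height_continuous p : {for p, continuous (fun q => height D q)}.
Proof.
exact: (continuous_comp (@mulmxr_continuous R 1 4 1 (hgt D) p)
  (@coord_continuous R 1 1 0 0 (p *m hgt D))).
Qed.

Lemma lift_height_near (c : chart R) wall lft i : planes D c wall lft -> wall i ->
  (forall k, wall k -> k != i -> height D (lft k 0) < height D (lft i 0)) ->
  nbhs (0 : 'rV[R]_3) [set w | forall k, wall k -> k != i ->
    height D (lft k w) < height D (lft i w)].
Proof.
move=> pc wi hlt; have b0 : box (rad c) 0 by apply: box0; exact: rad_gt0.
apply: (@filter_forall _ _ (fun k (w : 'rV[R]_3) => wall k -> k != i ->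
  height D (lft k w) < height D (lft i w)) _ (nbhs_filter (0 : 'rV[R]_3))) => k.
have [wk|nwk] := boolP (wall k); last exact: nearW.
have [->|ki] := eqVneq k i; first by apply: nearW => w _ /eqP.
have C j : wall j -> (fun w => height D (lft j w)) @ (0 : 'rV[R]_3) --> height D (lft j 0).
  move=> wj; have dl := differentiable_continuous (lift_diff pc wj b0).
  exact: (continuous_comp dl (@height_continuous _)).
have C2 : (fun w => height D (lft i w) - height D (lft k w)) @ (0 : 'rV[R]_3) -->
    height D (lft i 0) - height D (lft k 0).
  by apply: (@cvgB _ _ _ _ (nbhs_filter (0 : 'rV[R]_3))); exact: C.
have h0 : 0 < height D (lft i 0) - height D (lft k 0) by rewrite subr_gt0; exact: hlt.
have := @cvgr_gt _ _ _ (nbhs_filter (0 : 'rV[R]_3)) _ _ C2 _ h0.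
by apply: filterS => w /=; rewrite subr_gt0.
Qed.

(** Outside the closure of the lower set there are no branch points and the sheet of [p] is the
    highest over its projection; by continuity of the height this persists in a smaller chart. *)
Lemma above_chart p : above p -> exists (c : chart R) wall lft i,
  [/\ planes D c wall lft, wall i, point c 0 = pr p, p = lft i 0 &
     (forall w, box (rad c) w -> w 0 i = 0 -> above (lft i w)) /\
     (forall j w, wall j -> j != i -> box (rad c) w ->
        height D (lft j w) < height D (lft i w))].
Proof.
move=> ap; have [Sp ncl] := ap.
have [[c [wall [lft [i [pc wi c0 pE]]]]]|[c [phi [uc c0 pE]]]] := chart_at Sp; last first.
  by case: ncl; rewrite pE; exact: branch_lower uc.
have b0 : box (rad c) 0 by apply: box0; exact: rad_gt0.
have z0 k : (0 : 'rV[R]_3) 0 k = 0 by rewrite mxE.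
have onw k : wall k -> on_wall c wall k 0 by split.
have hlt k : wall k -> k != i -> height D (lft k 0) < height D (lft i 0).
  move=> wk ki; rewrite lt_neqAle; have ik : i != k by rewrite eq_sym.
  have nki := lift_neq pc (onw k wk) (onw i wi) ki.
  have sp : same_proj D (lft k 0) (lft i 0) by rewrite /same_proj !(lift_proj pc).
  rewrite (height_neq sp nki) leNgt /=; apply/negP => h; apply: ncl; apply: subset_closure.
  split => //; exists (lft k 0); split; [exact: (lift_surf pc)| |by rewrite pE].
  by rewrite pE /same_proj !(lift_proj pc).
have N1 : nbhs (0 : 'rV[R]_3) [set w | S (lft i w) -> above (lft i w)].
  have dl := lift_diff pc wi b0; rewrite pE in ap.
  have H : nbhs (lft i 0) [set q | S q -> above q] by exact: above_near.
  exact: (differentiable_continuous dl H).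
have N2 := lift_height_near pc wi hlt.
have [r r0 rN] := nbhs0_box (filterI N1 N2).
have mr0 : 0 < Num.min r (rad c) by rewrite lt_min r0 rad_gt0.
have mrc : Num.min r (rad c) <= rad c by rewrite ge_min lexx orbT.
have mr : Num.min r (rad c) <= r by rewrite ge_min lexx.
exists (shrink mr0 mrc), wall, lft, i; split => //; first exact: planes_shrink.
split=> [w bw wi0|j w wj ji bw]; have [h1 h2] := rN w (box_le mr bw); last exact: h2.
by apply: h1; apply: (lift_surf pc) => //; exact: box_le bw.
Qed.

Lemma sheet_near p : above p -> \forall q \near p, S q -> connected_component above p q.
Proof.
move=> ap; have [c [wall [lft [i [pc wi c0 pE [ab _]]]]]] := above_chart ap.
have b0 : box (rad c) 0 by apply: box0; exact: rad_gt0.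
have z0 : (0 : 'rV[R]_3) 0 i = 0 by rewrite mxE.
rewrite pE; apply: filterS (lift_near pc wi b0 z0) => q Hq /Hq [w [bw w0 ->]].
have bs t : 0 <= t <= 1 -> box (rad c) (seg 0 w t) by exact: box_seg.
have zs t : seg 0 w t 0 i = 0 by rewrite segE w0 mxE !mulr0 addr0.
rewrite -[X in connected_component _ (lft i X)](seg0 0 w).
rewrite (@connected_component_path R _ above (fun t => lft i (seg 0 w t))).
- by rewrite seg1; apply: connected_component_refl; exact: ab.
- move=> t t01; apply: (continuous_comp (@seg_continuous R 3 0 w t)).
  by apply: differentiable_continuous; apply: (lift_diff pc) => //; exact: bs.
- by move=> t t01; apply: ab; [exact: bs|exact: zs].
Qed.

(** Moving all coordinates but the [i]-th to a small positive value leaves every other wall. *)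
Lemma regular_dense p : above p -> forall P, nbhs p P -> exists q, regular q /\ P q.
Proof.
move=> ap P pP; have [c [wall [lft [i [pc wi c0 pE _]]]]] := above_chart ap.
have r0 := rad_gt0 c; have b0 : box (rad c) 0 by exact: box0.
have N : nbhs (0 : 'rV[R]_3) [set w | P (lft i w)].
  by rewrite pE in pP; exact: (differentiable_continuous (lift_diff pc wi b0) pP).
have [e e0 eN] := nbhs0_box N.
pose h := Num.min e (rad c) / 2.
have m0 : 0 < Num.min e (rad c) by rewrite lt_min e0.
have he : h < e by rewrite /h ltr_pdivrMr // gt_min; apply/orP; left; lra.
have hr : h < rad c by rewrite /h ltr_pdivrMr // gt_min; apply/orP; right; lra.
have h0 : 0 < h by rewrite divr_gt0.
pose w := upd (row3 h h h) i 0.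
have we k : `|w 0 k| <= h.
  rewrite /w updE; case: ifP => _; first by rewrite normr0 ltW.
  by move: k; apply: ord3; rewrite row3E gtr0_norm.
exists (lft i w); split; last by apply: eN => k; exact: le_lt_trans (we k) he.
apply: (lift_regular pc).
  by split; [exact: wi|move=> k; exact: le_lt_trans (we k) hr|rewrite upd_same].
move=> k wk ki; rewrite upd_other //.
by move: k {wk ki}; apply: ord3; rewrite row3E gt_eqF.
Qed.

(** Near [q] its wall remains strictly the highest, so no lower points accumulate there; and [q] is
    no branch point, since over a branch point the surface has only one point. *)
Lemma upper_above p q : double_point D p q -> above q.
Proof.
move=> [[Sp Sq] pq h only]; split => // cl.
have [[c [wall [lft [i [pc wi c0 qE]]]]]|[c [phi [uc c0 qE]]]] := chart_at Sq; last first.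
  have wh00 : whitney_umbrella 0 = 0 :> 'rV[R]_3.
    by rewrite whE; apply/rowP; apply: ord3; rewrite row3E !mxE; ring.
  have b0 : box (rad c) 0 by apply: box0; exact: rad_gt0.
  have pc0 : pr p = point c 0 by rewrite c0 pq.
  have [u u0 pE] := umbrella_cover uc Sp b0 pc0.
  have uz : u = 0.
    move: u0; rewrite whE => /rowP E; have := E 0; have := E 2; rewrite !row3E !mxE => /eqP.
    by rewrite sqrf_eq0 => /eqP e1 e0; apply/rowP; apply: ord2; rewrite mxE.
  by rewrite pE qE uz ltxx in h.
have b0 : box (rad c) 0 by apply: box0; exact: rad_gt0.
have z0 k : (0 : 'rV[R]_3) 0 k = 0 by rewrite mxE.
have onw k : wall k -> on_wall c wall k 0 by split.
have hlt k : wall k -> k != i -> height D (lft k 0) < height D (lft i 0).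
  move=> wk ki; have spq : same_proj D (lft k 0) p.
    by rewrite /same_proj pq -c0 (lift_proj pc).
  have [->|kq] := only _ (lift_surf pc wk b0 (z0 k)) spq; first by rewrite -qE.
  by case: (lift_neq pc (onw k wk) (onw i wi) ki); rewrite kq.
have N2 := lift_height_near pc wi hlt.
have H := lift_near_in pc wi b0 (z0 i) N2; rewrite -qE in H.
have [v [[Sv [v' [Sv' vv' hv]]] Hv]] := cl _ H.
have {Hv} [w [bw w0 vE hw]] := Hv Sv.
have pv' : pr v' = point c w by rewrite -vv' vE (lift_proj pc).
have [k [wk wk0 v'E]] := planes_cover pc Sv' bw pv'.
have [ki|ki] := eqVneq k i; first by rewrite v'E vE ki ltxx in hv.
have hv' : height D v' < height D v by rewrite v'E vE; exact: hw.
by have := lt_trans hv hv'; rewrite ltxx.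
Qed.

Lemma double_chart p q : double_point D p q -> exists (c : chart R) wall lft i j,
  [/\ planes D c wall lft, on_wall c wall i 0 /\ on_wall c wall j 0, i != j,
     off_both wall i j (0 : 'rV[R]_3) & p = lft i 0 /\ q = lft j 0].
Proof.
move=> dp; have [[Sp Sq] pq h only] := dp.
have [c [wall [lft [j [pc wj c0 qE _]]]]] := above_chart (upper_above dp).
have b0 : box (rad c) 0 by apply: box0; exact: rad_gt0.
have z0 k : (0 : 'rV[R]_3) 0 k = 0 by rewrite mxE.
have pc0 : pr p = point c 0 by rewrite c0 pq.
have [i [wi _ pE]] := planes_cover pc Sp b0 pc0.
have onw k : wall k -> on_wall c wall k 0 by split.
exists c, wall, lft, i, j; split; [exact: pc|by split; exact: onw| | |by []].
  by apply/eqP => ij; rewrite pE qE ij ltxx in h.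
move=> k wk ki kj; exfalso.
have spq : same_proj D (lft k 0) p by rewrite /same_proj pc0 (lift_proj pc).
have [kp|kq] := only _ (lift_surf pc wk b0 (z0 k)) spq.
  by apply: (lift_neq pc (onw k wk) (onw i wi) ki); rewrite kp.
by apply: (lift_neq pc (onw k wk) (onw j wj) kj); rewrite kq.
Qed.

(** In the chart of [above_chart] the point lies on the highest wall. The other coordinates are set
    to [e] one after the other; a change of sign crosses a double curve in the upper sheet, where
    [hB] preserves [h]. *)
Lemma local_sheet_value (Y : Type) (h : set 'rV[R]_4 -> Y) p :
  (forall q r B B', double_point D q r -> is_component regular B ->
     is_component regular B' -> behind D r q B -> ahead D r q B' -> h B = h B') ->
  above p -> exists y, \forall q \near p, regular q -> h (comp q) = y.
Proof.
move=> hB ap; have [c [wall [lft [i [pc wi c0 pE [_ low]]]]]] := above_chart ap.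
have r0 := rad_gt0 c; have b0 : box (rad c) 0 by exact: box0.
have z0 : (0 : 'rV[R]_3) 0 i = 0 by rewrite mxE.
pose e := rad c / 2.
have e0 : 0 < e by rewrite divr_gt0.
have er : e < rad c by rewrite /e; lra.
have en : `|e| < rad c by rewrite gtr0_norm.
have nen : `|- e| < rad c by rewrite normrN.
pose ok w := on_wall c wall i w /\ off_others wall i w.
have step w k : ok w -> k != i ->
  ok (upd w k e) /\ h (comp (lft i w)) = h (comp (lft i (upd w k e))).
  move=> [onw ow] ki; have ik : i != k by rewrite eq_sym.
  have onu x : `|x| < rad c -> on_wall c wall i (upd w k x) by exact: upd_on_wall.
  have ou x : x != 0 -> off_others wall i (upd w k x).
    by move=> x0 j wj ji; rewrite updE; have [//|jk] := eqVneq j k; exact: ow.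
  split; first by split; [exact: onu|apply: ou; rewrite gt_eqF].
  have same x x' : `|x| < rad c -> `|x'| < rad c -> (wall k -> 0 < x * x') ->
      comp (lft i (upd w k x)) = comp (lft i (upd w k x')).
    move=> xr xr' xx; apply: (comp_lift pc); [exact: onu|exact: onu|].
    move=> j wj ji; rewrite !updE; case: eqP => [jk|_]; first by apply: xx; rewrite -jk.
    by rewrite -expr2 exprn_even_gt0 //=; exact: ow.
  have [_ bw _] := onw; rewrite -[in LHS](upd_id w k).
  have [wk|nwk] := boolP (wall k); last by rewrite (same _ e) // (negbTE nwk).
  have wk0 := ow k wk ki; move: (wk0); rewrite neq_lt => /orP[neg|pos]; last first.
    by rewrite (same _ e) // => _; exact: mulr_gt0.
  rewrite (same _ (- e)) //; last by move=> _; rewrite mulrN oppr_gt0 pmulr_llt0.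
  have n0 : `|0 : R| < rad c by rewrite normr0.
  pose u := upd w k 0.
  have oi : on_wall c wall i u by exact: onu.
  have okk : on_wall c wall k u by split => //; [exact: box_upd | rewrite upd_same].
  have oik : off_both wall i k u by move=> j wj ji jk; rewrite upd_other //; exact: ow.
  have oki : off_both wall k i u by move=> j wj jk ji; exact: oik.
  have dp : double_point D (lft k u) (lft i u).
    by apply: (double_point_lift pc) => //; apply: low => //; case: oi.
  have er' : 0 < e < rad c by rewrite e0.
  have bB := behind_comp pc oi okk ik oik er'.
  have aB := ahead_comp pc oi okk ik oik er'.
  rewrite -(upd_upd w k 0 (- e)) -(upd_upd w k 0 e).
  have cmp x : `|x| < rad c -> x != 0 -> is_component regular (comp (lft i (upd u k x))).
    move=> xr x0; apply: comp_component; rewrite /u upd_upd.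
    by apply: (lift_regular pc); [exact: onu|exact: ou].
  by apply: (hB _ _ _ _ dp) => //; apply: cmp => //; rewrite ?oppr_eq0 gt_eqF.
pose f k w := if k == i then w else upd w k e.
have fstep w k : ok w -> ok (f k w) /\ h (comp (lft i w)) = h (comp (lft i (f k w))).
  by move=> okw; rewrite /f; have [|ki] := eqVneq k i; [split|exact: step].
exists (h (comp (lft i (upd (row3 e e e) i 0)))).
rewrite pE; apply: filterS (lift_near pc wi b0 z0) => q Hq rq.
have [w [bw w0 qE]] := Hq rq.1; rewrite qE in rq *.
have onw : on_wall c wall i w by [].
have okw : ok w by split => //; exact: (regular_off pc onw rq).
have [ok1 ->] := fstep w 0 okw.
have [ok2 ->] := fstep _ 1 ok1.
have [ok3 ->] := fstep _ 2 ok2.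
congr (h (comp (lft i _))); apply/rowP => k; rewrite updE.
have [->|ki] := eqVneq k i; first by case: ok3 => -[].
move: k ki; apply: ord3; rewrite row3E /f => /negbTE ki.
- by case: ifP => _; case: ifP => _; rewrite ki !updE /=.
- by case: ifP => _; rewrite ki !updE /=.
- by rewrite ki !updE /=.
Qed.

(** Local values are unique because regular points are dense, and they agree along the connected
    sheet. *)
Lemma sheet_value (Y : Type) (h : set 'rV[R]_4 -> Y) a :
  (forall q r B B', double_point D q r -> is_component regular B ->
     is_component regular B' -> behind D r q B -> ahead D r q B' -> h B = h B') ->
  is_component above a -> exists y, forall p, a p -> regular p -> h (comp p) = y.
Proof.
move=> hB [p0 ap0 aE].
have asub : a `<=` above by rewrite -aE; exact: connected_component_sub.
have acon : connected a by rewrite -aE; exact: component_connected.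
have a0 : a p0 by rewrite -aE; exact: connected_component_refl.
pose f p := [set y | \forall q \near p, regular q -> h (comp q) = y].
have fE p y : above p -> f p y -> f p = [set y].
  move=> abp fy; apply/seteqP; split=> [y' fy'|_ ->] //=.
  have [q [rq [e1 e2]]] := regular_dense abp (filterI fy fy').
  by rewrite -(e1 rq) -(e2 rq).
have lc p : a p -> \forall q \near p, a q -> f q = f p.
  move=> ap; have [y fy] := local_sheet_value hB (asub p ap).
  have fy2 : \forall q \near p, f q y by exact: nbhs_interior fy.
  apply: filterS fy2 => q fqy aq.
  by rewrite (fE q y (asub q aq) fqy) (fE p y (asub p ap) fy).
have [y0 fy0] := local_sheet_value hB ap0; exists y0 => p ap rp.
have := locally_constant_connected acon lc a0 ap.
rewrite (fE p0 y0 ap0 fy0) => E; have fpy : f p y0 by rewrite E.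
exact: (nbhs_singleton fpy).
Qed.

(** * Values of a section behind semi-sheets *)

Section Values.
Variables (G : Type) (T : set 'rV[R]_4 -> G -> G) (tau : 'rV[R]_3 -> G).
Hypothesis gtau : good D T setT tau.

Definition value_behind p (g : G) := forall n, normal_vec D p n ->
  \forall t \near 0^'+, tau (pr p - t *: n) = g.

Lemma value_behind_lift (c : chart R) wall lft i w x : planes D c wall lft ->
  on_wall c wall i w -> off_others wall i w -> 0 < x < rad c ->
  value_behind (lft i w) (tau (point c (upd w i (- x)))).
Proof.
move=> pc onw ow /andP[x0 xr] n pn; have [wi bw w0] := onw.
rewrite (lift_proj pc) //.
apply: filterS (normal_sides pc onw pn (near_sides w)) => t [w1 [w2 [_ [b2 e2 s2 P2]]]].
rewrite -e2; apply: (good_const pc (W := setT) _ gtau) => //.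
  by apply: box_upd => //; rewrite normrN gtr0_norm.
move=> k wk; rewrite updE; case: eqP => [->|/eqP ki].
  by rewrite mulrN oppr_gt0 pmulr_llt0.
by rewrite mulrC; apply: P2; exact: ow.
Qed.

Lemma value_behind_uniq p g g' : S p -> value_behind p g -> value_behind p g' -> g = g'.
Proof.
move=> Sp vg vg'; have [n pn] := normal_vec_ex Sp.
by have [t [_ <- <-]] := right_ex (vg n pn) (vg' n pn).
Qed.

Lemma value_behind_near p : regular p ->
  exists g, \forall q \near p, regular q -> value_behind q g.
Proof.
move=> rp; have [c [wall [lft [i [pc wi c0 pE]]]]] := regular_chart rp.
have r0 := rad_gt0 c; have b0 : box (rad c) 0 by exact: box0.
have z0 : (0 : 'rV[R]_3) 0 i = 0 by rewrite mxE.
rewrite pE in rp; have off0 : off_others wall i (0 : 'rV[R]_3) by apply: (regular_off pc).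
have hr : 0 < rad c / 2 < rad c by rewrite divr_gt0 //=; lra.
exists (tau (point c (upd 0 i (- (rad c / 2))))).
rewrite pE; apply: filterS (lift_near pc wi b0 z0) => q Hq rq.
have [w [bw w0 qE]] := Hq rq.1; rewrite qE in rq *.
have onw : on_wall c wall i w by [].
have H := value_behind_lift pc onw (regular_off pc onw rq) hr.
rewrite (good_const pc (W := setT) _ gtau (w := upd 0 i _) (w' := upd w i (- (rad c / 2)))) //.
- by apply: box_upd => //; have /andP[? ?] := hr; rewrite normrN gtr0_norm.
- by apply: box_upd => //; have /andP[? ?] := hr; rewrite normrN gtr0_norm.
move=> k wk; have [->|ki] := eqVneq k i.
  by rewrite !upd_same mulrNN mulr_gt0 // divr_gt0.
by have := off0 k wk ki; rewrite mxE eqxx.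
Qed.

Lemma component_value A : is_component regular A ->
  exists g, forall p, A p -> value_behind p g.
Proof.
move=> [p0 rp0 AE].
have Areg : A `<=` regular by rewrite -AE; exact: connected_component_sub.
have Acon : connected A by rewrite -AE; exact: component_connected.
have Ap0 : A p0 by rewrite -AE; exact: connected_component_refl.
pose f p := [set g | value_behind p g].
have fE p g : regular p -> value_behind p g -> f p = [set g].
  move=> rp vg; apply/seteqP; split=> [g'|_ ->] //= vg'.
  exact: value_behind_uniq rp.1 vg' vg.
have lc p : A p -> \forall q \near p, A q -> f q = f p.
  move=> Ap; have [g gP] := value_behind_near (Areg p Ap).
  have gp := nbhs_singleton gP (Areg p Ap).
  apply: filterS gP => q Hq Aq; have rq := Areg q Aq.
  by rewrite (fE q g rq (Hq rq)) (fE p g (Areg p Ap) gp).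
have [g0 gP] := value_behind_near rp0; have g0p := nbhs_singleton gP rp0.
exists g0 => p Ap; have := locally_constant_connected Acon lc Ap0 Ap.
rewrite (fE p0 g0 rp0 g0p) => E; have : f p g0 by rewrite E.
by [].
Qed.

Definition comp_value A g := forall p, A p -> value_behind p g.

Lemma comp_value_comp p g : regular p -> value_behind p g -> comp_value (comp p) g.
Proof.
move=> rp vg; have [g' g'P] := component_value (comp_component rp).
have := g'P p (comp_refl rp) => vg'.
by rewrite (value_behind_uniq rp.1 vg vg').
Qed.

(** [g] is the value of [tau] in the quadrant behind both sheets. Behind each of the two semi-sheets
    beyond the double curve lies the quadrant reached from there by crossing the other sheet. *)
Lemma double_values p q A A' B B' : double_point D p q ->
  is_component regular A -> is_component regular A' ->
  is_component regular B -> is_component regular B' ->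
  behind D p q A -> ahead D p q A' -> behind D q p B -> ahead D q p B' ->
  exists g, [/\ comp_value A g, comp_value B g, comp_value A' (T B g) & comp_value B' (T A g)].
Proof.
move=> dp cA cA' cB cB' bA aA' bB aB'.
have [c [wall [lft [i [j [pc [oi oj] ij ow [pE qE]]]]]]] := double_chart dp.
rewrite pE qE in bA aA' bB aB'.
have ji : j != i by rewrite eq_sym.
have ow' : off_both wall j i (0 : 'rV[R]_3) by move=> k wk kj ki; exact: ow.
have r0 := rad_gt0 c; pose h := rad c / 2.
have h0 : 0 < h by rewrite divr_gt0.
have hr : h < rad c by rewrite /h; lra.
have hh : 0 < h < rad c by rewrite h0.
have nh : `|- h| < rad c by rewrite normrN gtr0_norm.
have ph : `|h| < rad c by rewrite gtr0_norm.
have AE := behind_uniq pc oi oj ij ow hh cA bA.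
have A'E := ahead_uniq pc oi oj ij ow hh cA' aA'.
have BE := behind_uniq pc oj oi ji ow' hh cB bB.
have B'E := ahead_uniq pc oj oi ji ow' hh cB' aB'.
pose g := tau (point c (upd (upd 0 i (- h)) j (- h))).
have comm a b x x' : a != b -> upd (upd (0 : 'rV[R]_3) a x) b x' = upd (upd 0 b x') a x.
  move=> ab; apply/rowP => k; rewrite !updE; case: eqP => [->|//].
  by rewrite eq_sym (negbTE ab).
have lift_on a b x : on_wall c wall a 0 -> a != b -> `|x| < rad c ->
    on_wall c wall a (upd 0 b x) by move=> oa ab xr; exact: upd_on_wall.
have lift_off a b (x : R) : off_both wall a b (0 : 'rV[R]_3) -> x != 0 ->
  off_others wall a (upd 0 b x).
  by move=> oab x0; exact: (upd_off oab x0).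
have h_n0 : h != 0 by rewrite gt_eqF.
have nh_n0 : - h != 0 by rewrite oppr_eq0.
have val a b x : on_wall c wall a 0 -> a != b -> off_both wall a b (0 : 'rV[R]_3) ->
  `|x| < rad c -> x != 0 ->
    comp_value (comp (lft a (upd 0 b x))) (tau (point c (upd (upd 0 b x) a (- h)))).
  move=> oa ab oab xr x0; apply: comp_value_comp.
    by apply: (lift_regular pc); [exact: lift_on|exact: lift_off].
  by apply: (value_behind_lift pc) => //; [exact: lift_on|exact: lift_off].
have cross a b : on_wall c wall a 0 -> a != b -> off_both wall a b (0 : 'rV[R]_3) ->
    tau (point c (upd (upd 0 b (- h)) a h)) =
    T (comp (lft a (upd 0 b (- h)))) (tau (point c (upd (upd 0 b (- h)) a (- h)))).
  move=> oa ab oab; apply: (good_cross pc (W := setT) _ gtau) => //.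
  - exact: lift_on.
  - exact: lift_off.
  - by rewrite oppr_lt0 h0.
exists g; split.
- by rewrite AE /g comm //; exact: val.
- by rewrite BE /g; exact: val.
- have := val i j h oi ij ow ph h_n0; rewrite -A'E comm 1?eq_sym //.
  by rewrite (cross j i) // -BE.
- have := val j i h oj ji ow' ph h_n0; rewrite -B'E comm //.
  by rewrite (cross i j) // -AE /g comm // eq_sym.
Qed.

End Values.
End Sheets.

(** * The correspondence *)

Section BiquandleAlgebra.
Variable X : biquandle.
Implicit Types x y z a b : X.

Lemma over_inj a : injective (fun x => biq_over x a).
Proof. exact: bij_inj (over_bij a). Qed.

Lemma assoc_opE x y : biq_over (assoc_op x y) y = biq_under x y.
Proof. by rewrite /assoc_op over_invK. Qed.

(** After translation by [biq_over y a] this follows from [over_over] and [under_over]. It is what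
    lets the transport stay among automorphisms. *)
Lemma over_assoc_op x y a :
  biq_over (assoc_op x y) a = assoc_op (biq_over x a) (biq_over y a).
Proof.
apply: (over_inj (a := biq_over y a)).
by rewrite over_over assoc_opE under_over assoc_opE.
Qed.

(* If [x] under [y] equals [y] over [x], then [over_over] makes the
   translations by [x] and by [y] coincide, which forces [x = y]. *)
Lemma over_diag_bij : bijective (fun x => biq_over x x).
Proof.
have [h hK Kh] := bqd_switch_bij X.
have diag z : exists x, biq_over x x = z.
  have := Kh (z, z); case: (h (z, z)) => x y /= [yx xy]; exists x.
  have Exy t : biq_over t x = biq_over t y.
    by apply: (over_inj (a := z)); rewrite -{1}yx -xy over_over.
  have xEy : x = y.
    apply: (bij_inj (under_bij y)); rewrite /= xy bqd_diag -yx; exact: Exy.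
  by rewrite -yx -xEy.
have /choice [g gP] := diag; exists g => // x.
have := hK (g (biq_over x x), g (biq_over x x)); have := hK (x, x).
by rewrite /= !bqd_diag !gP => -> [].
Qed.

Definition is_aut (f : X -> X) := bijective f /\
  forall x y, f (assoc_op x y) = assoc_op (f x) (f y).

Definition aut := {f : X -> X | is_aut f}.

Lemma aut_eq (f g : aut) : (forall x, sval f x = sval g x) -> f = g.
Proof.
by case: f g => [f Hf] [g Hg] /= /funext E; subst g; congr exist; exact: Prop_irrelevance.
Qed.

Lemma aut_inj (f : aut) : injective (sval f).
Proof. by case: f => f [bf hf]; exact: bij_inj bf. Qed.

Lemma aut_assoc_op (f : aut) x y : sval f (assoc_op x y) = assoc_op (sval f x) (sval f y).
Proof. by case: f => f [bf hf]; exact: hf. Qed.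

Lemma aut_surj (f : aut) y : exists x, sval f x = y.
Proof. by case: f => f [[g gK Kg] hf]; exists (g y); exact: Kg. Qed.

Lemma id_is_aut : is_aut id.
Proof. by split=> //; exists id. Qed.

Definition id_aut : aut := exist _ id id_is_aut.

Lemma shift_is_aut a (g : aut) : is_aut (fun x => biq_over (sval g x) a).
Proof.
case: g => g [bg hg]; split=> /=; last by move=> x y; rewrite hg over_assoc_op.
exact: (bij_comp (over_bij a) bg).
Qed.

Definition shift a (g : aut) : aut := exist _ _ (shift_is_aut a g).

Lemma unshift_is_aut a (g : aut) : is_aut (fun x => over_inv (sval g x) a).
Proof.
case: g => g [bg hg]; split=> /=.
  have bo : bijective (fun y => over_inv y a).
    by exists (fun y => biq_over y a) => y; rewrite ?over_invK ?overK.
  exact: (bij_comp bo bg).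
move=> x y; apply: (over_inj (a := a)).
by rewrite over_assoc_op !over_invK hg.
Qed.

Definition unshift a (g : aut) : aut := exist _ _ (unshift_is_aut a g).

Lemma shift_bij a : bijective (shift a).
Proof.
by exists (unshift a) => g; apply: aut_eq => x /=; rewrite ?overK ?over_invK.
Qed.

(** The image of [g] takes at [v] the value [biq_over x x], where [x] is [sval g v]; [over_diag_bij]
    recovers [x], and with it the translation to be undone. *)
Lemma self_shift_bij v : bijective (fun g => shift (sval g v) g).
Proof.
have [d dK Kd] := over_diag_bij.
exists (fun g => unshift (d (sval g v)) g) => g; apply: aut_eq => x /=.
  by rewrite dK overK.
have E : over_inv (sval g v) (d (sval g v)) = d (sval g v).
  by apply: (over_inj (a := d (sval g v))); rewrite over_invK Kd.
by rewrite E over_invK.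
Qed.

Lemma shift_square a b g :
  shift (biq_over b a) (shift a g) = shift (biq_under a b) (shift b g).
Proof. by apply: aut_eq => x /=; rewrite over_over. Qed.

End BiquandleAlgebra.

(** * Pairs of colorings that share a section *)

Section Correspondence.
Variables (R : realType) (X : biquandle) (D : diagram R).
Local Notation S := (surf D).
Local Notation pr p := (p *m projmx D).
Local Notation regular := (regular D).
Local Notation above := (above D).
Local Notation comp := (comp D).
Local Notation shadow := (shadow D).
Implicit Types (p q : 'rV[R]_4) (s : semi_sheet D) (a : sheet D) (g : aut X).

Lemma semi_component s : is_component regular (sval s).
Proof. exact: (svalP s). Qed.

Lemma sheet_component a : is_component above (sval a).
Proof. exact: (svalP a). Qed.

Definition semi_of p (rp : regular p) : semi_sheet D :=
  exist _ (comp p) (comp_component rp).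

Lemma semi_eq s s' : sval s = sval s' -> s = s'.
Proof.
by case: s s' => [A HA] [B HB] /= E; subst B; congr exist; exact: Prop_irrelevance.
Qed.

Lemma sheet_eq a a' : sval a = sval a' -> a = a'.
Proof.
by case: a a' => [A HA] [B HB] /= E; subst B; congr exist; exact: Prop_irrelevance.
Qed.

Lemma semi_regular s p : sval s p -> regular p.
Proof. by have [q rq <-] := semi_component s; exact: connected_component_sub. Qed.

Lemma sheet_ex s : exists a : sheet D, sval s `<=` sval a.
Proof.
have [p rp sE] := semi_component s.
have ap := regular_above rp.
have ca : is_component above (connected_component above p) by exists p.
exists (exist _ (connected_component above p) ca) => q /= sq.
rewrite -sE in sq.
have := @connected_component_max _ above (comp p) p (comp_refl rp).
apply => //; last exact: component_connected.
by move=> z /connected_component_sub; exact: regular_above.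
Qed.

Definition sheet_of s : sheet D := sval (cid (sheet_ex s)).

Lemma sheet_of_sub s : sval s `<=` sval (sheet_of s).
Proof. exact: svalP (cid (sheet_ex s)). Qed.

Lemma sheet_meet a a' p : sval a p -> sval a' p -> a = a'.
Proof.
move=> ap a'p; apply: sheet_eq.
by rewrite (component_eq (sheet_component a) ap) (component_eq (sheet_component a') a'p).
Qed.

Lemma sheet_of_eq s a p : sval s p -> sval a p -> a = sheet_of s.
Proof. by move=> sp ap; apply: sheet_meet ap _; exact: sheet_of_sub. Qed.

Lemma sheet_semi_ex a : exists s p, sval s p /\ sval a p.
Proof.
have [p ap aE] := sheet_component a.
have [q [rq Hq]] := regular_dense ap (sheet_near ap).
exists (semi_of rq), q; split; first exact: comp_refl.
by rewrite -aE; apply: Hq; case: rq.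
Qed.

Lemma double_semi p q : double_point D p q -> exists si sj sk sl : semi_sheet D,
  [/\ behind D p q (sval si), behind D q p (sval sj), ahead D p q (sval sk) &
      ahead D q p (sval sl)].
Proof.
move=> dp; have [c [wall [lft [i [j [pc [oi oj] ij ow [pE qE]]]]]]] := double_chart dp.
rewrite pE qE; have ji : j != i by rewrite eq_sym.
have ow' : off_both wall j i (0 : 'rV[R]_3) by move=> k wk kj ki; exact: ow.
have r0 := rad_gt0 c; pose h := rad c / 2.
have h0 : 0 < h by rewrite divr_gt0.
have hh : 0 < h < rad c by rewrite h0 /h; lra.
have rg e k l : on_wall c wall k 0 -> k != l -> off_both wall k l (0 : 'rV[R]_3) ->
    regular (lft k (upd 0 l (if e then h else - h))).
  move=> ok kl okl; apply: (lift_regular pc).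
    by apply: (upd_on_wall ok kl); case: e; rewrite ?normrN gtr0_norm //; case/andP: hh.
  by apply: (upd_off okl); case: e; rewrite ?oppr_eq0 gt_eqF.
exists (semi_of (rg false i j oi ij ow)), (semi_of (rg false j i oj ji ow')),
  (semi_of (rg true i j oi ij ow)), (semi_of (rg true j i oj ji ow')).
split => /=.
- exact: (behind_comp pc).
- exact: (behind_comp pc).
- exact: (ahead_comp pc).
- exact: (ahead_comp pc).
Qed.

(** The coloring rule admits any sheet lying behind along some crossing curve; a common point
    identifies it with the sheet that contains the semi-sheet. *)
Lemma behind_common p q s a : double_point D p q -> behind D p q (sval s) ->
  behind D p q (sval a) -> exists p', sval s p' /\ sval a p'.
Proof.
move=> dp bs ba; have [c [wall [lft [i [j [pc [oi oj] ij ow [pE qE]]]]]]] := double_chart dp.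
rewrite pE qE in bs ba; have r0 := rad_gt0 c; pose h := rad c / 2.
have h0 : 0 < h by rewrite divr_gt0.
have hr : h < rad c by rewrite /h; lra.
have hh : 0 < h < rad c by rewrite h0.
have [w [ow' wj ss aw]] := behind_in pc oi oj ij ba; exists (lft i w); split => //.
rewrite (behind_uniq pc oi oj ij ow hh (semi_component s) bs).
rewrite -(comp_axis pc oi ij ow ow' ss) ?normrN ?gtr0_norm //; last first.
  by rewrite mulrN oppr_gt0 pmulr_llt0.
apply: comp_refl; apply: (lift_regular pc ow') => k wk ki.
have [->|kj] := eqVneq k j; first by rewrite lt_eqF.
by have := ow k wk ki kj; rewrite mxE eqxx.
Qed.

Lemma ahead_common p q s a : double_point D p q -> ahead D p q (sval s) ->
  ahead D p q (sval a) -> exists p', sval s p' /\ sval a p'.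
Proof.
move=> dp bs ba; have [c [wall [lft [i [j [pc [oi oj] ij ow [pE qE]]]]]]] := double_chart dp.
rewrite pE qE in bs ba; have r0 := rad_gt0 c; pose h := rad c / 2.
have h0 : 0 < h by rewrite divr_gt0.
have hr : h < rad c by rewrite /h; lra.
have hh : 0 < h < rad c by rewrite h0.
have [w [ow' wj ss aw]] := ahead_in pc oi oj ij ba; exists (lft i w); split => //.
rewrite (ahead_uniq pc oi oj ij ow hh (semi_component s) bs).
rewrite -(comp_axis pc oi ij ow ow' ss) ?gtr0_norm //; last exact: mulr_gt0.
apply: comp_refl; apply: (lift_regular pc ow') => k wk ki.
have [->|kj] := eqVneq k j; first by rewrite gt_eqF.
by have := ow k wk ki kj; rewrite mxE eqxx.
Qed.

Lemma crossing_near p q cv (P : set 'rV[R]_4) : crossing_curve D p q cv -> nbhs p P ->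
  \forall t \near (0 : R), P (cv t) /\ S (cv t).
Proof.
move=> [cv0 Scv dcv _] pP; rewrite -cv0 in pP.
have dc : differentiable cv 0 by exact/derivable1_diffP.
have H : nbhs (0 : R) [set t | P (cv t)] by exact: (differentiable_continuous dc pP).
exact: filterI.
Qed.

Lemma behind_near p q (B P : set 'rV[R]_4) : behind D p q B -> nbhs p P ->
  exists r, [/\ B r, S r & P r].
Proof.
move=> [cv cvP Bcv] pP; have H := crossing_near cvP pP.
have N : nbhs (- (0 : R)) [set t | P (cv t) /\ S (cv t)] by rewrite oppr0.
have C : (fun t : R => - t) @ (0 : R) --> - (0 : R) by apply: cvgN; exact: cvg_id.
have N2 : nbhs (0 : R) [set t | P (cv (- t)) /\ S (cv (- t))] := C _ N.
by have [t [_ Bt [Pt St]]] := right_ex Bcv (near_right N2); exists (cv (- t)).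
Qed.

Lemma ahead_near p q (B P : set 'rV[R]_4) : ahead D p q B -> nbhs p P ->
  exists r, [/\ B r, S r & P r].
Proof.
move=> [cv cvP Bcv] pP; have H := crossing_near cvP pP.
by have [t [_ Bt [Pt St]]] := right_ex Bcv (near_right H); exists (cv t).
Qed.

Lemma upper_common_behind p q s a : double_point D p q -> behind D q p (sval s) ->
  sval a q -> exists r, sval s r /\ sval a r.
Proof.
move=> dp bs aq; have [r [sr Sr Hr]] := behind_near bs (sheet_near (upper_above dp)).
by exists r; split => //; rewrite (component_eq (sheet_component a) aq); exact: Hr.
Qed.

Lemma upper_common_ahead p q s a : double_point D p q -> ahead D q p (sval s) ->
  sval a q -> exists r, sval s r /\ sval a r.
Proof.
move=> dp bs aq; have [r [sr Sr Hr]] := ahead_near bs (sheet_near (upper_above dp)).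
by exists r; split => //; rewrite (component_eq (sheet_component a) aq); exact: Hr.
Qed.

Lemma behind_sub p q (A B : set 'rV[R]_4) : A `<=` B -> behind D p q A -> behind D p q B.
Proof. by move=> AB [cv cvP H]; exists cv => //; apply: filterS H => t; exact: AB. Qed.

Lemma ahead_sub p q (A B : set 'rV[R]_4) : A `<=` B -> ahead D p q A -> ahead D p q B.
Proof. by move=> AB [cv cvP H]; exists cv => //; apply: filterS H => t; exact: AB. Qed.

(** Transports are indexed by all subsets of R^4; the identity is the default outside the
    semi-sheets. *)
Definition transport (F : semi_sheet D -> aut X -> aut X) (A : set 'rV[R]_4) : aut X -> aut X :=
  if pselect (is_component regular A) is left H then F (exist _ A H) else id.

Lemma transportE F s : transport F (sval s) = F s.
Proof.
rewrite /transport; case: pselect => [H|nH]; last by case: nH; exact: semi_component.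
by congr F; exact: semi_eq.
Qed.

Lemma transport_bij F : (forall s, bijective (F s)) -> T_bij D (transport F).
Proof.
move=> bF A cA; pose s : semi_sheet D := exist _ A cA.
by rewrite -[A]/(sval s) transportE.
Qed.

Lemma transport_square F :
  (forall p q, double_point D p q -> forall si sj sk sl : semi_sheet D,
    behind D p q (sval si) -> behind D q p (sval sj) ->
    ahead D p q (sval sk) -> ahead D q p (sval sl) ->
    forall g, F sl (F si g) = F sk (F sj g)) -> square_rule D (transport F).
Proof.
move=> sq p q A A' B B' dp cA cA' cB cB' bA aA' bB aB' g.
pose sA : semi_sheet D := exist _ A cA; pose sA' : semi_sheet D := exist _ A' cA'.
pose sB : semi_sheet D := exist _ B cB; pose sB' : semi_sheet D := exist _ B' cB'.
rewrite -[A]/(sval sA) -[A']/(sval sA') -[B]/(sval sB) -[B']/(sval sB') !transportE.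
exact: (sq p q dp).
Qed.

(** Only the action on the value found behind each semi-sheet matters. This lets a biquandle
    coloring and its quandle coloring share the same [tau]. *)
Lemma good_transport F F' tau : good D (transport F) setT tau ->
  (forall s g, comp_value D tau (sval s) g -> F s g = F' s g) ->
  good D (transport F') setT tau.
Proof.
move=> gtau FF'; have [g1 g2] := gtau; split => // p n rp _ pn.
have [g gP] := component_value gtau (semi_component (semi_of rp)).
have gp := gP p (comp_refl rp) n pn.
apply: filterS2 gp (g2 p n rp I pn) => t tg ->.
by rewrite -[comp p]/(sval (semi_of rp)) !transportE tg FF'.
Qed.

Variable y0 : 'rV[R]_3.
Hypothesis ny0 : ~ shadow y0.

Definition under_action (C : semi_sheet D -> X) s := shift (C s).

Definition quandle_action (c : sheet D -> X) s g := shift (sval g (c (sheet_of s))) g.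

(* [tau] is the transformation carried by the regions of the complement of the
   projected surface; the quandle color of a sheet is moved by the value of
   [tau] behind a semi-sheet to the biquandle color of that semi-sheet. *)
Definition related (C : semi_sheet D -> X) (c : sheet D -> X) tau :=
  [/\ good D (transport (under_action C)) setT tau, tau y0 = id_aut X &
      forall s g, comp_value D tau (sval s) g -> sval g (c (sheet_of s)) = C s].

Lemma under_bij_action C : T_bij D (transport (under_action C)).
Proof. by apply: transport_bij => s; exact: shift_bij. Qed.

Lemma quandle_bij_action c : T_bij D (transport (quandle_action c)).
Proof. by apply: transport_bij => s; exact: self_shift_bij. Qed.

Lemma under_square C : is_biquandle_coloring C ->
  square_rule D (transport (under_action C)).
Proof.
move=> colC; apply: transport_square => p q dp si sj sk sl bi bj ak al g.
have [E1 E2] := colC p q dp si sj sk sl bi bj ak al.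
by rewrite /under_action -E1 -E2; exact: shift_square.
Qed.

Lemma upper_sheets p q sj sl : double_point D p q -> behind D q p (sval sj) ->
  ahead D q p (sval sl) -> sheet_of sj = sheet_of sl /\ sval (sheet_of sj) q.
Proof.
move=> dp bj al; have aq := upper_above dp.
have ca : is_component above (connected_component above q) by exists q.
pose a : sheet D := exist _ (connected_component above q) ca.
have aa : sval a q by exact: connected_component_refl.
have [r [jr ar]] := upper_common_behind dp bj aa.
have [r' [lr' ar']] := upper_common_ahead dp al aa.
by rewrite -(sheet_of_eq jr ar) -(sheet_of_eq lr' ar').
Qed.

Lemma lower_sheets p q si sj sk (c : sheet D -> assoc_quandle X) : is_quandle_coloring c ->
  double_point D p q -> behind D p q (sval si) -> behind D q p (sval sj) ->
  ahead D p q (sval sk) ->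
  c (sheet_of sk) = assoc_op (c (sheet_of si)) (c (sheet_of sj)).
Proof.
move=> colc dp bi bj ak.
have [_ [_ [_ [sl [_ _ _ al]]]]] := double_semi dp.
have [_ jq] := upper_sheets dp bj al.
apply/esym; apply: (colc p q dp _ _ _ _ jq).
  by apply: behind_sub bi; exact: sheet_of_sub.
by apply: ahead_sub ak; exact: sheet_of_sub.
Qed.

(** Let [g] move the colors of the sheets of [si] and [sj] to [a] and [b]. After crossing [si] the
    color at [sl] is moved to [biq_over b a]; after crossing [sj] the color at [sk] is moved to
    [biq_over (assoc_op a b) b], that is [biq_under a b]. *)
Lemma quandle_square (c : sheet D -> assoc_quandle X) : is_quandle_coloring c ->
  square_rule D (transport (quandle_action c)).
Proof.
move=> colc; apply: transport_square => p q dp si sj sk sl bi bj ak al g.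
rewrite /quandle_action /= -(upper_sheets dp bj al).1 (lower_sheets colc dp bi bj ak).
by rewrite aut_assoc_op assoc_opE; exact: shift_square.
Qed.

Lemma related_quandle C : is_biquandle_coloring C ->
  exists (c : sheet D -> assoc_quandle X) tau, is_quandle_coloring c /\ related C c tau.
Proof.
move=> colC.
have [tau [gtau tau0]] := monodromy (@under_bij_action C) (under_square colC) (id_aut X) ny0.
(* The candidate quandle color, kept as a set so that [h] is defined on all subsets. *)
pose h A := [set x | exists s g, [/\ sval s = A, comp_value D tau A g & sval g x = C s]].
have hE s g : comp_value D tau (sval s) g -> h (sval s) = [set x | sval g x = C s].
  move=> vg; apply/seteqP; split=> x /=; last by move=> gx; exists s, g.
  move=> [s' [g' [/semi_eq -> vg' <-]]].
  have [p rp sE] := semi_component s.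
  have sp : sval s p by rewrite -sE; exact: comp_refl.
  by rewrite (value_behind_uniq rp.1 (vg p sp) (vg' p sp)).
(* Across the double curve both the value of [tau] and the color of the upper semi-sheet are
   translated by the color of the same lower semi-sheet, and the translation cancels. *)
have hB q r B B' : double_point D q r -> is_component regular B ->
    is_component regular B' -> behind D r q B -> ahead D r q B' -> h B = h B'.
  move=> dp cB cB' bB aB'.
  have [si [_ [sk [_ [bi _ ak _]]]]] := double_semi dp.
  pose sB : semi_sheet D := exist _ B cB; pose sB' : semi_sheet D := exist _ B' cB'.
  have [g [_ vB _ vB']] := double_values gtau dp (semi_component si) (semi_component sk)
    cB cB' bi ak bB aB'.
  rewrite transportE in vB'.
  rewrite -[B]/(sval sB) -[B']/(sval sB') (hE sB g vB) (hE sB' _ vB').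
  have [_ E] := colC q r dp si sB sk sB' bi bB ak aB'.
  apply/seteqP; split=> x /=; rewrite -E; first by move=> ->.
  exact: over_inj.
have /choice [c cP] : forall a : sheet D, exists x : X, forall s p, sval s p -> sval a p ->
    forall g, comp_value D tau (sval s) g -> sval g x = C s.
  move=> a; have [y yP] := sheet_value hB (sheet_component a).
  have hy s p : sval s p -> sval a p -> h (sval s) = y.
    move=> sp ap; rewrite (component_eq (semi_component s) sp).
    by apply: yP => //; exact: semi_regular sp.
  have [s0 [p0 [s0p a0p]]] := sheet_semi_ex a.
  have [g0 vg0] := component_value gtau (semi_component s0).
  have [x xP] := aut_surj g0 (C s0); exists x => s p sp ap g vg.
  have yx : y x by rewrite -(hy s0 p0 s0p a0p) (hE s0 g0 vg0).
  by move: yx; rewrite -(hy s p sp ap) (hE s g vg).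
exists c, tau; split; last first.
  split => // s g vg; have [p rp sE] := semi_component s.
  have sp : sval s p by rewrite -sE; exact: comp_refl.
  exact: (cP (sheet_of s) s p sp (sheet_of_sub sp) g vg).
move=> p q dp ai aj ak bi jq akk.
have [si [sj [sk [sl [bsi bsj ask asl]]]]] := double_semi dp.
have [g [vi vj vk _]] := double_values gtau dp (semi_component si) (semi_component sk)
  (semi_component sj) (semi_component sl) bsi ask bsj asl.
rewrite transportE in vk.
have [ri [sri ari]] := behind_common dp bsi bi.
have [rk [srk ark]] := ahead_common dp ask akk.
have [rj [srj arj]] := upper_common_behind dp bsj jq.
have Ei := cP ai si ri sri ari g vi.
have Ej := cP aj sj rj srj arj g vj.
have := cP ak sk rk srk ark _ vk; rewrite /= => Ek.
have [Eu _] := colC p q dp si sj sk sl bsi bsj ask asl.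
(* The equality is checked after applying [g] and translating by [C sj], which turns [assoc_op] into
   [biq_under]. *)
apply: (@aut_inj _ g); apply: (over_inj (a := C sj)); rewrite Ek -Eu.
by rewrite aut_assoc_op Ei Ej assoc_opE.
Qed.

Lemma related_biquandle (c : sheet D -> assoc_quandle X) : is_quandle_coloring c ->
  exists C tau, is_biquandle_coloring C /\ related C c tau.
Proof.
move=> colc.
have [tau [gtau tau0]] := monodromy (@quandle_bij_action c) (quandle_square colc) (id_aut X) ny0.
have /choice [v vP] : forall s, exists g, comp_value D tau (sval s) g.
  by move=> s; have [g gP] := component_value gtau (semi_component s); exists g.
have vE s g : comp_value D tau (sval s) g -> v s = g.
  move=> vg; have [p rp sE] := semi_component s.
  have sp : sval s p by rewrite -sE; exact: comp_refl.
  exact: value_behind_uniq rp.1 (vP s p sp) (vg p sp).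
pose C s := sval (v s) (c (sheet_of s)).
exists C, tau; split; last first.
  split => //; last by move=> s g /vE <-.
  by apply: good_transport gtau _ => s g /vE E; rewrite /under_action /quandle_action /C E.
move=> p q dp si sj sk sl bi bj ak al.
have [g [vi vj vk vl]] := double_values gtau dp (semi_component si) (semi_component sk)
  (semi_component sj) (semi_component sl) bi ak bj al.
rewrite !transportE in vk vl.
rewrite /C (vE _ _ vi) (vE _ _ vj) (vE _ _ vk) (vE _ _ vl) /=.
by rewrite -(upper_sheets dp bj al).1 (lower_sheets colc dp bi bj ak) aut_assoc_op assoc_opE.
Qed.

Lemma comp_value_eq tau tau' s g : (forall z, ~ shadow z -> tau z = tau' z) ->
  comp_value D tau (sval s) g -> comp_value D tau' (sval s) g.
Proof.
move=> E vg p sp n pn; have rp := semi_regular sp.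
by apply: filterS2 (vg p sp n pn) (normal_off_shadow rp pn) => t <- [_ n2]; rewrite E.
Qed.

Lemma related_unique_quandle C c c' tau tau' : is_biquandle_coloring C ->
  related C c tau -> related C c' tau' -> c = c'.
Proof.
move=> colC [gtau tau0 H] [gtau' tau0' H']; apply/funext => a.
have [s [p [sp ap]]] := sheet_semi_ex a.
rewrite (sheet_of_eq sp ap).
have E0 : tau y0 = tau' y0 by rewrite tau0 tau0'.
have E := good_unique_global (@under_bij_action C) (under_square colC) ny0 gtau gtau' E0.
have [g vg] := component_value gtau (semi_component s).
by apply: (@aut_inj _ g); rewrite (H s g vg) (H' s g (comp_value_eq E vg)).
Qed.

(** At first [tau] and [tau'] are sections of different transports, given by [C] and [C']; through
    [c] both become sections of [quandle_action c], and they agree at [y0]. *)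
Lemma related_unique_biquandle C C' (c : sheet D -> assoc_quandle X) tau tau' :
  is_quandle_coloring c -> related C c tau -> related C' c tau' -> C = C'.
Proof.
move=> colc [gtau tau0 H] [gtau' tau0' H']; apply/funext => s.
have E0 : tau y0 = tau' y0 by rewrite tau0 tau0'.
have change B sigma : good D (transport (under_action B)) setT sigma ->
    (forall s g, comp_value D sigma (sval s) g -> sval g (c (sheet_of s)) = B s) ->
    good D (transport (quandle_action c)) setT sigma.
  move=> gs HB; apply: good_transport gs _ => s' g vg.
  by rewrite /under_action /quandle_action HB.
have g1 := change C tau gtau H; have g2 := change C' tau' gtau' H'.
have E := good_unique_global (@quandle_bij_action c) (quandle_square colc) ny0 g1 g2 E0.
have [g vg] := component_value gtau (semi_component s).
by rewrite -(H s g vg) -(H' s g (comp_value_eq E vg)).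
Qed.

End Correspondence.

Theorem theorem7p1 (R : realType) (X : biquandle) (D : diagram R) :
  exists f : biquandle_coloring D X -> quandle_coloring D (assoc_quandle X),
    bijective f.
Proof.
have [y0 ny0] : exists y0, ~ shadow D y0.
  (* The trivial transport on a one-point set makes [shadow_dense] available, which yields a base
     point. *)
  have bT : T_bij D (fun _ => @id unit) by move=> A _; exists id.
  have sqT : square_rule D (fun _ => @id unit) by [].
  by have [y0 _ ny0] := shadow_dense bT sqT (@filterT _ _ (nbhs_filter (0 : 'rV[R]_3))); exists y0.
have /choice [f fP] : forall C : biquandle_coloring D X,
    exists c : quandle_coloring D (assoc_quandle X), exists tau, related y0 (sval C) (sval c) tau.
  move=> [C colC]; have [c [tau [colc rel]]] := related_quandle ny0 colC.
  by exists (exist _ c colc), tau.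
have /choice [h hP] : forall c : quandle_coloring D (assoc_quandle X),
    exists C : biquandle_coloring D X, exists tau, related y0 (sval C) (sval c) tau.
  move=> [c colc]; have [C [tau [colC rel]]] := related_biquandle ny0 colc.
  by exists (exist _ C colC), tau.
exists f; exists h => [C|c].
- have [tau rel] := fP C; have [tau' rel'] := hP (f C).
  have E := related_unique_biquandle ny0 (svalP (f C)) rel rel'.
  by apply: eq_sig_hprop; [move=> *; exact: Prop_irrelevance | rewrite -E].
- have [tau rel] := hP c; have [tau' rel'] := fP (h c).
  have E := related_unique_quandle ny0 (svalP (h c)) rel rel'.
  by apply: eq_sig_hprop; [move=> *; exact: Prop_irrelevance | rewrite -E].
Qed.
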